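(* Let $G$ be a finite abelian group with exponent $s\in\mathbb N$. Let $A$ be an $\ell\times k$ integer matrix which satisfies the $s$-columns condition, with $\mathrm{rank}_G(A)>0$ and such that $(A,G)$ is abundant. For all $r\ge2$ there exist constants $C,c>0$ such that $$\lim_{n\to\infty}\mathbb P\big[G^n_p\text{ is }(A,r)\text{-Rado}\big]=\begin{cases}0 & \text{if } p\le c\,|G|^{-n/m_G(A)};\\ 1 & \text{if } p\ge C\,|G|^{-n/m_G(A)}.\end{cases}$$
   Context: Integers act on an abelian group by repeated addition. The exponent of $G$ is the least $s\ge1$ with $sg=0$ for all $g\in G$. $G^n$ is the direct product, $G^n_p$ its random subset containing each element independently with probability $p$. A subset $S$ is $(A,r)$-Rado if every $r$-colouring of $S$ yields a monochromatic $x\in S^k$ with pairwise distinct entries and $Ax=0$. Columns condition over a commutative ring $R$: there is a partition $C_0,\dots,C_m$ of the columns of $A$ such that, with $s_i$ the sum of the columns in $C_i$, $s_0=0$ and each $s_i$ ($1\le i\le m$) is an $R$-linear combination of the columns in $C_0\cup\dots\cup C_{i-1}$. The $s$-columns condition is the columns condition over $\mathbb Z_s$ with entries of $A$ read modulo $s$. For an integer matrix $M$ with $k'$ columns and $\ell'$ rows and the map $f_M:G^{k'}\to G^{\ell'}$, $x\mapsto Mx$, set $\mathrm{rank}_G(M):=\log_{|G|}|\mathrm{im}(f_M)|$ if $|G|>1$ and $0$ if $|G|=1$; the matrix with no columns has rank $0$. $A_{\overline W}$ denotes the submatrix of columns indexed by $[k]\setminus W$. $(A,G)$ is abundant if every $\ell\times(k-2)$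 submatrix $A'$ of $A$ has $\mathrm{rank}_G(A')=\mathrm{rank}_G(A)$. Finally $m_G(A):=\max_{W\subseteq[k],|W|\ge2}\frac{|W|-1}{|W|-1+\mathrm{rank}_G(A_{\overline W})-\mathrm{rank}_G(A)}$. *)

(* Defs.v *)
From mathcomp Require Import all_boot all_order all_algebra.
From mathcomp Require Import all_classical all_reals all_analysis.

Set Implicit Arguments.
Unset Strict Implicit.
Unset Printing Implicit Defensive.

Import Order.TTheory GRing.Theory Num.Theory.
Import numFieldNormedType.Exports.

Local Open Scope ring_scope.

Definition is_exponent (G : zmodType) (s : nat) : Prop :=
  [/\ (0 < s)%N, forall g : G, g *+ s = 0
    & forall t : nat, (0 < t)%N -> (forall g : G, g *+ t = 0) -> (s <= t)%N].

Definition int_mul (T : zmodType) (l k : nat) (M : 'M[int]_(l, k))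
    (x : {ffun 'I_k -> T}) : {ffun 'I_l -> T} :=
  [ffun i => \sum_(j < k) x j *~ M i j].

(* The colouring is given on all of T; on S this yields every r-colouring of S
   as soon as r > 0. *)
Definition rado (T : finZmodType) (l k : nat) (A : 'M[int]_(l, k)) (r : nat)
    (S : {set T}) : bool :=
  [forall chi : {ffun T -> 'I_r},
    [exists x : {ffun 'I_k -> T},
      [&& [forall i, x i \in S],
          [exists c, [forall i, chi (x i) == c]],
          injectiveb x
        & int_mul A x == 0]]].

(* The law of the random subset of T containing each element independently with
   probability p. *)
Definition random_subset_prob (R : realType) (T : finType) (p : R)
    (E : pred {set T}) : R :=
  \sum_(S : {set T} | E S) p ^+ #|S| * (1 - p) ^+ #|~: S|.

Definition columns_condition (K : comPzRingType) (l k : nat)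
    (A : 'M[K]_(l, k)) : Prop :=
  exists (m : nat) (C : 'I_m.+1 -> {set 'I_k}),
    [/\ injective C,
        finset.partition [set C i | i : 'I_m.+1] [set: 'I_k],
        \sum_(j in C ord0) col j A = 0
      & forall i : 'I_m.+1, (0 < i)%N ->
          exists a : 'I_k -> K,
            \sum_(j in C i) col j A =
            \sum_(j in \bigcup_(i' < m.+1 | (i' < i)%N) C i') a j *: col j A].

(* 'Z_s is the ring of integers modulo s only for s > 1.  For the exponent s of
   G, this is the case as soon as some integer matrix has positive G-rank. *)
Definition s_columns_condition (s l k : nat) (A : 'M[int]_(l, k)) : Prop :=
  columns_condition (map_mx (intr : int -> 'Z_s) A).

Definition rankG (R : realType) (G : finZmodType) (l k : nat)
    (M : 'M[int]_(l, k)) : R :=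
  if (1 < #|G|)%N then
    ln #|[set int_mul M x | x : {ffun 'I_k -> G}]|%:R / ln #|G|%:R
  else 0.

Definition del_cols (l k : nat) (A : 'M[int]_(l, k)) (W : {set 'I_k}) :
    'M[int]_(l, #|~: W|) :=
  colsub (enum_val : 'I_#|~: W| -> 'I_k) A.

Definition abundant (R : realType) (G : finZmodType) (l k : nat)
    (A : 'M[int]_(l, k)) : Prop :=
  forall W : {set 'I_k}, #|W| = 2%N ->
    rankG R G (del_cols A W) = rankG R G A.

(* When (A, G) is abundant and k > 1, the denominators are at least 1 and the
   W with #|W| = 2 contribute the value 1, so that the default value 0 of the
   iterated maximum plays no role. *)
Definition mG (R : realType) (G : finZmodType) (l k : nat)
    (A : 'M[int]_(l, k)) : R :=
  \big[Num.max/0]_(W : {set 'I_k} | (2 <= #|W|)%N)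
    ((#|W|%:R - 1) /
     (#|W|%:R - 1 + rankG R G (del_cols A W) - rankG R G A)).

(* Main.v *)
(* Write N = |G|^n and let q = N^(-1/m), the threshold, so q = u^n.  For a set W
   of columns let nsol W be the number of solutions in G^k vanishing on W; in
   G^n it becomes (nsol W)^n, so all counts are exponential in n, and m is chosen
   so that the number of solutions through |W| given vertices is at most
   q^(|W|-1) times the average number of solutions through one vertex, with
   equality for some W; abundance and rank > 0 force |W| >= 3 there.

   1-statement.  Hales-Jewett, iterated along the columns condition, gives for
   every colouring a monochromatic solution onto which every solution of Ax = 0
   factors; averaging over homomorphisms into G^n shows that every (r+1)-colouring
   has a positive proportion of monochromatic solutions.  By the degree bounds the
   hypergraph of solutions has containers with fingerprints of size O(qN), and a
   union bound over the fingerprints of the r colour classes finishes.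

   0-statement.  Take W minimal attaining m.  If the projections to W of solutions
   inside the random set cannot be properly 2-coloured, take an edge-critical
   subfamily: for every edge e and v in e some edge h meets e exactly in v.
   Extending a maximal path of edges at its end then yields either a path of
   length linear in n, or a short sequence of edges closing up twice, once of them
   in exactly two vertices.  Attaching an edge in one vertex costs a constant < 1,
   in exactly two vertices 1/(qN), and, W being minimal, in 2 <= j < |W| vertices
   an exponentially small factor, so the expected number of both kinds of
   sequences tends to 0. *)

Require Import Defs.
From HB Require Import structures.
From mathcomp Require Import all_boot all_order all_algebra.
From mathcomp Require Import all_classical all_reals all_analysis.
From mathcomp Require Import ring lra zify.

Set Implicit Arguments.
Unset Strict Implicit.
Unset Printing Implicit Defensive.

Import Order.TTheory GRing.Theory Num.Theory.
Import numFieldNormedType.Exports.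

Local Open Scope ring_scope.

(** The Ramsey input has to be uniform in [n]. The zero solution is always monochromatic, so mere
    existence says nothing about counts; a solution onto which every solution factors, found in a
    finite group independent of [n], is carried by a uniformly chosen homomorphism to a uniformly
    distributed solution in G^n. This converts existence into a positive proportion. In the
    0-statement the number of edges expected in the random set may be of order qN, exponentially
    large, so a first moment over single edges is useless. Closing up once in exactly two vertices
    has weight 1/(qN) and only cancels the number of starting edges; a second closing supplies the
    decay. This is the reason for asking for two closings, one of them in exactly two vertices. A
    path that never closes needs length linear in [n] for its constant loss per edge to beat qN. The
    number of places where an edge can attach is then polynomial in [n], which the exponential decay
    absorbs. *)

(** * The Hales-Jewett theorem by colour focusing *)

Section HalesJewett.

Variable T : finType.

(* A combinatorial line is a word over [option T] in which [None], the wildcard,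
   occurs. *)
Definition line_at (w : seq (option T)) (t : T) : seq T := map (odflt t) w.

Lemma line_at_cat w1 w2 t : line_at (w1 ++ w2) t = line_at w1 t ++ line_at w2 t.
Proof. exact: map_cat. Qed.

Lemma line_at_const (v : seq T) t : line_at (map Some v) t = v.
Proof. by rewrite /line_at -map_comp map_id. Qed.

Lemma size_line_at w t : size (line_at w t) = size w.
Proof. exact: size_map. Qed.

Definition mono_line (A : seq T) (C : Type) (chi : seq T -> C) w :=
  exists c, forall t, t \in A -> chi (line_at w t) = c.

(* Induction on the alphabet; [D] is the set of colours of the lines focused at [f]. *)
Lemma Hales_Jewett_seq (A : seq T) (C : finType) : exists N, forall chi : seq T -> C,
  exists w, [/\ size w = N, None \in w & mono_line A chi w].
Proof.
elim: A C => [|a A IHA] C.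
  exists 1%N => chi; exists [:: None]; split => //.
  by exists (chi [::]).
case: (posnP (size A)) => [/size0nil -> | A_gt0].
  exists 1%N => chi; exists [:: None]; split => //.
  by exists (chi [:: a]) => t; rewrite inE => /eqP ->.
have [t0 t0A] : exists t0, t0 \in A.
  by case: (A) A_gt0 => // t1 A' _; exists t1; rewrite mem_head.
have focus j : exists N, forall chi : seq T -> C,
    (exists w, [/\ size w = N, None \in w & mono_line (a :: A) chi w]) \/
    exists (f : seq T) (D : {set C}), [/\ size f = N, #|D| = j, chi f \notin D &
      forall c, c \in D -> exists w, [/\ size w = N, None \in w, line_at w a = f &
        forall t, t \in A -> chi (line_at w t) = c]].
  elim: j => [|j [N IHj]].
    exists 0%N => chi; right; exists [::], finset.set0; split => //; rewrite ?cards0 ?inE //.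
    by move=> c; rewrite inE.
  (* The colour of a word [y] is the whole colouring of the [N]-words [x] by [chi (x ++ y)], so
     along [A] the line [v] may be moved without changing any colour on the first block. *)
  have [M HM] := IHA {ffun N.-tuple T -> C}.
  exists (N + M)%N => chi.
  have [v [sv v_wild [c0 v_mono]]] := HM (fun y => [ffun x : N.-tuple T => chi (x ++ y)]).
  have v_eq t x : t \in A -> size x = N ->
      chi (x ++ line_at v t) = chi (x ++ line_at v t0).
    move=> tA sx.
    have /ffunP/(_ (in_tuple x)) : [ffun x : (size x).-tuple T => chi (x ++ line_at v t)]
        = [ffun x : (size x).-tuple T => chi (x ++ line_at v t0)].
      by rewrite sx (v_mono t) // (v_mono t0).
    by rewrite !ffunE.
  case: (IHj (fun x => chi (x ++ line_at v t0))) =>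
      [[w [sw w_wild [c w_mono]]]|[f [D [sf cD fD lines]]]].
    left; exists (w ++ map Some (line_at v t0)); split.
    - by rewrite size_cat size_map size_line_at sw sv.
    - by rewrite mem_cat w_wild.
    - by exists c => t tA; rewrite line_at_cat line_at_const w_mono.
  (* If the new focus has a new colour, the line through [f] in direction [v] contributes one more
     focused colour; otherwise its colour is that of a focused line, which becomes monochromatic on
     [a :: A]. *)
  case: (boolP (chi (f ++ line_at v a) \in chi (f ++ line_at v t0) |: D)); last first.
    move=> fD'; right; exists (f ++ line_at v a), (chi (f ++ line_at v t0) |: D); split => //.
    - by rewrite size_cat size_line_at sf sv.
    - by rewrite cardsU1 fD cD.
    move=> c; rewrite !inE => /orP [/eqP -> | cD'].
      exists (map Some f ++ v); split.
      - by rewrite size_cat size_map sf sv.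
      - by rewrite mem_cat v_wild orbT.
      - by rewrite line_at_cat line_at_const.
      - by move=> t tA; rewrite line_at_cat line_at_const v_eq.
    have [w [sw w_wild wf w_mono]] := lines _ cD'.
    exists (w ++ v); split.
    - by rewrite size_cat sw sv.
    - by rewrite mem_cat w_wild.
    - by rewrite line_at_cat wf.
    - by move=> t tA; rewrite line_at_cat v_eq ?size_line_at // w_mono.
  rewrite !inE => /orP [/eqP fE | fD']; left.
    exists (map Some f ++ v); split.
    - by rewrite size_cat size_map sf sv.
    - by rewrite mem_cat v_wild orbT.
    exists (chi (f ++ line_at v t0)) => t; rewrite inE => /orP [/eqP -> | tA].
      by rewrite line_at_cat line_at_const fE.
    by rewrite line_at_cat line_at_const v_eq.
  have [w [sw w_wild wf w_mono]] := lines _ fD'.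
  exists (w ++ v); split.
  - by rewrite size_cat sw sv.
  - by rewrite mem_cat w_wild.
  exists (chi (f ++ line_at v a)) => t; rewrite inE => /orP [/eqP -> | tA].
    by rewrite line_at_cat wf.
  by rewrite line_at_cat v_eq ?size_line_at // w_mono.
(* With [#|C|] focused colours none is left for the focus itself. *)
have [N HN] := focus #|C|; exists N => chi.
case: (HN chi) => // [[f [D [_ cD fD _]]]].
have DT : D = [set: C] by apply/eqP; rewrite eqEcard finset.subsetT cardsT cD leqnn.
by move: fD; rewrite DT inE.
Qed.

Lemma Hales_Jewett (C : finType) : exists N, forall chi : seq T -> C,
  exists w c, [/\ size w = N, None \in w & forall t, chi (line_at w t) = c].
Proof.
have [N HN] := Hales_Jewett_seq (enum T) C; exists N => chi.
have [w [sw w_wild [c w_mono]]] := HN chi.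
by exists w, c; split => // t; rewrite w_mono ?mem_enum.
Qed.

End HalesJewett.

(** Joins the finite and the additive structure, so that powers of finite groups can serve again as
    groups in the inductions. *)
HB.instance Definition _ (I : finType) (G : finZmodType) :=
  GRing.Zmodule.on {ffun I -> G}.

(** * Additive maps given as bare functions *)

Section Morphisms.

Variables (U V : zmodType) (f : U -> V).
Hypothesis fD : {morph f : x y / x + y}.

Lemma morph_add0 : f 0 = 0.
Proof. by apply: (addrI (f 0)); rewrite -fD !addr0. Qed.

Lemma morph_addN : {morph f : x / - x}.
Proof. by move=> x; apply: (addrI (f x)); rewrite -fD !subrr morph_add0. Qed.

Lemma morph_addB : {morph f : x y / x - y}.
Proof. by move=> x y; rewrite fD morph_addN. Qed.

Lemma morph_addMn n : {morph f : x / x *+ n}.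
Proof. by move=> x; elim: n => [|n IHn]; rewrite ?morph_add0 // !mulrS fD IHn. Qed.

Lemma morph_addMz z : {morph f : x / x *~ z}.
Proof.
move=> x; case: z => n; first by rewrite -!pmulrn morph_addMn.
by rewrite NegzE !mulrNz morph_addN -!pmulrn morph_addMn.
Qed.

Lemma morph_add_sum (I : Type) (r : seq I) (P : pred I) (F : I -> U) :
  f (\sum_(i <- r | P i) F i) = \sum_(i <- r | P i) f (F i).
Proof. by apply: (big_morph _ fD morph_add0). Qed.

End Morphisms.

(** * Iterated Hales-Jewett: systems of rows in the style of Deuber *)

Section Rows.

Fixpoint nspan (U : zmodType) (ds : seq U) (u : U) : Prop :=
  if ds is d :: ds' then exists a v, u = d *+ a + v /\ nspan ds' v else u = 0.

(** The rows of a Deuber (m,p,c)-set with leading coefficient 1: a generator plus any combination of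
    the later ones plus the image of [psi]. Each row has a colour of its own. *)
Fixpoint rows (U0 U1 : zmodType) (C : Type) (chi : U0 -> C) (psi : U1 -> U0)
    (ds : seq (U0 * C)) : Prop :=
  if ds is dc :: ds' then
    (forall u y, nspan (map fst ds') u -> chi (dc.1 + u + psi y) = dc.2)
    /\ rows chi psi ds'
  else True.

Lemma nspan_map (U V : zmodType) (f : U -> V) (ds : seq U) v :
  {morph f : x y / x + y} -> nspan (map f ds) v -> exists2 u, nspan ds u & v = f u.
Proof.
move=> fD; elim: ds v => [|d ds IHds] v /=.
  by move=> ->; exists 0; rewrite ?(morph_add0 fD).
move=> [a [v' [-> /IHds [u u_sp ->]]]]; exists (d *+ a + u); last by rewrite fD (morph_addMn fD).
by exists a, u.
Qed.

Lemma rows_map (U U0 U1 : zmodType) (C : Type) (chi : U0 -> C) (f : U -> U0)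
    (psi : U1 -> U) (ds : seq (U * C)) : {morph f : x y / x + y} ->
  rows (chi \o f) psi ds -> rows chi (f \o psi) [seq (f dc.1, dc.2) | dc <- ds].
Proof.
move=> fD; elim: ds => //= dc ds IHds [dc_row /IHds rows_ds]; split => // u y.
rewrite -map_comp (map_comp f fst) => /(nspan_map fD) [u' u'_sp ->].
by rewrite -!fD -(dc_row u' y u'_sp).
Qed.

Lemma nspan_filter (U : zmodType) (C : Type) (P : pred (U * C)) (ds : seq (U * C)) u :
  nspan (map fst (seq.filter P ds)) u -> nspan (map fst ds) u.
Proof.
elim: ds u => //= dc ds IHds u; case: (P dc) => /=.
  by move=> [a [v [-> /IHds v_sp]]]; exists a, v.
by move=> /IHds u_sp; exists 0%N, u; rewrite mulr0n add0r.
Qed.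

Lemma rows_filter (U0 U1 : zmodType) (C : Type) (chi : U0 -> C) (psi : U1 -> U0)
    (P : pred (U0 * C)) ds : rows chi psi ds -> rows chi psi (seq.filter P ds).
Proof.
elim: ds => //= dc ds IHds [dc_row /IHds rows_ds]; case: (P dc) => //=; split => //.
by move=> u y /nspan_filter; apply: dc_row.
Qed.

(* [pr] is the projection to coordinates on which all the [d] vanish and [psi]
   is the identity. *)
Lemma Deuber_rows (C : finType) (U1 : finZmodType) (s J : nat) :
    (forall y : U1, y *+ s = 0) ->
  exists2 U0 : finZmodType, (forall u : U0, u *+ s = 0) &
  forall chi : U0 -> C, exists (ds : seq (U0 * C)) (psi : U1 -> U0) (pr : U0 -> U1),
    [/\ size ds = J, {morph psi : x y / x + y}, {morph pr : x y / x + y},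
        cancel psi pr & all (fun dc => pr dc.1 == 0) ds /\ rows chi psi ds].
Proof.
move=> U1s; elim: J => [|J [U U_s IHJ]].
  by exists U1 => // chi; exists [::], id, id.
have [N HN] := Hales_Jewett U C.
exists {ffun 'I_N -> U} => [u|chi].
  suff uE n : u *+ n = [ffun i => u i *+ n] by rewrite uE; apply/ffunP => i; rewrite !ffunE U_s.
  by elim: n => [|n IHn]; apply/ffunP => i; rewrite ?mulrS ?IHn !ffunE ?mulrS.
have [w [c [sw w_wild w_mono]]] := HN (fun v => chi [ffun i : 'I_N => nth 0 v i]).
have ltwN : (index None w < N)%N by rewrite -sw index_mem.
(* At a wildcard position [d] vanishes and [f] is the identity, so reading this coordinate first
   extends [pr]. *)
pose i0 := Ordinal ltwN.
have wi0 : nth None w i0 = None by rewrite nth_index.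
(* The line is the coset of [f U] through [d]: its constants form [d], and [f] is diagonal on the
   wildcards. All later generators and [psi] will factor through [f], so this coset contains the
   entire first row. *)
pose f (t : U) : {ffun 'I_N -> U} := [ffun i => if nth None w (val i) is None then t else 0].
pose d : {ffun 'I_N -> U} := [ffun i => odflt 0 (nth None w (val i))].
have fD : {morph f : x y / x + y}.
  by move=> x y; apply/ffunP => i; rewrite !ffunE; case: (nth _ _ _); rewrite ?addr0.
have df t : chi (d + f t) = c.
  rewrite -(w_mono t); congr (chi _); apply/ffunP => i; rewrite !ffunE.
  rewrite (nth_map None) ?sw //.
  by case: (nth _ _ _) => [a|] /=; rewrite ?addr0 ?add0r.
have [ds [psi [pr [sds psiD prD psiK [pr_ds rows_ds]]]]] := IHJ (chi \o f).
exists ((d, c) :: [seq (f dc.1, dc.2) | dc <- ds]), (f \o psi), (fun u : {ffun 'I_N -> U} => pr (u i0)).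
have fi0 t : f t i0 = t by rewrite ffunE wi0.
split.
- by rewrite /= size_map sds.
- by move=> x y /=; rewrite psiD fD.
- by move=> x y /=; rewrite ffunE prD.
- by move=> y /=; rewrite fi0 psiK.
split.
  rewrite /= ffunE wi0 /= (morph_add0 prD) eqxx /= all_map.
  by apply: sub_all pr_ds => dc /=; rewrite fi0.
split; last exact: rows_map.
move=> u y; rewrite -map_comp (map_comp f fst) => /(nspan_map fD) [u' _ ->] /=.
by rewrite -addrA -fD df.
Qed.

(** Pigeonhole on the colours of the rows; deleting generators only shrinks the spans, so the
    remaining rows keep their colours. *)
Lemma Deuber_mono_rows (C : finType) (U1 : finZmodType) (s m : nat) :
    (forall y : U1, y *+ s = 0) ->
  exists2 U0 : finZmodType, (forall u : U0, u *+ s = 0) &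
  forall chi : U0 -> C, exists (ds : seq (U0 * C)) (psi : U1 -> U0) (pr : U0 -> U1) (c : C),
    [/\ (m <= size ds)%N, {morph psi : x y / x + y} /\ {morph pr : x y / x + y},
        cancel psi pr, all (fun dc => (pr dc.1 == 0) && (dc.2 == c)) ds & rows chi psi ds].
Proof.
move=> U1s; have [U0 U0s HU0] := @Deuber_rows C _ s (#|C| * m).+1 U1s.
exists U0 => // chi; have [ds [psi [pr [sds psiD prD psiK [pr_ds rows_ds]]]]] := HU0 chi.
have [c lemc] : exists c, (m <= count (fun dc => dc.2 == c) ds)%N.
  apply/existsP; apply: contra_eqT sds => /existsPn few; rewrite neq_ltn; apply/orP; left.
  have -> : size ds = (\sum_c count (fun dc => dc.2 == c) ds)%N.
    under eq_bigr => c _ do rewrite -sum1_count.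
    rewrite (exchange_big_dep predT) //= -sum1_size; apply: eq_bigr => dc _.
    by rewrite (big_pred1 dc.2) // => c; rewrite /= eq_sym.
  rewrite ltnS -sum_nat_const; apply: leq_sum => c _; move: (few c).
  by rewrite -ltnNge => /ltnW.
exists (seq.filter (fun dc => dc.2 == c) ds), psi, pr, c; split => //.
- by rewrite size_filter.
- rewrite all_filter; apply: sub_all pr_ds => dc prdc; apply/implyP => ->.
  by rewrite prdc.
- exact: rows_filter.
Qed.

End Rows.

(** * From the columns condition to monochromatic solutions above a given solution *)

Section ColumnsRamsey.

Lemma mulrn_modn (U : zmodType) (s : nat) (g : U) (n : nat) :
  g *+ s = 0 -> g *+ (n %% s) = g *+ n.
Proof.
by move=> gs; rewrite {2}(divn_eq n s) mulrnDr mulnC mulrnA gs mul0rn add0r.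
Qed.

Lemma Zp_act_morph (U : zmodType) (s : nat) (g : U) : (1 < s)%N -> g *+ s = 0 ->
  {morph (fun a : 'Z_s => g *+ val a) : x y / x + y}.
Proof.
by move=> s_gt1 gs x y /=; rewrite -mulrnDr; apply: mulrn_modn; rewrite Zp_cast.
Qed.

(** The columns condition as kernel vectors modulo [s] in echelon form: [v t] is 1 on the class
    [C t], minus the coefficients of the linear combination on earlier classes, and 0 on later ones.
    Column [j] therefore leads with a 1 at the index of its class. Natural representatives let the
    vectors act on every group element killed by [s]. *)
Lemma columns_kernel (s l k : nat) (A : 'M[int]_(l, k)) :
    (1 < s)%N -> s_columns_condition s A ->
  exists M (v : nat -> 'I_k -> nat),
    (forall j, exists t, [/\ (t < M)%N, v t j = 1%N & forall t', (t' < t)%N -> v t' j = 0%N]) /\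
    forall t (U : zmodType) (g : U) i, (t < M)%N -> g *+ s = 0 ->
      \sum_j (g *+ v t j) *~ A i j = 0.
Proof.
move=> s_gt1 [m [C [C_inj /and3P [/eqP Ccov Ctriv _] C0 Ccol]]].
have Cdisj t t' j : j \in C t -> j \in C t' -> t = t'.
  move=> jt jt'; apply: C_inj; apply/eqP/negPn/negP => neq.
  have /finset.trivIsetP/(_ _ _ (imset_f C (erefl true : t \in predT)) (imset_f C (erefl true : t' \in predT)) neq) := Ctriv.
  by move=> /pred0P/(_ j) /=; rewrite jt jt'.
have Call j : exists t, j \in C t.
  have : j \in finset.cover [set C i | i : 'I_m.+1] by rewrite Ccov inE.
  by move=> /bigcupP [_ /imsetP [t _ ->] jt]; exists t.
pose lincomb t (a : 'I_k -> 'Z_s) :=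
    \sum_(j in C t) col j (map_mx (intr : int -> 'Z_s) A) =
    \sum_(j in \bigcup_(i' < m.+1 | (i' < t)%N) C i') a j *: col j (map_mx (intr : int -> 'Z_s) A).
have [a Ha] : exists a, forall t, lincomb t (a t).
  apply: fin_all_exists => t; case: (posnP t) => [t0|/Ccol //].
  exists (fun _ => 0); rewrite /lincomb [RHS]big1 => [|j _]; last by rewrite scale0r.
  by rewrite (_ : t = ord0) ?C0 //; apply/val_inj.
pose vz t j : 'Z_s := if j \in C t then 1 else
  if j \in \bigcup_(i' < m.+1 | (i' < t)%N) C i' then - a t j else 0.
exists m.+1, (fun t j => val (vz (inord t) j)); split=> [j|t U g i lt_t gs].
  have [t jt] := Call j; exists t; rewrite inord_val /vz jt; split => //.
  move=> t' lt_t'; have lt'm : (t' < m.+1)%N by apply: ltn_trans (ltn_ord t).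
  case: ifPn => [jt'|_].
    by have := Cdisj _ _ _ jt jt' => tt'; move: lt_t'; rewrite tt' inordK // ltnn.
  case: ifPn => // /bigcupP [i' lt_i' ji'].
  have it := Cdisj _ _ _ jt ji'; move: lt_i'; rewrite -it inordK // ltnNge.
  by rewrite ltnW.
have actD := Zp_act_morph s_gt1 gs.
(* Acting on [g] is additive in the residue, so the claim reduces to an identity in ['Z_s]. *)
transitivity ((fun b : 'Z_s => g *+ val b) (\sum_j vz (inord t) j * (A i j)%:~R)).
  rewrite (morph_add_sum actD); apply: eq_bigr => j _.
  by rewrite mulrzr (morph_addMz actD).
suff -> : \sum_j vz (inord t) j * (A i j)%:~R = 0 by rewrite /= mulr0n.
have /matrixP/(_ i ord0) := Ha (inord t); rewrite !summxE => Hti.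
transitivity (\sum_(j in C (inord t)) (A i j)%:~R
   - \sum_(j in \bigcup_(i' < m.+1 | (i' < (inord t : 'I_m.+1))%N) C i') a (inord t) j * (A i j)%:~R : 'Z_s).
  rewrite [X in _ = X - _]big_mkcond [X in _ = _ - X]big_mkcond -sumrB; apply: eq_bigr => j _;
    rewrite /vz.
  case: ifPn => jt.
    case: ifPn => [/bigcupP [i' lt_i' ji']|]; last by rewrite mul1r subr0.
    by move: lt_i'; rewrite (Cdisj _ _ _ jt ji') ltnn.
  by case: ifPn => _; rewrite ?subr0 ?mul0r // sub0r mulNr.
apply/eqP; rewrite subr_eq0; apply/eqP; move: Hti.
under eq_bigr => j _ do rewrite !mxE.
by move=> ->; apply: eq_bigr => j _; rewrite !mxE.
Qed.

Lemma nspan_sum (U : zmodType) (ds : seq U) (e : nat -> nat) n :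
  nspan ds (\sum_(i < n) ds`_i *+ e i).
Proof.
elim: ds n e => [|d ds IHds] n e /=; first by apply: big1 => i _; rewrite nth_nil mul0rn.
case: n => [|n]; first by exists 0%N, 0; rewrite big_ord0 mulr0n addr0; split => //;
  have := IHds 0%N e; rewrite big_ord0.
by exists (e 0%N), (\sum_(i < n) ds`_i *+ e i.+1); rewrite big_ord_recl /=; split => //;
  exact: (IHds n (fun i => e i.+1)).
Qed.

Lemma rows_nth (U0 U1 : zmodType) (C : Type) (chi : U0 -> C) (psi : U1 -> U0) x0 ds t u y :
  rows chi psi ds -> (t < size ds)%N -> nspan (map fst (drop t.+1 ds)) u ->
  chi ((nth x0 ds t).1 + u + psi y) = (nth x0 ds t).2.
Proof.
elim: ds t => //= dc ds IHds [|t] [dc_row rows_ds] /=.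
  by rewrite drop0 => _; apply: dc_row.
by move=> lt_t; apply: IHds.
Qed.

(** Combining the generators [d t] with the kernel vectors [v t] and adding [psi] of [w] gives a
    solution. Entry [j] leads with a generator of coefficient 1, hence lies in a row of colour [c];
    the projection [pr] kills all generators and returns [w]. *)
Lemma columns_Ramsey (C : finType) (U1 : finZmodType) (s l k : nat) (A : 'M[int]_(l, k))
    (w : {ffun 'I_k -> U1}) :
    (1 < s)%N -> s_columns_condition s A -> (forall y : U1, y *+ s = 0) -> int_mul A w = 0 ->
  exists U0 : finZmodType, forall chi : U0 -> C,
  exists (x : {ffun 'I_k -> U0}) (c : C) (pr : U0 -> U1),
    [/\ int_mul A x = 0, forall j, chi (x j) = c, {morph pr : y z / y + z}
      & forall j, pr (x j) = w j].
Proof.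
move=> s_gt1 hcol U1s Aw; have [M [v [v_first v_ker]]] := columns_kernel s_gt1 hcol.
have [U0 U0s HU0] := @Deuber_mono_rows C U1 s M U1s.
exists U0 => chi; have [ds [psi [pr [c [sds [psiD prD] psiK pr_ds rows_ds]]]]] := HU0 chi.
pose d t := nth 0 (map fst ds) t.
pose x := [ffun j => \sum_(t < M) d t *+ v t j + psi (w j)].
have xE j : x j = \sum_(t < M) d t *+ v t j + psi (w j) by rewrite /x ffunE.
exists x, c, pr; split => //.
- apply/ffunP => i; rewrite !ffunE.
  under eq_bigr => j _ do rewrite xE mulrzDl mulrz_suml.
  rewrite big_split /= exchange_big /= big1 ?add0r => [|t _]; last exact: v_ker.
  transitivity (psi (int_mul A w i)); last by rewrite Aw ffunE (morph_add0 psiD).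
  rewrite ffunE (morph_add_sum psiD); apply: eq_bigr => j _.
  by rewrite (morph_addMz psiD).
- move=> j; rewrite xE; have [t [ltM vt1 vt0]] := v_first j.
  have lt_ds : (t < size ds)%N by apply: leq_trans sds.
  have /allP/(_ _ (mem_nth (0, c) lt_ds))/andP [_ /eqP ct] := pr_ds.
  rewrite -[RHS]ct -(@rows_nth _ _ _ chi psi (0, c) ds t
    (\sum_(i < M - t.+1) (map fst (drop t.+1 ds))`_i *+ v (i + t.+1)%N j) (w j)) //; last first.
    exact: (@nspan_sum _ _ (fun i => v (i + t.+1)%N j)).
  congr (chi (_ + _)); rewrite -(big_mkord xpredT (fun t => d t *+ v t j)).
  rewrite (big_cat_nat _ (n := t)) ?leq0n ?(ltnW ltM) //=.
  rewrite big_nat big1 ?add0r => [|i /andP [_ /vt0 ->]]; last by rewrite mulr0n.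
  rewrite big_ltn // vt1 mulr1n {1}/d (nth_map (0, c)) //; congr (_ + _).
  rewrite -{1}[t.+1]add0n big_addn big_mkord; apply: eq_bigr => i _; rewrite /d.
  by rewrite map_drop nth_drop addnC.
- move=> j; rewrite xE prD psiK (morph_add_sum prD) big1 ?add0r // => t _.
  rewrite (morph_addMn prD) /d.
  case: (ltnP t (size ds)) => lt_t;
    last by rewrite nth_default ?size_map // (morph_add0 prD) mul0rn.
  rewrite (nth_map (0, c)) //.
  by have /allP/(_ _ (mem_nth (0, c) lt_t))/andP [/eqP -> _] := pr_ds; rewrite mul0rn.
Qed.

End ColumnsRamsey.

(** * Supersaturation by averaging over homomorphisms *)

Section Solutions.

Variables (l k : nat) (A : 'M[int]_(l, k)).

Definition sol (T : finZmodType) : {set {ffun 'I_k -> T}} := [set x | int_mul A x == 0].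

Lemma int_mulD (T : zmodType) : {morph (@int_mul T l k A) : x y / x + y}.
Proof.
move=> x y; apply/ffunP => i; rewrite !ffunE -big_split; apply: eq_bigr => j _.
by rewrite ffunE mulrzDl.
Qed.

Lemma int_mul_morph (U V : zmodType) (f : U -> V) (x : {ffun 'I_k -> U}) :
  {morph f : y z / y + z} -> int_mul A [ffun j => f (x j)] = [ffun i => f (int_mul A x i)].
Proof.
move=> fD; apply/ffunP => i; rewrite !ffunE (morph_add_sum fD); apply: eq_bigr => j _.
by rewrite ffunE (morph_addMz fD).
Qed.

Lemma solD (T : finZmodType) (x y : {ffun 'I_k -> T}) :
  x \in sol T -> y \in sol T -> x + y \in sol T.
Proof. by rewrite !inE int_mulD => /eqP -> /eqP ->; rewrite addr0. Qed.

Lemma solB (T : finZmodType) (x y : {ffun 'I_k -> T}) :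
  x \in sol T -> y \in sol T -> x - y \in sol T.
Proof. by rewrite !inE (morph_addB (@int_mulD T)) => /eqP -> /eqP ->; rewrite subr0. Qed.

Lemma sol0 (T : finZmodType) : 0 \in sol T.
Proof. by rewrite inE (morph_add0 (@int_mulD T)). Qed.

Lemma sol_morph (U V : finZmodType) (f : U -> V) (x : {ffun 'I_k -> U}) :
  {morph f : y z / y + z} -> x \in sol U -> [ffun j => f (x j)] \in sol V.
Proof.
move=> fD; rewrite !inE => /eqP Ax; rewrite int_mul_morph // Ax.
by apply/eqP/ffunP => i; rewrite !ffunE (morph_add0 fD).
Qed.

Section Homs.

Variables U T : finZmodType.

Definition is_hom (phi : {ffun U -> T}) := [forall x, forall y, phi (x + y) == phi x + phi y].

Lemma is_homP (phi : {ffun U -> T}) : reflect {morph phi : x y / x + y} (is_hom phi).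
Proof.
apply: (iffP forallP) => [phiD x y|phiD x].
  by have /forallP/(_ y)/eqP := phiD x.
by apply/forallP => y; rewrite phiD.
Qed.

Definition homs : {set {ffun U -> T}} := [set phi | is_hom phi].

Definition eval_hom (x : {ffun 'I_k -> U}) (phi : {ffun U -> T}) : {ffun 'I_k -> T} :=
  [ffun j => phi (x j)].

(* Evaluation at a solution onto which every solution factors has uniform
   fibres over the solutions. *)
Lemma card_homs_fiber (x : {ffun 'I_k -> U}) (M : {set {ffun 'I_k -> T}}) :
    x \in sol U -> M \subset sol T -> {in sol T, forall z, z \in eval_hom x @: homs} ->
  (#|[set phi in homs | eval_hom x phi \in M]| * #|sol T| = #|M| * #|homs|)%N.
Proof.
move=> x_sol M_sol x_gen.
have fiberE (S : {set {ffun 'I_k -> T}}) : S \subset sol T ->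
    #|[set phi in homs | eval_hom x phi \in S]| =
    (#|S| * #|[set phi in homs | eval_hom x phi == 0%R]|)%N.
  move=> S_sol; rewrite -sum1_card -sum_nat_const.
  rewrite (partition_big (eval_hom x) (mem S)) /=; last by move=> phi; rewrite !inE => /andP [].
  apply: eq_bigr => z zS.
  have /imsetP [phi0] := x_gen z (fintype.subsetP S_sol z zS); rewrite inE => /is_homP phi0D zE.
  rewrite sum1_card -[RHS](card_imset _ (addIr phi0)); apply: eq_card => phi.
  rewrite [LHS]/in_mem /=.
  apply/andP/imsetP => [[]|[psi]].
    rewrite 2!inE => /andP [/is_homP phiD _] /eqP phi_z; exists (phi - phi0); last by rewrite subrK.
    rewrite 2!inE; apply/andP; split.
      by apply/is_homP => u v; rewrite !ffunE phi0D phiD opprD addrACA.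
    apply/eqP/ffunP => j; rewrite !ffunE.
    by move/ffunP: phi_z => /(_ j); rewrite zE !ffunE => ->; rewrite subrr.
  rewrite 2!inE => /andP [/is_homP psiD /eqP psi0] ->.
  have e : eval_hom x (psi + phi0) = z.
    by apply/ffunP => j; move/ffunP: psi0 => /(_ j); rewrite zE !ffunE => ->; rewrite add0r.
  rewrite 2!inE e eqxx zS andbT; split=> //.
  by apply/is_homP => u v; rewrite !ffunE psiD phi0D addrACA.
have homsE : #|homs| = (#|sol T| * #|[set phi in homs | eval_hom x phi == 0%R]|)%N.
  rewrite -fiberE //; apply: eq_card => phi; rewrite [RHS]inE.
  by rewrite inE; case: is_homP => // phiD; rewrite sol_morph.
by rewrite homsE fiberE // -mulnA [X in (_ * X)%N]mulnC.
Qed.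

End Homs.

Definition mono_sol (T : finZmodType) (C : finType) (chi : T -> C) :=
  [set x in sol T | [exists c, [forall j, chi (x j) == c]]].

Lemma card_mono_sol (G : finZmodType) (s : nat) (C : finType) :
    (1 < s)%N -> (forall g : G, g *+ s = 0) -> s_columns_condition s A ->
  exists2 K, (0 < K)%N & forall n (chi : 'rV[G]_n -> C),
    (#|sol 'rV[G]_n| <= K * #|mono_sol chi|)%N.
Proof.
move=> s_gt1 Gs hcol; pose U1 := {ffun {ffun 'I_k -> G} -> G} : finZmodType.
have U1s (y : U1) : y *+ s = 0.
  suff yE n : y *+ n = [ffun i => y i *+ n] by rewrite yE; apply/ffunP => i; rewrite !ffunE Gs.
  by elim: n => [|n IHn]; apply/ffunP => i; rewrite ?mulrS ?IHn !ffunE ?mulrS.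
(* The universal solution: coordinate [y] of it is [y] itself when [y] solves the system, and 0
   otherwise. Any solution [z] in G^n arises from it by selecting, for each [i], the coordinate
   indexed by the [i]-th slice of [z]; hence every solution that [pr] maps to [w] is generic. *)
pose w : {ffun 'I_k -> U1} :=
  [ffun j => [ffun y : {ffun 'I_k -> G} => if y \in sol G then y j else 0]].
have Aw : int_mul A w = 0.
  apply/ffunP => i; rewrite ffunE; apply/ffunP => y.
  have evD : {morph (fun u : U1 => u y) : a b / a + b} by move=> a b; rewrite ffunE.
  rewrite (morph_add_sum evD) !ffunE.
  under eq_bigr => j _ do rewrite (morph_addMz evD) /w !ffunE.
  case: (boolP (y \in sol G)) => [|_]; last by rewrite big1 // => j _; rewrite mul0rz.
  by rewrite inE => /eqP/ffunP/(_ i); rewrite !ffunE.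
have [U0 HU0] := @columns_Ramsey C U1 s l k A w s_gt1 hcol U1s Aw.
(* Each homomorphism has its own monochromatic generic [x] for the pulled back colouring; the
   constant counts the possible [x], independently of [n]. *)
exists #|{ffun 'I_k -> U0}|; first by apply/card_gt0P; exists 0.
move=> n chi; set H := homs U0 'rV[G]_n; set M := mono_sol chi.
have H_gt0 : (0 < #|H|)%N.
  by apply/card_gt0P; exists 0; rewrite inE; apply/is_homP => x y; rewrite !ffunE addr0.
rewrite -(leq_pmul2r H_gt0) -mulnA.
pose good (x : {ffun 'I_k -> U0}) := (x \in sol U0) &&
  [forall z, (z \in sol 'rV[G]_n) ==> (z \in @eval_hom U0 'rV[G]_n x @: H)].
have H_le : (#|H| <= \sum_(x : {ffun 'I_k -> U0} | good x)
    #|[set phi in H | eval_hom x phi \in M]|)%N.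
  have cE (x : {ffun 'I_k -> U0}) : #|[set phi in H | eval_hom x phi \in M]| =
      (\sum_(phi in [set phi in H | eval_hom x phi \in M]) 1)%N by rewrite sum1_card.
  rewrite -sum1_card (eq_bigr _ (fun x _ => cE x)) (exchange_big_dep (mem H)) /=;
    last by move=> x phi _; rewrite inE => /andP [].
  apply: leq_sum => phi phiH; have := phiH; rewrite inE => /is_homP phiD.
  have [x [c [pr [Ax x_mono prD prx]]]] := HU0 (chi \o phi).
  have x_sol : x \in sol U0 by rewrite inE Ax.
  rewrite (bigD1 x) //= finset.in_set phiH finset.in_set sol_morph //=.
  apply/andP; split; last first.
    by apply/existsP; exists c; apply/forallP => j; rewrite ffunE; apply/eqP/x_mono.
  rewrite /good x_sol; apply/forallP => z; apply/implyP => z_sol; apply/imsetP.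
  exists [ffun u => \row_i pr u [ffun j => z j 0 i]].
    by rewrite inE; apply/is_homP => u v; apply/rowP => i; rewrite !ffunE !mxE prD ffunE.
  apply/ffunP => j; apply/rowP => i; rewrite !ffunE mxE prx !ffunE.
  by rewrite (@sol_morph _ _ (fun v : 'rV[G]_n => v 0 i) z) ?ffunE // => u v; rewrite mxE.
rewrite mulnC; apply: leq_trans (leq_mul H_le (leqnn _)) _.
rewrite big_distrl /= -(sum_nat_const (mem {ffun 'I_k -> U0})) big_mkcond /=.
apply: leq_sum => x _; case: ifPn => // /andP [x_sol /forallP x_gen].
rewrite card_homs_fiber //.
  by apply/fintype.subsetP => z; rewrite inE => /andP [].
by move=> z z_sol; have /implyP/(_ z_sol) := x_gen z.
Qed.

End Solutions.

(** * Counting solutions with prescribed entries *)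

Section CountSolutions.

Lemma card_im_ker (U V : finZmodType) (f : U -> V) : {morph f : x y / x + y} ->
  (#|[set f x | x : U]| * #|[set x | f x == 0%R]| = #|U|)%N.
Proof.
move=> fD; rewrite -[#|U|]sum1_card (partition_big f (mem [set f x | x : U])) /=; last first.
  by move=> x _; exact: imset_f.
rewrite -sum_nat_const; apply: eq_bigr => _ /imsetP [x0 _ ->].
rewrite sum1_card -[LHS](card_imset _ (addIr x0)); apply: eq_card => x; rewrite [RHS]/in_mem /=.
apply/imsetP/eqP => [[y + ->]|fx].
  by rewrite inE fD => /eqP ->; rewrite add0r.
by exists (x - x0); rewrite ?subrK // inE (morph_addB fD) fx subrr.
Qed.

Variables (l k : nat) (A : 'M[int]_(l, k)).

Definition sol_at (T : finZmodType) (J : {set 'I_k}) (y : {ffun 'I_k -> T}) :=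
  [set x in sol A T | [forall i in J, x i == y i]].

Lemma sol_atP (T : finZmodType) (J : {set 'I_k}) (y x : {ffun 'I_k -> T}) :
  reflect (x \in sol A T /\ {in J, x =1 y}) (x \in sol_at J y).
Proof.
rewrite [X in reflect _ X]finset.in_set; apply: (iffP andP) => -[x_sol xJ]; split => //.
  by move=> i iJ; apply/eqP; move/forall_inP: xJ; apply.
by apply/forall_inP => i iJ; rewrite xJ.
Qed.

Definition nsol (T : finZmodType) (J : {set 'I_k}) := #|sol_at J (0 : {ffun 'I_k -> T})|.

Lemma nsol0 (T : finZmodType) : nsol T finset.set0 = #|sol A T|.
Proof.
apply: eq_card => x; apply/sol_atP/idP => [[] //|xs]; split => // i; by rewrite inE.
Qed.

Lemma nsol_gt0 (T : finZmodType) J : (0 < nsol T J)%N.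
Proof. by apply/card_gt0P; exists 0; apply/sol_atP; split => //; rewrite sol0. Qed.

Lemma nsol_setT (T : finZmodType) : nsol T [set: 'I_k] = 1%N.
Proof.
apply/eqP/cards1P; exists 0; apply/setP => x; rewrite inE; apply/sol_atP/eqP => [[_ x0]|->].
  by apply/ffunP => i; rewrite x0 ?inE.
by split => //; exact: sol0.
Qed.

Lemma nsolS (T : finZmodType) (J J' : {set 'I_k}) : J \subset J' -> (nsol T J' <= nsol T J)%N.
Proof.
move=> /fintype.subsetP sJ; apply/subset_leq_card/fintype.subsetP => x /sol_atP [xs x0].
by apply/sol_atP; split => // i /sJ; apply: x0.
Qed.

Lemma card_sol_at_sol (T : finZmodType) J (y : {ffun 'I_k -> T}) :
  y \in sol A T -> #|sol_at J y| = nsol T J.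
Proof.
move=> ys; rewrite /nsol -[RHS](card_imset _ (addIr y)); apply: eq_card => x.
apply/sol_atP/imsetP => [[xs xy]|[z /sol_atP [zs z0] ->]].
  exists (x - y); last by rewrite subrK.
  by apply/sol_atP; split => [|i iJ]; rewrite ?solB // !ffunE xy // subrr.
by split => [|i iJ]; rewrite ?solD // !ffunE z0 // ffunE add0r.
Qed.

Lemma card_sol_at_le (T : finZmodType) J (y : {ffun 'I_k -> T}) : (#|sol_at J y| <= nsol T J)%N.
Proof.
have [->|[x]] := set_0Vmem (sol_at J y); first by rewrite cards0.
case/sol_atP => xs xy; rewrite -(card_sol_at_sol J xs); apply/subset_leq_card/fintype.subsetP => z.
by case/sol_atP => zs zy; apply/sol_atP; split => // i iJ; rewrite zy // xy.
Qed.

Lemma nsol_row (G : finZmodType) n J : nsol 'rV[G]_n J = (nsol G J ^ n)%N.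
Proof.
pose slice (x : {ffun 'I_k -> 'rV[G]_n}) : {ffun 'I_n -> {ffun 'I_k -> G}} :=
  [ffun i => [ffun j => x j 0 i]].
pose unslice (z : {ffun 'I_n -> {ffun 'I_k -> G}}) : {ffun 'I_k -> 'rV[G]_n} :=
  [ffun j => \row_i z i j].
have sliceK : cancel slice unslice.
  by move=> x; apply/ffunP => j; apply/rowP => i; rewrite ffunE mxE !ffunE.
have unsliceK : cancel unslice slice.
  by move=> z; apply/ffunP => i; apply/ffunP => j; rewrite !ffunE mxE.
rewrite -[n in RHS]card_ord -card_ffun_on.
rewrite -(on_card_preimset (f := slice)); last by exists unslice => x _;
  [exact: sliceK | exact: unsliceK].
apply: eq_card => x; rewrite [RHS]finset.in_set; apply/sol_atP/ffun_onP => [[xs x0] i|xi].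
  apply/sol_atP; split => [|j jJ]; last by rewrite !ffunE x0 // ffunE mxE.
  rewrite ffunE (@sol_morph _ _ _ _ _ (fun v : 'rV[G]_n => v 0 i) x) //.
  by move=> u v; rewrite mxE.
split => [|j jJ]; last first.
  apply/rowP => i; have /sol_atP [_ /(_ _ jJ)] := xi i.
  by rewrite !ffunE => ->; rewrite mxE.
rewrite inE; apply/eqP/ffunP => i; apply/rowP => c.
have /sol_atP [+ _] := xi c; rewrite inE => /eqP/ffunP/(_ i).
rewrite !ffunE mxE => <-; have cD : {morph (fun v : 'rV[G]_n => v 0 c) : u v / u + v}.
  by move=> u v; rewrite mxE.
rewrite (morph_add_sum cD); apply: eq_bigr => j _.
by rewrite (morph_addMz cD) !ffunE.
Qed.

(** Extension by zero identifies the kernel of [del_cols A J] with the solutions vanishing on [J];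
    this is how ranks become counts. *)
Lemma nsol_del_cols (G : finZmodType) (J : {set 'I_k}) :
  (#|[set int_mul (del_cols A J) x | x : {ffun 'I_#|~: J| -> G}]| * nsol G J
   = #|G| ^ #|~: J|)%N.
Proof.
rewrite -[in RHS](card_ord #|~: J|) -card_ffun -(card_im_ker (@int_mulD _ _ (del_cols A J) G)).
congr (_ * _)%N.
pose res (x : {ffun 'I_k -> G}) : {ffun 'I_#|~: J| -> G} := [ffun i => x (enum_val i)].
have mulE (x : {ffun 'I_k -> G}) : {in J, x =1 (0 : {ffun 'I_k -> G})} -> int_mul (del_cols A J) (res x) = int_mul A x.
  move=> x0; apply/ffunP => i;
    rewrite !ffunE [RHS](bigID (mem J)) /= [X in _ = X + _]big1 ?add0r; last first.
    by move=> j jJ; rewrite x0 // ffunE mul0rz.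
  rewrite (eq_bigl (fun j => j \in ~: J)); last by move=> j; rewrite !inE.
  rewrite [RHS]big_enum_val /=; apply: eq_bigr => j _.
  by rewrite ffunE /del_cols mxE.
have res_inj : {in sol_at J (0 : {ffun 'I_k -> G}) &, injective res}.
  move=> x x' /sol_atP [_ x0] /sol_atP [_ x0'] e; apply/ffunP => j.
  case: (boolP (j \in J)) => jJ; first by rewrite x0 // x0'.
  have jJ' : j \in ~: J by rewrite inE.
  by move/ffunP: e => /(_ (enum_rank_in jJ' j)); rewrite !ffunE enum_rankK_in.
rewrite /nsol -(card_in_imset res_inj); apply: eq_card => y; rewrite [RHS]finset.in_set.
apply/imsetP/eqP => [[x /sol_atP [xs x0] ->]|My].
  by rewrite mulE //; move: xs; rewrite inE => /eqP.
pose x : {ffun 'I_k -> G} :=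
  [ffun j => if [pick i : 'I_#|~: J| | enum_val i == j] is Some i then y i else 0].
have x0 : {in J, x =1 (0 : {ffun 'I_k -> G})}.
  move=> j jJ; rewrite !ffunE; case: pickP => // i /eqP ij.
  by have := enum_valP i; rewrite ij inE jJ.
have rx : res x = y.
  apply/ffunP => i; rewrite !ffunE; case: pickP => [i' /eqP/enum_val_inj -> //|].
  by move=> /(_ i); rewrite eqxx.
by exists x => //; apply/sol_atP; split => //; rewrite inE -mulE // rx My.
Qed.

End CountSolutions.

(** * The base [u] of the threshold and the extremal set of columns *)

Section ThresholdExponent.

Variables (R : realType) (G : finZmodType) (l k : nat) (A : 'M[int]_(l, k)).

Lemma nsol_setU1 (T : finZmodType) (J : {set 'I_k}) (j : 'I_k) :
  (nsol A T J <= #|T| * nsol A T (j |: J))%N.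
Proof.
rewrite -sum_nat_const /nsol -[X in (X <= _)%N]sum1_card.
rewrite (partition_big (fun x : {ffun 'I_k -> T} => x j) predT) //=; apply: leq_sum => a _.
rewrite sum1_card; apply: leq_trans (card_sol_at_le A (j |: J) [ffun i => if i == j then a else 0]).
apply/subset_leq_card/fintype.subsetP => x /andP [/sol_atP [xs x0] /eqP xj].
apply/sol_atP; split => // i; rewrite !inE ffunE; case: eqP => [-> _|_ /= iJ] //.
by rewrite x0 // ffunE.
Qed.

Lemma im_nsol : (#|[set int_mul A x | x : {ffun 'I_k -> G}]| * nsol A G finset.set0 = #|G| ^ k)%N.
Proof. by rewrite nsol0 -[k in RHS]card_ord -card_ffun -(card_im_ker (@int_mulD _ _ A G)). Qed.

Lemma rankG_gt0 : 0 < rankG R G A ->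
  (1 < #|G|)%N /\ (1 < #|[set int_mul A x | x : {ffun 'I_k -> G}]|)%N.
Proof.
rewrite /rankG; case: ifP; last by rewrite ltxx.
move=> g_gt1 im_pos; split => //; rewrite ltnNge; apply/negP => im_le1.
move: im_pos; rewrite (_ : ln _ = 0) ?mul0r ?ltxx //; apply/eqP.
by move: im_le1; case: #|_| => [|[|]] // _; [rewrite ln0 | rewrite ln1].
Qed.

(** With a single column, its kernel vector from the columns condition has entry 1, so the column
    acts as zero and the image is trivial. *)
Lemma columns_im (s : nat) : (1 < s)%N -> (forall g : G, g *+ s = 0) -> s_columns_condition s A ->
  (1 < #|[set int_mul A x | x : {ffun 'I_k -> G}]|)%N -> (1 < k)%N.
Proof.
move=> s_gt1 Gs /(columns_kernel s_gt1) [M [v [v1 v0]]] im_gt1; rewrite ltnNge; apply/negP => k_le1.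
move: im_gt1; rewrite ltnNge => /negP [];
  rewrite [leqRHS](_ : _ = #|[set (0 : {ffun 'I_l -> G})]|); last by rewrite cards1.
apply/subset_leq_card/fintype.subsetP => _ /imsetP [x _ ->]; rewrite inE; apply/eqP/ffunP => i.
rewrite !ffunE; have [j0|k0] := pickP 'I_k; last by apply: big1 => j; have := k0 j.
move=> _; have [t [ltM vt _]] := v1 j0.
have only j : j = j0.
  by apply/val_inj; move: (ltn_ord j) (ltn_ord j0) k_le1 => /=; lia.
rewrite -[RHS](v0 t G (x j0) i ltM (Gs _)).
by apply: eq_bigr => j _; rewrite (only j) vt.
Qed.

Let lg : R := ln #|G|%:R.
Let L (J : {set 'I_k}) : R := ln (nsol A G J)%:R.

(** Image times kernel is a power of [#|G|], both for [A] and for the deletion; the exponents [k]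
    and [k - #|J|] cancel against [#|J|]. *)
Lemma mG_denominator (J : {set 'I_k}) : (1 < #|G|)%N ->
  #|J|%:R - 1 + rankG R G (del_cols A J) - rankG R G A = (L finset.set0 - L J) / lg - 1.
Proof.
move=> g_gt1; have lg_gt0 : 0 < lg by rewrite ln_gt0 // ltr1n.
rewrite /rankG g_gt1 -/lg.
have lnE (a b c : nat) : (0 < b)%N -> (a * b = #|G| ^ c)%N ->
    ln (a%:R : R) = c%:R * lg - ln b%:R.
  move=> b_gt0 abc; have : ln ((a * b)%:R : R) = c%:R * lg.
    by rewrite abc natrX lnXn ?ltr0n ?(ltnW g_gt1) // mulr_natl.
  have a_gt0 : (0 < a)%N.
    by case: a abc => // /esym /eqP; rewrite mul0n expn_eq0 eqn0Ngt (ltnW g_gt1).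
  by rewrite natrM lnM ?posrE ?ltr0n // => <-; rewrite addrK.
rewrite (lnE _ _ _ (nsol_gt0 A G J) (nsol_del_cols A G J)) (lnE _ _ _ (nsol_gt0 A G finset.set0) im_nsol).
rewrite -/(L J) -/(L finset.set0).
have -> : (#|~: J|%:R : R) = k%:R - #|J|%:R.
  have kE : (k%:R : R) = #|J|%:R + #|~: J|%:R by rewrite -natrD cardsC card_ord.
  by rewrite kE addrAC subrr add0r.
by field; rewrite gt_eqF.
Qed.

(** Abundance says that the two entries in [J] of a solution range uniformly over G^2. *)
Lemma abundant_nsol2 (J : {set 'I_k}) : (1 < #|G|)%N -> abundant R G A -> #|J| = 2%N ->
  (nsol A G J * #|G| ^ 2 = #|sol A G|)%N.
Proof.
move=> g_gt1 hab J2; have := mG_denominator J g_gt1; rewrite (hab J J2) J2.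
have lg_gt0 : 0 < lg by rewrite ln_gt0 // ltr1n.
move=> e; have {}e : L finset.set0 = L J + 2 * lg.
  have : (L finset.set0 - L J) / lg = 2 by lra.
  by move=> /(congr1 (fun x => x * lg)); rewrite mulfVK ?gt_eqF // => e'; lra.
apply/eqP; rewrite -(eqr_nat R) -nsol0; apply/eqP/ln_inj;
  rewrite ?posrE ?ltr0n ?muln_gt0 ?nsol_gt0 ?expn_gt0 ?(ltnW g_gt1) //.
rewrite natrM lnM ?posrE ?ltr0n ?nsol_gt0 ?expn_gt0 ?(ltnW g_gt1) // natrX lnXn ?ltr0n ?(ltnW g_gt1) //.
by rewrite -/(L J) -/(L finset.set0) e mulr_natl.
Qed.

(** Fixing one more entry loses at most a factor [#|G|]; for a pair the two losses together are
    exactly [#|G| ^ 2], so each of them is full. *)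
Lemma abundant_nsol1 (i : 'I_k) : (1 < k)%N -> (1 < #|G|)%N -> abundant R G A ->
  (nsol A G [set i] * #|G| = #|sol A G|)%N.
Proof.
move=> k_gt1 g_gt1 hab.
have [j ji] : exists j, j != i.
  have : (0 < #|predC1 i|)%N by have := cardC1 i; rewrite card_ord => ->; case: (k) k_gt1 => [|[|]].
  by move=> /card_gt0P [j]; rewrite inE => ji; exists j.
have c2 : #|j |: [set i]| = 2%N by rewrite cardsU1 cards1 inE ji.
have := nsol_setU1 G [set i] j; have := nsol_setU1 G finset.set0 i.
have := abundant_nsol2 g_gt1 hab c2; rewrite finset.setU0 nsol0 => h2 h0 h1.
by move: h2 h1 h0; rewrite expnS expn1; nia.
Qed.

Lemma exponent_gt1 (s : nat) : is_exponent G s -> (1 < #|G|)%N ->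
  (1 < s)%N /\ forall g : G, g *+ s = 0.
Proof.
move=> [s_gt0 Gs _] g_gt1; split => //.
rewrite ltn_neqAle s_gt0 andbT eq_sym; apply/eqP => s1; move: g_gt1; rewrite ltnNge => /negP [].
by apply/fintype_le1P => x y; rewrite -[x]mulr1n -[y]mulr1n -s1 !Gs.
Qed.

Lemma threshold_exponent (s : nat) :
    is_exponent G s -> s_columns_condition s A -> 0 < rankG R G A -> abundant R G A ->
  exists u : R, [/\ 0 < u < 1, 1 < u * #|G|%:R,
      forall n : nat, #|G|%:R `^ (- (n%:R / mG R G A)) = u ^+ n,
      forall J : {set 'I_k}, (0 < #|J|)%N ->
        (nsol A G J)%:R * #|G|%:R <= #|sol A G|%:R * u ^+ #|J|.-1 &
      exists W : {set 'I_k}, [/\ (2 < #|W|)%N,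
        (nsol A G W)%:R * #|G|%:R = #|sol A G|%:R * u ^+ #|W|.-1 &
        forall J : {set 'I_k}, J \proper W -> (1 < #|J|)%N ->
          (nsol A G J)%:R * #|G|%:R < #|sol A G|%:R * u ^+ #|J|.-1]].
Proof.
move=> hs hcol hrank hab; have [g_gt1 im_gt1] := rankG_gt0 hrank.
have [s_gt1 Gs] := exponent_gt1 hs g_gt1.
have k_gt1 := columns_im s_gt1 Gs hcol im_gt1.
have lg_gt0 : 0 < lg by rewrite ln_gt0 // ltr1n.
have g_gt0 : 0 < (#|G|%:R : R) by rewrite ltr0n (ltnW g_gt1).
pose d J : R := (L finset.set0 - L J) / lg - 1.
have d2 (J : {set 'I_k}) : #|J| = 2%N -> d J = 1.
  by move=> J2; rewrite /d -mG_denominator // hab // J2 addrK; lra.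
have Lle (J J' : {set 'I_k}) : J \subset J' -> L J' <= L J.
  by move=> sJ; rewrite ler_ln ?posrE ?ltr0n ?nsol_gt0 // ler_nat nsolS.
have d_ge1 (J : {set 'I_k}) : (1 < #|J|)%N -> 1 <= d J.
  move=> /card_gt1P [i [j [iJ jJ ij]]].
  have c2 : #|[set i; j]| = 2%N by rewrite cards2 ij.
  rewrite -(d2 _ c2) lerD2r ler_pM2r ?invr_gt0 // lerD2l lerN2 Lle //.
  by apply/fintype.subsetP => x; rewrite !inE => /orP [] /eqP ->.
pose q (J : {set 'I_k}) : R := (#|J|%:R - 1) / d J.
have mE : mG R G A = \big[Num.max/0]_(W : {set 'I_k} | (2 <= #|W|)%N) q W.
  by apply: eq_bigr => W _; rewrite mG_denominator.
have q_le (J : {set 'I_k}) : (1 < #|J|)%N -> q J <= mG R G A by move=> J2; rewrite mE;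
  exact: le_bigmax_cond.
have kT : (1 < #|[set: 'I_k]|)%N by rewrite cardsT card_ord.
(* Test the maximum on all columns: only 0 vanishes there, and positive rank makes the solutions
   fewer than [#|G| ^ k]. *)
have m_gt1 : 1 < mG R G A.
  apply: lt_le_trans (q_le [set: 'I_k] kT);
    rewrite /q ltr_pdivlMr ?(lt_le_trans _ (d_ge1 _ kT)) // mul1r.
  rewrite cardsT card_ord /d ltrD2r ltr_pdivrMr // /L nsol_setT ln1 subr0.
  rewrite mulr_natl -lnXn // -natrX ltr_ln ?posrE ?ltr0n ?nsol_gt0 ?expn_gt0 ?(ltnW g_gt1) //.
  by rewrite ltr_nat -im_nsol ltn_Pmull // nsol_gt0.
have m_gt0 : 0 < mG R G A by apply: lt_trans m_gt1.
have sol_gt0 : 0 < (#|sol A G|%:R : R) by rewrite -nsol0 ltr0n nsol_gt0.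
pose u : R := expR (- (lg / mG R G A)).
have uX n : u ^+ n = expR (- (n%:R * (lg / mG R G A))) by rewrite -expRM_natl mulrN.
have nsolE (J : {set 'I_k}) : (nsol A G J)%:R * #|G|%:R = #|sol A G|%:R * expR (- (d J * lg)).
  have -> : - (d J * lg) = lg + L J - L finset.set0 by rewrite /d; field; rewrite gt_eqF.
  rewrite expRB expRD /lg /L !lnK ?posrE ?ltr0n ?nsol_gt0 // ?(ltnW g_gt1) // nsol0.
  by field; rewrite gt_eqF.
have uE n : u ^+ n = expR (- (n%:R / mG R G A * lg)) by rewrite uX mulrAC -mulrA.
have cmp (J : {set 'I_k}) : (1 < #|J|)%N -> #|J|.-1%:R / mG R G A <= d J.
  move=> J2; rewrite ler_pdivrMr // mulrC -ler_pdivrMr ?(lt_le_trans _ (d_ge1 _ J2)) //.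
  by apply: le_trans (q_le _ J2); rewrite /q -subn1 natrB // (ltnW J2).
have u_gt0 : 0 < u by rewrite expR_gt0.
exists u; split.
- by rewrite u_gt0 /= /u -expR0 ltr_expR oppr_lt0 divr_gt0.
- rewrite -[X in _ * X]lnK ?posrE // /u -expRD -[X in X < _]expR0 ltr_expR addrC subr_gt0 -/lg.
  by rewrite ltr_pdivrMr // -[X in X < _]mulr1 ltr_pM2l.
- by move=> n; rewrite uE /powR gt_eqF // mulNr.
- move=> J; rewrite leq_eqVlt => /orP [/eqP/esym J1|J2].
    (* [mG] says nothing about single columns; there abundance gives equality. *)
    have /eqP/cards1P [i ->] := J1; rewrite cards1 expr0 mulr1 -natrM.
    by rewrite (abundant_nsol1 i k_gt1 g_gt1 hab).
  by rewrite nsolE ler_pM2l // uE ler_expR lerN2 ler_pM2r // cmp.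
have [W0 W0c qW0] : {W0 : {set 'I_k} | W0 \in (fun W : {set 'I_k} => (2 <= #|W|)%N) & mG R G A = q W0}.
  rewrite mE; apply: (eq_bigmax [set: 'I_k]) => // J J2; apply: divr_ge0;
    last exact: le_trans (d_ge1 _ J2).
  by rewrite subr_ge0 ler1n (ltnW J2).
pose P (W : {set 'I_k}) := (1 < #|W|)%N && (#|W|.-1%:R / mG R G A == d W).
have PW0 : P W0.
  have d0 := lt_le_trans ltr01 (d_ge1 _ W0c); have c2 : (1 < #|W0|)%N by [].
  apply/andP; split => //; rewrite qW0 /q -subn1 natrB ?(ltnW c2) //.
  rewrite invf_div mulrCA divff ?mulr1 // subr_eq0 pnatr_eq1.
  by rewrite gtn_eqF.
(* Minimal size makes the inequality strict on proper subsets with at least two elements. A pair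
   cannot attain the maximum, since it has quotient 1 while [mG] exceeds 1. *)
have [W /andP [W2 /eqP dW] Wmin] := @arg_minnP _ W0 P (fun W => #|W|) PW0.
exists W; split.
- rewrite ltn_neqAle W2 andbT; apply/eqP => /esym Wc; move: dW; rewrite Wc d2 // mul1r => /eqP.
  by rewrite invr_eq1 gt_eqF.
- by rewrite nsolE uE dW.
- move=> J /[dup] /proper_card JW _ J2; rewrite nsolE ltr_pM2l // uE ltr_expR ltrN2 ltr_pM2r //.
  rewrite lt_neqAle cmp // andbT; apply/eqP => dJ.
  have := Wmin J; rewrite /P J2 dJ eqxx => /(_ isT); by rewrite leqNgt JW.
Qed.

End ThresholdExponent.

(** * Containers: eliminating one coordinate by adaptive queries *)

Section Containers.

Variables (R : realType) (k : nat).

Section Degrees.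

Variable V : finType.
Implicit Types (H F : {set {ffun 'I_k -> V}}) (W Act : {set 'I_k}) (I Q T : {set V}).

Definition deg H W (y : {ffun 'I_k -> V}) : nat := #|[set x in H | [forall i in W, x i == y i]]|.

(** The codegree condition of the container method for ordered tuples: [Act] holds the coordinates
    not yet eliminated, [e] is the scale of one-vertex degrees, and each further vertex gains a
    factor [q]. *)
Definition bounded_deg H Act (K q e : R) := forall W y, W \subset Act -> (0 < #|W|)%N ->
  (deg H W y)%:R <= K * q ^+ #|W|.-1 * e.

Definition coord H (j : 'I_k) : {set V} := [set x j | x : {ffun 'I_k -> V} in H].

Lemma deg_subset F H W y : F \subset H -> (deg F W y <= deg H W y)%N.
Proof.
move=> /fintype.subsetP sFH; apply/subset_leq_card/fintype.subsetP => x.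
by rewrite !inE => /andP [/sFH -> ->].
Qed.

Lemma bounded_deg_subset F H Act K q e :
  F \subset H -> bounded_deg H Act K q e -> bounded_deg F Act K q e.
Proof.
by move=> sFH bH W y sW W0; apply: le_trans (bH W y sW W0); rewrite ler_nat deg_subset.
Qed.

Lemma deg_agree H W (y z : {ffun 'I_k -> V}) : {in W, y =1 z} -> deg H W y = deg H W z.
Proof.
move=> yz; apply: eq_card => x; rewrite !inE; congr (_ && _).
by apply: eq_forallb => i; case: (boolP (i \in W)) => //= iW; rewrite yz.
Qed.

Lemma card_by_coord H Act (K q e : R) j Q : bounded_deg H Act K q e -> j \in Act ->
  #|[set x in H | x j \in Q]|%:R <= #|Q|%:R * (K * e).
Proof.
move=> bH jA; have bj y : (deg H [set j] y)%:R <= K * e.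
  by have := bH [set j] y; rewrite finset.sub1set cards1 expr0 mulr1; apply.
rewrite -sum1_card (partition_big (fun x : {ffun 'I_k -> V} => x j) (mem Q)) /=; last first.
  by move=> x; rewrite inE => /andP [].
rewrite natr_sum mulr_natl -sumr_const; apply: ler_sum => v _; rewrite sum1_card.
apply: le_trans (bj [ffun=> v]); rewrite ler_nat.
apply/subset_leq_card/fintype.subsetP => x /andP []; rewrite !inE => /andP [-> _] xv.
by apply/forall_inP => i; rewrite inE => /eqP ->; rewrite ffunE.
Qed.

End Degrees.

Section Step.

Variables (V : finType) (H : {set {ffun 'I_k -> V}}) (Act : {set 'I_k}) (j : 'I_k).
Variables (K q e d : R) (b : nat).
Hypotheses (jAct : j \notin Act) (bH : bounded_deg H (j |: Act) K q e).
Hypotheses (K_ge1 : 1 <= K) (q_gt0 : 0 < q) (e_gt0 : 0 < e) (d_gt0 : 0 < d).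

Definition unsat (F : {set {ffun 'I_k -> V}}) (x : {ffun 'I_k -> V}) :=
  [forall W : {set 'I_k}, (W \subset Act) && (0 < #|W|)%N ==> ((deg F W x)%:R <= q ^+ #|W| * e)].

Definition link F (v : V) := [set x in H | (x j == v) && unsat F x].

Definition query_inv (I Q : {set V}) (F : {set {ffun 'I_k -> V}}) :=
  [/\ F \subset H, forall x, x \in F -> x j \in Q :&: I, #|Q :&: I|%:R * d <= #|F|%:R,
      bounded_deg F Act (K + 1) q (q * e) & Q \subset coord H j] /\ (#|Q :&: I| <= b)%N.

Lemma query_inv_no (I Q : {set V}) F v : v \notin I -> v \in coord H j ->
  query_inv I Q F -> query_inv I (v |: Q) F.
Proof.
move=> vI vH [[FH FQ Fd Fdeg QH] Qb]; have QE : (v |: Q) :&: I = Q :&: I.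
  by apply/setP => x; rewrite !inE; case: eqP => [->|//]; rewrite (negPf vI) !andbF.
split; last by rewrite QE.
split; rewrite ?QE //.
by rewrite finset.subUset finset.sub1set vH QH.
Qed.

Lemma query_inv_yes (I Q : {set V}) F v : v \in I -> v \notin Q -> v \in coord H j ->
  d <= #|link F v|%:R -> (#|Q :&: I| < b)%N ->
  query_inv I Q F -> query_inv I (v |: Q) (F :|: link F v).
Proof.
move=> vI vQ vH dv lt_b [[FH FQ Fd Fdeg QH] Qb].
have QE : (v |: Q) :&: I = v |: (Q :&: I).
  by apply/setP => x; rewrite !inE; case: eqP => [->|//]; rewrite vI.
have vQI : v \notin Q :&: I by rewrite inE (negPf vQ).
split; last by rewrite QE cardsU1 vQI.
split.
- rewrite finset.subUset FH; apply/fintype.subsetP => x; by rewrite !inE => /andP [].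
- move=> x; rewrite inE QE => /orP [/FQ xQ|]; first by rewrite !inE in xQ *; rewrite xQ orbT.
  by rewrite !inE => /andP [_ /andP [-> _]].
- rewrite QE cardsU1 vQI cardsU (_ : F :&: link F v = finset.set0) ?cards0 ?subn0.
    by rewrite !natrD mulrDl mul1r addrC lerD.
  apply/setP => x; rewrite !inE; apply/negP => /andP [/FQ xF /andP [_ /andP [/eqP xv _]]].
  by move: xF; rewrite xv (negPf vQI).
- move=> W y sW W0; case: (boolP [exists x in link F v, [forall i in W, x i == y i]]).
    move=> /exists_inP [x xl /forall_inP xy].
    have yx : {in W, y =1 x} by move=> i iW; rewrite (eqP (xy i iW)).
    have jW : j \notin W by apply: contra jAct; apply: (fintype.subsetP sW).
    rewrite (deg_agree _ yx).
    apply: (@le_trans _ _ ((deg F W x)%:R + (deg H (j |: W) x)%:R)).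
      rewrite -natrD ler_nat /deg; apply: leq_trans (subset_leq_card _) (leq_card_setU _ _).
      apply/fintype.subsetP => z; rewrite !inE => /andP [/orP [->|/andP [zH /andP [/eqP zv _]]] zW].
        by rewrite zW.
      apply/orP; right; rewrite zH; apply/forall_inP => i; rewrite inE => /orP [|iW].
        by rewrite inE => /eqP ->; move: xl; rewrite !inE => /andP [_ /andP [/eqP -> _]];
          rewrite zv.
      by move/forall_inP: zW; apply.
    move: xl; rewrite !inE => /andP [_ /andP [_ /forallP/(_ W)]]; rewrite sW W0 /= => degF.
    have := bH x (finset.setUS [set j] sW); rewrite cardsU1 jW => /(_ isT) /= degH.
    have -> : (K + 1) * q ^+ #|W|.-1 * (q * e) = q ^+ #|W| * e + K * q ^+ #|W| * e.
      by rewrite -[in RHS](prednK W0) exprS; ring.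
    exact: lerD.
  move=> none; suff -> : deg (F :|: link F v) W y = deg F W y by exact: Fdeg.
  apply: eq_card => x; rewrite !inE andb_orl; case: (boolP (x \in link F v)) => xl; last first.
    by move: xl; rewrite inE => /negPf ->; rewrite orbF.
  suff /negPf -> : ~~ [forall i in W, x i == y i] by rewrite !andbF.
  by apply: contra none => xW; apply/exists_inP; exists x.
- by rewrite finset.subUset finset.sub1set vH QH.
Qed.

(* [Phi] runs a decision tree of queries "is v in I?"; its leaf is determined by
   the set of queried vertices lying in [I]. *)
Lemma query_tree n (Q : {set V}) F t : (#|~: Q| <= n)%N ->
  exists Phi : {set V} -> {set V} * {set {ffun 'I_k -> V}}, forall I,
    query_inv I Q F -> #|Q :&: I| = t ->
    exists Q' F', [/\ Phi (Q' :&: I) = (Q', F'), Q \subset Q', query_inv I Q' F' &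
      (b <= #|Q' :&: I|)%N \/ forall v, v \notin Q' -> #|link F' v|%:R < d].
Proof.
elim: n Q F t => [|n IHn] Q F t leQ.
  exists (fun=> (Q, F)) => I inv_I _; exists Q, F; split => //; right => v vQ.
  by move: leQ; rewrite leqn0 cards_eq0 => /eqP/setP/(_ v); rewrite !inE vQ.
have [le_bt|lt_tb] := leqP b t.
  by exists (fun=> (Q, F)) => I inv_I tE; exists Q, F; split => //; left; rewrite tE.
case: (boolP [exists v, (v \notin Q) && (d <= #|link F v|%:R)]); last first.
  move=> /existsPn none; exists (fun=> (Q, F)) => I inv_I _; exists Q, F; split => //;
    right => v vQ.
  by have := none v; rewrite vQ /= -ltNge.
move=> /existsP [v /andP [vQ dv]].
have leQ' : (#|~: (v |: Q)| <= n)%N.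
  by move: leQ; rewrite (cardsD1 v (~: Q)) !inE vQ /= ltnS finset.setDE finset.setIC -finset.setCU.
have vH : v \in coord H j.
  have : (0 < #|link F v|)%N by rewrite -(ltr_nat R) (lt_le_trans d_gt0).
  by move=> /card_gt0P [x]; rewrite inE => /andP [xH /andP [/eqP <- _]]; apply: imset_f.
have [Phi1 H1] := IHn (v |: Q) (F :|: link F v) t.+1 leQ'.
have [Phi0 H0] := IHn (v |: Q) F t leQ'.
exists (fun T : {set V} => if v \in T then Phi1 T else Phi0 T) => I inv_I tE.
have [vI|vI] := boolP (v \in I).
  have [||Q' [F' [PhiE QQ' inv' stop]]] := H1 I.
  - by apply: query_inv_yes => //; rewrite tE.
  - rewrite -tE (_ : (v |: Q) :&: I = v |: (Q :&: I)) ?cardsU1 ?inE ?(negPf vQ) //.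
    by apply/setP => x; rewrite !inE; case: eqP => [->|//]; rewrite vI.
  exists Q', F'; split => //; last by apply: fintype.subset_trans QQ'; apply: finset.subsetUr.
  by rewrite inE vI (fintype.subsetP QQ') ?inE ?eqxx.
have [||Q' [F' [PhiE QQ' inv' stop]]] := H0 I.
- exact: query_inv_no.
- rewrite -tE; apply: eq_card => x; rewrite !inE.
  by case: eqP => [->|//]; rewrite (negPf vI) !andbF.
exists Q', F'; split => //; last by apply: fintype.subset_trans QQ'; apply: finset.subsetUr.
by rewrite inE (negPf vI) andbF.
Qed.

(** Group the tuples by their restriction to [W]. In a saturated group [F] has more than
    [q ^+ #|W| * e] tuples, while the codegree bound gives [H] at most [K / q] times as many. *)
Lemma card_saturated (F : {set {ffun 'I_k -> V}}) (W : {set 'I_k}) : W \subset Act -> (0 < #|W|)%N ->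
  q * #|[set x in H | ~~ ((deg F W x)%:R <= q ^+ #|W| * e)]|%:R <= K * #|F|%:R.
Proof.
move=> sW W0; set B := [set x in H | _].
pose r (x : {ffun 'I_k -> V}) : {ffun 'I_k -> option V} :=
  [ffun i => if i \in W then Some (x i) else None].
have rP (x y : {ffun 'I_k -> V}) : (r x == r y) = [forall i in W, x i == y i].
  apply/eqP/forall_inP => [/ffunP rxy i iW|xy].
    by move: (rxy i); rewrite !ffunE iW => -[->].
  by apply/ffunP => i; rewrite !ffunE; case: ifP => // iW; rewrite (eqP (xy i iW)).
have K_gt0 : 0 < K by apply: lt_le_trans K_ge1.
have cE (S : {set {ffun 'I_k -> V}}) : #|S| = (\sum_c #|[pred i in S | r i == c]|)%N.
  rewrite -sum1_card (partition_big r predT) //; apply: eq_bigr => c _; by rewrite sum1_card.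
rewrite !cE !natr_sum !mulr_sumr; apply: ler_sum => c _.
have [->|/card_gt0P [x /andP [xB /eqP rx]]] := posnP #|[pred i in B | r i == c]|.
  by rewrite mulr0 mulr_ge0 // ltW.
have -> : #|[pred i in F | r i == c]| = deg F W x.
  by apply: eq_card => y; rewrite !inE -rx rP.
apply: (@le_trans _ _ (q * (deg H W x)%:R)).
  rewrite ler_pM2l // ler_nat; apply/subset_leq_card/fintype.subsetP => y; rewrite !inE -rx rP.
  by move=> /andP [/andP [-> _] ->].
apply: (@le_trans _ _ (q * (K * q ^+ #|W|.-1 * e))).
  by rewrite ler_pM2l // bH // (fintype.subset_trans sW) // finset.subsetUr.
have -> : q * (K * q ^+ #|W|.-1 * e) = K * (q ^+ #|W| * e).
  by rewrite -[in RHS](prednK W0) exprS; ring.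
by rewrite ler_pM2l //; move: xB; rewrite inE -ltNge => /andP [_ /ltW].
Qed.

Lemma card_not_unsat (F : {set {ffun 'I_k -> V}}) :
  q * #|[set x in H | ~~ unsat F x]|%:R <= 2 ^+ k * K * #|F|%:R.
Proof.
have K_gt0 : 0 < K by apply: lt_le_trans K_ge1.
pose B W := [set x in H | ~~ ((deg F W x)%:R <= q ^+ #|W| * e)].
pose P (W : {set 'I_k}) := (W \subset Act) && (0 < #|W|)%N.
apply: (@le_trans _ _ (\sum_(W | P W) q * #|B W|%:R)).
  rewrite -mulr_sumr ler_pM2l // -natr_sum ler_nat -sum1_card.
  apply: (@leq_trans (\sum_(x in [set x in H | ~~ unsat F x]) \sum_(W | P W && (x \in B W)) 1)%N).
    apply: leq_sum => x; rewrite inE => /andP [xH /forallPn [W]].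
    rewrite negb_imply => /andP [PW satW]; rewrite (bigD1 W) //=.
    by apply/andP; split => //; rewrite inE xH.
  rewrite (exchange_big_dep P) /=; last by move=> x W _ /andP [].
  apply: leq_sum => W PW; rewrite sum1_card; apply/subset_leq_card/fintype.subsetP => x.
  by case/and3P.
apply: (@le_trans _ _ (\sum_(W | P W) K * #|F|%:R)).
  by apply: ler_sum => W /andP [sW W0]; apply: card_saturated.
rewrite sumr_const -[X in X <= _]mulr_natl -mulrA ler_wpM2r ?mulr_ge0 ?(ltW K_gt0) //.
rewrite -natrX ler_nat; apply: leq_trans (max_card _) _.
by rewrite -cardsT -powersetT card_powerset cardsT card_ord.
Qed.

(* [a] is the density of [H]; a container step either passes to the link [F] or
   has queried a positive proportion of the vertices. *)
Lemma query_step (a : R) : 0 < a -> d = a * e / 4 -> a * e * #|V|%:R <= #|H|%:R ->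
    q * #|V|%:R <= b%:R -> b%:R <= a / (4 * K) * #|V|%:R ->
  exists Phi : {set V} -> {set V} * {set {ffun 'I_k -> V}}, forall I, exists Q F,
    let T := Q :&: I in
    [/\ Phi T = (Q, F), (#|T| <= b)%N, F \subset H, forall x, x \in F -> x j \in I &
      bounded_deg F Act (K + 1) q (q * e) /\
      (#|F|%:R < a / (4 * 2 ^+ k * K) * (q * e) * #|V|%:R ->
       a / (4 * K) * #|V|%:R <= #|Q :\: T|%:R /\ Q \subset coord H j)].
Proof.
move=> a_gt0 dE leH leqb leb; have K_gt0 : 0 < K by apply: lt_le_trans K_ge1.
have [Phi HPhi] := @query_tree _ finset.set0 finset.set0 0 (leqnn _).
exists Phi => I; have inv0 : query_inv I finset.set0 finset.set0.
  split; last by rewrite finset.set0I cards0.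
  split; rewrite ?finset.sub0set ?finset.set0I ?cards0 ?mul0r //; first by move=> x; rewrite inE.
  move=> W y _ _; rewrite /deg (_ : [set x in finset.set0 | _] = finset.set0) ?cards0.
    by rewrite !mulr_ge0 ?exprn_ge0 ?addr_ge0 // ltW.
  by apply/setP => x; rewrite !inE.
have [|Q [F [PhiE _ [[FH FQ Fd Fdeg QH] Qb] stop]]] := HPhi I inv0.
  by rewrite finset.set0I cards0.
exists Q, F; split => //; first by move=> x /FQ; rewrite inE => /andP [].
split => // Fsmall; split => //.
have two_k : 1 <= (2 ^+ k : R) by rewrite exprn_ege1 // ler1n.
(* If the queries stopped because [b] vertices were found in [I], each brought at least [d] tuples
   into [F], too many for a small [F]. *)
case: stop => [leb'|none].
  have : b%:R * d <= #|F|%:R by apply: le_trans Fd; rewrite ler_pM2r // ler_nat.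
  move=> /(le_lt_trans)/(_ Fsmall); rewrite ltNge => /negP []; rewrite dE.
  apply: (@le_trans _ _ (q * #|V|%:R * (a * e / 4)));
    last by rewrite ler_pM2r // divr_gt0 ?mulr_gt0.
  have -> : a / (4 * 2 ^+ k * K) * (q * e) * #|V|%:R =
      (q * #|V|%:R * (a * e / 4)) * (2 ^+ k * K)^-1.
    by field; rewrite !gt_eqF ?exprn_gt0.
  rewrite ler_piMr //; first by rewrite !mulr_ge0 ?(ltW q_gt0) ?(ltW a_gt0) ?(ltW e_gt0).
  by rewrite invf_le1 ?mulr_gt0 ?exprn_gt0 // mulr_ege1.
have sat_le : #|[set x in H | ~~ unsat F x]|%:R <= a * e * #|V|%:R / 4.
  rewrite -(ler_pM2l q_gt0); apply: le_trans (card_not_unsat F) _.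
  apply: (@le_trans _ _ (2 ^+ k * K * (a / (4 * 2 ^+ k * K) * (q * e) * #|V|%:R))).
    by rewrite ler_pM2l ?mulr_gt0 ?exprn_gt0 // ltW.
  by rewrite le_eqVlt; apply/orP; left; apply/eqP; field; rewrite !gt_eqF ?exprn_gt0.
have out_le : #|[set x in H | (x j \notin Q) && unsat F x]|%:R <= a * e * #|V|%:R / 4.
  rewrite -sum1_card (partition_big (fun x : {ffun 'I_k -> V} => x j) (mem (~: Q))) /=; last first.
    by move=> x; rewrite !inE => /andP [_ /andP []].
  rewrite natr_sum; apply: (@le_trans _ _ (\sum_(v in ~: Q) d)).
    apply: ler_sum => v; rewrite inE => vQ; apply: le_trans (ltW (none v vQ)).
    rewrite sum1_card ler_nat; apply/subset_leq_card/fintype.subsetP => x /andP [].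
    by rewrite !inE => /andP [-> /andP [_ ->]] ->.
  rewrite sumr_const dE -[X in X <= _]mulr_natr [X in _ <= X]mulrAC ler_pM2l ?divr_gt0 ?mulr_gt0 //.
  by rewrite ler_nat max_card.
have in_le := card_by_coord Q bH (finset.setU11 j Act).
(* Saturated tuples and tuples with unqueried entry [j] account for at most a quarter of
   [a * e * #|V|] each, so half of it has entry [j] in [Q]. The degree bound makes [Q] large, and
   removing at most [b] vertices costs at most half of that. *)
have H_le : (#|H| <= #|[set x in H | ~~ unsat F x]| + #|[set x in H | (x j \notin Q) && unsat F x]|
    + #|[set x in H | x j \in Q]|)%N.
  apply: leq_trans (leq_add (leq_card_setU _ _) (leqnn _)).
  apply: leq_trans (leq_card_setU _ _); apply/subset_leq_card/fintype.subsetP => x xH.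
  by rewrite !inE xH /=; case: (unsat F x); case: (x j \in Q).
have {}in_le : a / (2 * K) * #|V|%:R <= #|Q|%:R.
  move: H_le; rewrite -(ler_nat R) !natrD => H_le.
  have Ke : 0 < K * e by rewrite mulr_gt0.
  rewrite -(ler_pM2r Ke); have -> : a / (2 * K) * #|V|%:R * (K * e) = a * e * #|V|%:R / 2.
    by field; rewrite gt_eqF.
  lra.
have QT : #|Q :\: (Q :&: I)|%:R = #|Q|%:R - #|Q :&: I|%:R :> R.
  by rewrite cardsD finset.setIA finset.setIid natrB // subset_leq_card // finset.subsetIl.
have Tb : #|Q :&: I|%:R <= b%:R :> R by rewrite ler_nat.
have half : a / (2 * K) * #|V|%:R = 2 * (a / (4 * K) * #|V|%:R) by field; rewrite gt_eqF.
by rewrite QT; lra.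
Qed.

End Step.

End Containers.

(** * Containers: induction over the coordinates, then repeated shrinking *)

Section ContainerTheorem.

Variables (R : realType) (k : nat).

Definition fingerprint (V : finType) (I : {set V}) (b : nat) (t : seq {set V}) :=
  all (fun T : {set V} => (T \subset I) && (#|T| <= b)%N) t.

Lemma fingerprint_nseq0 (V : finType) (I : {set V}) b n : fingerprint I b (nseq n finset.set0).
Proof. by rewrite /fingerprint all_nseq finset.sub0set cards0 orbT. Qed.

(* [f t] is a set of vertices that can be discarded: it is large, disjoint from
   [I] and covered by [H]. *)
Lemma container_shrink (s : nat) (a K : R) : 0 < a -> 1 <= K ->
  exists2 d : R, 0 < d & forall (V : finType) (q e : R) (b : nat)
    (H : {set {ffun 'I_k -> V}}) (Act : {set 'I_k}),
  0 < q -> 0 < e -> (0 < #|V|)%N -> q * #|V|%:R <= b%:R -> b%:R <= d * #|V|%:R ->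
  #|Act| = s.+1 -> a * e * #|V|%:R <= #|H|%:R -> bounded_deg H Act K q e ->
  exists f : seq {set V} -> {set V}, forall I : {set V},
    (forall x, x \in H -> exists2 i, i \in Act & x i \notin I) ->
    exists t, [/\ size t = s, fingerprint I b t, [disjoint f t & I],
      d * #|V|%:R <= #|f t|%:R & forall v, v \in f t -> exists2 x, x \in H & exists i, x i = v].
Proof.
elim: s a K => [|s IHs] a K a_gt0 K_ge1; have K_gt0 : 0 < K by apply: lt_le_trans K_ge1.
  exists (a / K); first exact: divr_gt0.
  (* With one active coordinate, every vertex occurring there is outside [I]. *)
  move=> V q e b H Act q_gt0 e_gt0 V_gt0 _ _ /eqP/cards1P [j ->] leH bH.
  exists (fun=> coord H j) => I indep; exists [::]; split => //.
  - rewrite disjoint_subset; apply/fintype.subsetP => _ /imsetP [x xH ->].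
    by have [i /set1P -> ] := indep x xH.
  - have := @card_by_coord R k V H [set j] K q e j (coord H j) bH (set11 j).
    have -> : [set x in H | x j \in coord H j] = H.
      by apply/setP => x; rewrite !inE; case: (boolP (x \in H)) => //= xH; exact: imset_f.
    move=> /(le_trans leH); have Ke : 0 < K * e by rewrite mulr_gt0.
    move=> h; rewrite -(ler_pM2r Ke); apply: le_trans h.
    by rewrite le_eqVlt; apply/orP; left; apply/eqP; field; rewrite gt_eqF.
  - by move=> _ /imsetP [x xH ->]; exists x => //; exists j.
pose a' := a / (4 * 2 ^+ k * K).
have a'_gt0 : 0 < a' by rewrite divr_gt0 ?mulr_gt0 ?exprn_gt0.
have K1_ge1 : 1 <= K + 1 by rewrite lerDr ltW.
have [d' d'_gt0 Hd'] := IHs a' (K + 1) a'_gt0 K1_ge1.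
have aK_gt0 : 0 < a / (4 * K) by rewrite divr_gt0 ?mulr_gt0.
exists (Num.min d' (a / (4 * K))); first by rewrite lt_min d'_gt0.
move=> V q e b H Act q_gt0 e_gt0 V_gt0 leqb leb cAct leH bH.
have V_gt0' : 0 < (#|V|%:R : R) by rewrite ltr0n.
have [j jA] : exists j, j \in Act by apply/card_gt0P; rewrite cAct.
have jA' : j \notin Act :\ j by rewrite !inE eqxx.
have cA' : #|Act :\ j| = s.+1 by have := cardsD1 j Act; rewrite cAct jA => -[].
have bH' : bounded_deg H (j |: (Act :\ j)) K q e by rewrite finset.setD1K.
have leb' : b%:R <= d' * #|V|%:R by apply: le_trans leb _; rewrite ler_pM2r // ge_min lexx.
have leb'' : b%:R <= a / (4 * K) * #|V|%:R.
  by apply: le_trans leb _; rewrite ler_pM2r // ge_min lexx orbT.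
have [Phi HPhi] := @query_step R k V H (Act :\ j) j K q e (a * e / 4) b jA' bH' K_ge1
   q_gt0 e_gt0 (divr_gt0 (mulr_gt0 a_gt0 e_gt0) (ltr0Sn _ _)) a a_gt0 erefl leH leqb leb''.
pose big (F : {set {ffun 'I_k -> V}}) := a' * (q * e) * #|V|%:R <= #|F|%:R.
pose P F (f : seq {set V} -> {set V}) := big F -> bounded_deg F (Act :\ j) (K + 1) q (q * e) ->
  forall I : {set V}, (forall x, x \in F -> exists2 i, i \in Act :\ j & x i \notin I) ->
    exists t, [/\ size t = s, fingerprint I b t, [disjoint f t & I],
      d' * #|V|%:R <= #|f t|%:R & forall v, v \in f t -> exists2 x, x \in F & exists i, x i = v].
have /choice [f Hf] : forall F, exists f, P F f.
  move=> F; have [[bigF degF]|no] := pselect (big F /\ bounded_deg F (Act :\ j) (K + 1) q (q * e)).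
    have [f Hf] := Hd' V q (q * e) b F (Act :\ j) q_gt0 (mulr_gt0 q_gt0 e_gt0) V_gt0 leqb leb' cA' bigF degF.
    by exists f => _ _.
  by exists (fun=> finset.set0) => bigF degF; case: no.
(* Decoding uses the fingerprint alone: [Phi] recovers [Q] and [F] from its head, and the test
   [big F] does not mention [I]. *)
exists (fun t => let T := head finset.set0 t in let: (Q, F) := Phi T in
  if big F then f F (behead t) else Q :\: T) => I indep.
have [Q [F [PhiE Tb FH FI [degF smallF]]]] := HPhi I.
have TI : fingerprint I b [:: Q :&: I] by rewrite /fingerprint /= finset.subsetIr Tb.
case: (boolP (big F)) => bigF.
  have [x xF|t [st tI ftI left fH]] := Hf F bigF degF I.
    have xH := fintype.subsetP FH x xF; have [i iA xi] := indep x xH; exists i => //.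
    by rewrite !inE iA andbT; apply: contraNneq xi => ->; exact: FI.
  exists ((Q :&: I) :: t) => /=; rewrite PhiE bigF st; split => //.
  - by move: TI; rewrite /fingerprint /= andbT => ->.
  - by apply: le_trans left; rewrite ler_pM2r // ge_min lexx.
  - by move=> v /fH [x xF xv]; exists x => //; exact: (fintype.subsetP FH).
have [|leQ QH] := smallF; first by rewrite ltNge.
exists ((Q :&: I) :: nseq s finset.set0) => /=; rewrite PhiE (negPf bigF) size_nseq; split => //.
- by move: TI; rewrite /fingerprint /= andbT => ->; exact: fingerprint_nseq0.
- by rewrite disjoint_subset; apply/fintype.subsetP => v; rewrite !inE; case: (v \in Q);
  rewrite ?andbF // andbT.
- by apply: le_trans leQ; rewrite ler_pM2r // ge_min lexx orbT.
- by move=> v; rewrite inE => /andP [_ /(fintype.subsetP QH) /imsetP [x xH ->]]; exists x => //;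
  exists j.
Qed.

(** As long as the container spans many tuples, [container_shrink] applied to these removes
    [d * #|V|] of its vertices; with [n * d > 1], [n] rounds would remove more than everything. *)
Theorem containers (eps : R) : (0 < k)%N -> 0 < eps ->
  exists M : nat, exists2 d : R, 0 < d & forall (V : finType) (q e : R) (b : nat)
    (H : {set {ffun 'I_k -> V}}),
  0 < q -> 0 < e -> (0 < #|V|)%N -> q * #|V|%:R <= b%:R -> b%:R <= d * #|V|%:R ->
  bounded_deg H [set: 'I_k] 1 q e ->
  exists f : seq {set V} -> {set V}, forall I : {set V},
    (forall x, x \in H -> exists i, x i \notin I) ->
    exists t, [/\ size t = M, fingerprint I b t, I \subset f t &
      #|[set x in H | [forall i, x i \in f t]]|%:R < eps * e * #|V|%:R].
Proof.
move=> k_gt0 eps_gt0.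
have [d d_gt0 Hd] := @container_shrink k.-1 eps 1 eps_gt0 (lexx 1).
pose n := (Num.truncn d^-1).+1.
have n_big : 1 < n%:R * d by rewrite -ltr_pdivrMr // div1r truncnS_gt.
exists (n * k.-1)%N, d => // V q e b H q_gt0 e_gt0 V_gt0 leqb leb bH.
have V_gt0' : 0 < (#|V|%:R : R) by rewrite ltr0n.
pose spanned (C : {set V}) := [set x in H | [forall i, x i \in C]].
have cT : #|[set: 'I_k]| = k.-1.+1 by rewrite cardsT card_ord prednK.
pose P C (g : seq {set V} -> {set V}) := eps * e * #|V|%:R <= #|spanned C|%:R ->
  forall I : {set V}, (forall x, x \in H -> exists i, x i \notin I) ->
  exists t, [/\ size t = k.-1, fingerprint I b t, [disjoint g t & I],
    d * #|V|%:R <= #|g t|%:R & g t \subset C].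
have /choice [g Hg] : forall C, exists g, P C g.
  move=> C; have [bigC|no] := pselect (eps * e * #|V|%:R <= #|spanned C|%:R); last first.
    by exists (fun=> finset.set0) => bigC; case: no.
  have sCH : spanned C \subset H by apply/fintype.subsetP => x; rewrite inE => /andP [].
  have [g Hg] := Hd V q e b (spanned C) [set: 'I_k] q_gt0 e_gt0 V_gt0 leqb leb cT bigC
    (bounded_deg_subset sCH bH).
  exists g => _ I indep; have [x|t [st tI gI leg gC]] := Hg I.
    by move=> /(fintype.subsetP sCH) /indep [i xi]; exists i.
  exists t; split => //; apply/fintype.subsetP => v /gC [x];
    rewrite inE => /andP [_ /forallP xC] [i <-].
  exact: xC.
suff [f Hf] : exists f : seq {set V} -> {set V}, forall I : {set V},
    (forall x, x \in H -> exists i, x i \notin I) ->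
    exists t, [/\ size t = (n * k.-1)%N, fingerprint I b t, I \subset f t &
      #|spanned (f t)|%:R < eps * e * #|V|%:R \/ #|f t|%:R <= (1 - n%:R * d) * #|V|%:R].
  exists f => I indep; have [t [st tI If [//|few]]] := Hf I indep; first by exists t.
  have neg : (1 - n%:R * d) * #|V|%:R < 0 by rewrite pmulr_llt0 // subr_lt0.
  by have := ler0n R #|f t|; rewrite leNgt (le_lt_trans few neg).
elim: (n) => [|m [f Hf]].
  exists (fun=> [set: V]) => I _; exists [::]; split => //.
  by right; rewrite mul0r subr0 mul1r cardsT.
exists (fun t => let C := f (take (m * k.-1) t) in
  if eps * e * #|V|%:R <= #|spanned C|%:R then C :\: g C (drop (m * k.-1) t) else C) => I indep.
have [t [st tI If small]] := Hf I indep.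
have [bigC|smallC] := boolP (eps * e * #|V|%:R <= #|spanned (f t)|%:R); last first.
  (* A container that is already sparse stays unchanged; empty sets pad the fingerprint to its fixed
     length. *)
  exists (t ++ nseq k.-1 finset.set0); rewrite /= take_size_cat // (negPf smallC); split => //.
  - by rewrite size_cat st size_nseq mulSn addnC.
  - by rewrite /fingerprint all_cat; apply/andP; split => //; exact: fingerprint_nseq0.
  - by left; rewrite ltNge.
have [t' [st' tI' gI leg gC]] := Hg (f t) bigC I indep.
exists (t ++ t'); rewrite /= take_size_cat // drop_size_cat // bigC; split => //.
- by rewrite size_cat st st' mulSn addnC.
- by rewrite /fingerprint all_cat; apply/andP; split.
- by rewrite finset.subsetD If disjoint_sym.
right; case: small => [|small]; first by rewrite ltNge bigC.
rewrite cardsD (finset.setIidPr gC) natrB ?subset_leq_card //.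
have -> : (1 - m.+1%:R * d) * #|V|%:R = (1 - m%:R * d) * #|V|%:R - d * #|V|%:R.
  by rewrite -natr1; ring.
exact: lerB.
Qed.

End ContainerTheorem.

Lemma card_bigcup_le (I V : finType) (F : I -> {set V}) :
  (#|\bigcup_i F i| <= \sum_i #|F i|)%N.
Proof.
apply: (big_ind2 (fun (A : {set V}) n => #|A| <= n)%N); rewrite ?cards0 // => A a A' a' hA hA'.
exact: leq_trans (leq_card_setU _ _) (leq_add hA hA').
Qed.

(** * Union bounds for the random set *)

Section RandomSubset.

Variables (R : realType) (V : finType).
Implicit Types (S U D : {set V}) (p : R).

Lemma sum_set_exp (a b : R) : \sum_(S : {set V}) a ^+ #|S| * b ^+ #|~: S| = (a + b) ^+ #|V|.
Proof.
transitivity (\prod_(v : V) (a + b)); last by rewrite prodr_const.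
rewrite bigA_distr; apply: eq_bigr => S _.
rewrite (bigID (mem S)) /= -2!prodr_const; congr (_ * _); first by apply: eq_bigr => v /= ->.
by apply: eq_big => [v|v vS]; [rewrite inE | move: vS; rewrite inE => /negPf ->].
Qed.

Lemma random_subset_probT p : random_subset_prob p (predT : pred {set V}) = 1.
Proof.
by rewrite /random_subset_prob (eq_bigl xpredT) // sum_set_exp addrC subrK expr1n.
Qed.

Lemma random_subset_probC p (E : pred {set V}) :
  random_subset_prob p E = 1 - random_subset_prob p (predC E).
Proof.
apply/eqP; rewrite eq_sym subr_eq -(random_subset_probT p) /random_subset_prob.
by rewrite (bigID E) /=; apply/eqP; congr (_ + _); apply: eq_bigl.
Qed.

Lemma random_subset_prob_ge0 p (E : pred {set V}) : 0 <= p <= 1 -> 0 <= random_subset_prob p E.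
Proof.
move=> /andP [p0 p1]; apply: sumr_ge0 => S _.
by rewrite mulr_ge0 ?exprn_ge0 // subr_ge0.
Qed.

Lemma random_subset_union p (E : pred {set V}) (I : Type) (r : seq I) (P : pred I)
    (F : I -> pred {set V}) : 0 <= p <= 1 ->
    (forall S, E S -> has (fun i => P i && F i S) r) ->
  random_subset_prob p E <= \sum_(i <- r | P i) random_subset_prob p (F i).
Proof.
move=> /andP [p0 p1] cov; rewrite /random_subset_prob.
have w_ge0 S : 0 <= p ^+ #|S| * (1 - p) ^+ #|~: S| by rewrite mulr_ge0 ?exprn_ge0 // subr_ge0.
rewrite (eq_bigr (fun i => \sum_(S : {set V}) if F i S then p ^+ #|S| * (1 - p) ^+ #|~: S| else 0)); last first.
  by move=> i _; rewrite big_mkcond.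
rewrite exchange_big /= big_mkcond; apply: ler_sum => S _.
case: ifP => [/cov|_]; last by apply: sumr_ge0 => i _; case: ifP.
elim: r {cov} => //= i r IHr /orP [/andP [Pi Fi]|/IHr h]; rewrite big_cons.
  rewrite Pi Fi lerDl; apply: sumr_ge0 => j _; by case: ifP.
case: ifP => // _; apply: le_trans h _; rewrite lerDr; by case: ifP.
Qed.

(** An inequality, to include the case that [U] meets [D], where the event is empty. *)
Lemma random_subset_prob_sandwich p U D : 0 <= p <= 1 ->
  random_subset_prob p [pred S : {set V} | (U \subset S) && [disjoint S & D]]
    <= p ^+ #|U| * (1 - p) ^+ #|D|.
Proof.
move=> /andP [p0 p1]; have q0 : 0 <= 1 - p by rewrite subr_ge0.
pose F v := if v \in D then 0 else p; pose F' v := if v \in U then 0 else 1 - p.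
apply: (@le_trans _ _ (\prod_(v : V) (F v + F' v))).
  rewrite bigA_distr /random_subset_prob big_mkcond; apply: ler_sum => S _ /=.
  have prod_ge0 : 0 <= \prod_v (if v \in S then F v else F' v).
    by apply: prodr_ge0 => v _; rewrite /F /F'; do 2?case: ifP.
  case: ifP => // /andP [US SD]; rewrite -2!prodr_const [X in _ <= X](bigID (mem S)) /=.
  rewrite le_eqVlt; apply/orP; left; apply/eqP; congr (_ * _).
    apply: eq_bigr => v vS; rewrite vS /F; case: ifP => // vD.
    by move/pred0P: SD => /(_ v); rewrite /= vS vD.
  apply: eq_big => [v|v]; first by rewrite inE.
  rewrite inE => vS; rewrite (negPf vS) /F'; case: ifP => // vU.
  by move: vS; rewrite (fintype.subsetP US).
rewrite -2!prodr_const [X in _ <= X * _]big_mkcond [X in _ <= _ * X]big_mkcond -big_split /=.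
apply: ler_prod => v _; rewrite /F /F'; have pq : p + (1 - p) = 1 by rewrite addrC subrK.
move: (1 - p) q0 pq => q q0 pq; case: (v \in D); case: (v \in U); apply/andP; split;
  by rewrite ?pq ?addr0 ?add0r ?mulr1 ?mul1r ?mulr_ge0.
Qed.

Lemma random_subset_prob_sub p U : 0 <= p <= 1 ->
  random_subset_prob p [pred S : {set V} | U \subset S] <= p ^+ #|U|.
Proof.
move=> p01; rewrite -[X in _ <= X]mulr1 -(expr0 (1 - p)) -(cards0 V).
apply: le_trans (random_subset_prob_sandwich U finset.set0 p01).
rewrite /random_subset_prob le_eqVlt; apply/orP; left; apply/eqP; apply: eq_bigl => S /=.
by rewrite -finset.setI_eq0 finset.setI0 eqxx andbT.
Qed.

(* Union bound over the union [U] of all fingerprints, of size at most [B],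
   with the Chernoff weight [x]; each [U] carries at most [2 ^ (r m #|U|)]
   fingerprints. *)
Lemma random_subset_fingerprints p (r m B : nat) (x y : R) (E : pred {set V})
    (D : {ffun 'I_r -> {ffun 'I_m -> {set V}}} -> {set V}) :
  0 <= p <= 1 -> 0 < x <= 1 -> 0 <= y ->
  (forall S, E S -> exists t : {ffun 'I_r -> {ffun 'I_m -> {set V}}},
    [/\ forall c i, t c i \subset S, (\sum_c \sum_i #|t c i| <= B)%N,
        [disjoint S & D t] & y <= #|D t|%:R]) ->
  random_subset_prob p E <=
    x ^- B * expR (x * 2 ^+ (m * r) * p * #|V|%:R) * expR (- (p * y)).
Proof.
move=> p01 /andP [x_gt0 x_le1] y0 Efp; have /andP [p0 p1] := p01.
pose I := ({set V} * {ffun 'I_r -> {ffun 'I_m -> {set V}}})%type.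
pose P (Ut : I) := (#|Ut.1| <= B)%N && ((y <= #|D Ut.2|%:R) && [forall c, forall i, Ut.2 c i \subset Ut.1]).
pose F (Ut : I) := [pred S : {set V} | (Ut.1 \subset S) && [disjoint S & D Ut.2]].
apply: le_trans (@random_subset_union p E I (index_enum I) P F p01 _) _.
  move=> S /Efp [t [tS tB SD yD]]; apply/hasP.
  exists (\bigcup_c \bigcup_i t c i, t); first exact: mem_index_enum.
  rewrite /P /F /= SD yD andbT /=; apply/andP; split; last first.
    by apply/finset.bigcupsP => c _; apply/finset.bigcupsP => i _.
  apply/andP; split.
    apply: leq_trans tB; apply: leq_trans (card_bigcup_le _) _.
    by apply: leq_sum => c _; exact: card_bigcup_le.
  apply/forallP => c; apply/forallP => i; apply: fintype.subset_trans (finset.bigcup_sup c _);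
    last by [].
  exact: finset.bigcup_sup.
pose Q (U : {set V}) (t : {ffun 'I_r -> {ffun 'I_m -> {set V}}}) := (y <= #|D t|%:R) && [forall c, forall i, t c i \subset U].
apply: (@le_trans _ _ (\sum_(U : {set V} | (#|U| <= B)%N) \sum_(t | Q U t) p ^+ #|U| * expR (- (p * y)))).
  rewrite [X in _ <= X]pair_big_dep /= [X in _ <= X](eq_bigl P) //;
    apply: ler_sum => -[U t] /= /andP [_ /andP [yD _]].
  apply: le_trans (random_subset_prob_sandwich U (D t) p01) _.
  rewrite ler_wpM2l ?exprn_ge0 //.
  apply: (@le_trans _ _ (expR (- p) ^+ #|D t|)).
    apply: lerXn2r; rewrite ?nnegrE ?subr_ge0 ?expR_ge0 //.
    exact: expR_ge1Dx.
  by rewrite -expRM_natl ler_expR mulrN lerN2 mulrC ler_wpM2r.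
apply: (@le_trans _ _ (\sum_(U : {set V}) x ^- B * (x * 2 ^+ (m * r) * p) ^+ #|U| * expR (- (p * y)))).
  rewrite big_mkcond; apply: ler_sum => U _; case: ifP => UB; last first.
    by rewrite !mulr_ge0 ?expR_ge0 ?invr_ge0 ?exprn_ge0 ?mulr_ge0 ?(ltW x_gt0) ?exprn_ge0.
  rewrite sumr_const -[X in X <= _]mulr_natl; set C := p ^+ #|U| * _.
  have C_ge0 : 0 <= C by rewrite mulr_ge0 ?exprn_ge0 ?expR_ge0.
  have -> : x ^- B * (x * 2 ^+ (m * r) * p) ^+ #|U| * expR (- (p * y)) =
      (x ^- B * x ^+ #|U|) * ((2 ^+ (m * r)) ^+ #|U| * C) by rewrite !exprMn /C; ring.
  apply: (@le_trans _ _ ((2 ^+ (m * r)) ^+ #|U| * C)).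
    apply: ler_wpM2r => //; rewrite -exprM -natrX ler_nat.
    pose A1 : {set {ffun 'I_m -> {set V}}} := [set f in ffun_on (powerset U)].
    pose A2 : {set {ffun 'I_r -> {ffun 'I_m -> {set V}}}} := [set f in ffun_on A1].
    apply: (@leq_trans #|A2|).
      apply/subset_leq_card/fintype.subsetP => t /andP [_ /forallP tU].
      rewrite inE; apply/ffun_onP => c; rewrite inE; apply/ffun_onP => i; rewrite powersetE.
      by move/forallP: (tU c); apply.
    by rewrite cardsE card_ffun_on cardsE card_ffun_on card_powerset !card_ord -!expnM [X in (_ <= _ ^ X)%N]mulnC mulnA.
  rewrite ler_peMl ?mulr_ge0 ?exprn_ge0 //.
  by rewrite mulrC ler_pdivlMr ?exprn_gt0 // mul1r ler_wiXn2l // ltW.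
rewrite -mulr_suml -mulr_sumr ler_wpM2r ?expR_ge0 // ler_wpM2l ?invr_ge0 ?exprn_ge0 ?(ltW x_gt0) //.
set a := x * _ * p.
have -> : \sum_(U : {set V}) a ^+ #|U| = (a + 1) ^+ #|V|.
  by rewrite -sum_set_exp; apply: eq_bigr => U _; rewrite expr1n mulr1.
have a_ge0 : 0 <= a by rewrite !mulr_ge0 ?exprn_ge0 // ltW.
rewrite [a * _]mulrC expRM_natl; apply: lerXn2r; rewrite ?nnegrE ?addr_ge0 ?expR_ge0 //.
by rewrite addrC expR_ge1Dx.
Qed.

End RandomSubset.

(** * The 1-statement: containers against supersaturation *)

Section OneStatement.

Variables (R : realType) (G : finZmodType) (l k : nat) (A : 'M[int]_(l, k)) (u : R).
Hypotheses (u_gt0 : 0 < u) (g_gt1 : (1 < #|G|)%N).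
Hypothesis nsol_le : forall J : {set 'I_k}, (0 < #|J|)%N ->
  (nsol A G J)%:R * #|G|%:R <= #|sol A G|%:R * u ^+ #|J|.-1.

Let g_gt0 : 0 < (#|G|%:R : R).
Proof. by rewrite ltr0n ltnW. Qed.

Lemma card_row n : #|'rV[G]_n| = (#|G| ^ n)%N.
Proof. by rewrite card_mx mul1n. Qed.

Lemma card_sol_row n : #|sol A 'rV[G]_n| = (#|sol A G| ^ n)%N.
Proof. by rewrite -!nsol0 nsol_row. Qed.

Definition sol_density n : R := #|sol A 'rV[G]_n|%:R / #|'rV[G]_n|%:R.

Lemma sol_density_gt0 n : 0 < sol_density n.
Proof.
rewrite divr_gt0 ?ltr0n ?card_row ?expn_gt0 ?(ltnW g_gt1) //.
by apply/card_gt0P; exists 0; exact: sol0.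
Qed.

Lemma bounded_deg_sol n : bounded_deg (sol A 'rV[G]_n) [set: 'I_k] 1 (u ^+ n) (sol_density n).
Proof.
move=> W y _ W0; rewrite mul1r /sol_density card_sol_row card_row.
apply: (@le_trans _ _ ((nsol A G W)%:R ^+ n)).
  by rewrite -natrX ler_nat -nsol_row; exact: card_sol_at_le.
rewrite mulrA ler_pdivlMr ?ltr0n ?expn_gt0 ?(ltnW g_gt1) // !natrX -exprM mulnC exprM -!exprMn.
by apply: lerXn2r;
  rewrite ?nnegrE ?mulr_ge0 ?exprn_ge0 ?ler0n ?(ltW u_gt0) // [X in _ <= X]mulrC nsol_le.
Qed.

(** Two given entries agree in at most [#|'rV[G]_n|] times [nsol] of the pair many solutions, and
    [nsol_le] for pairs makes this a proportion [u ^+ n]. *)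
Lemma card_sol_not_inj n :
  #|[set x in sol A 'rV[G]_n | ~~ injectiveb x]|%:R <= (k ^ 2)%:R * u ^+ n * #|sol A 'rV[G]_n|%:R.
Proof.
have pair_le (i j : 'I_k) : i != j ->
    #|[set x in sol A 'rV[G]_n | x i == x j]|%:R <= u ^+ n * #|sol A 'rV[G]_n|%:R.
  move=> ij; have c2 : #|[set i; j]| = 2%N by rewrite cards2 ij.
  apply: (@le_trans _ _ (#|'rV[G]_n| * nsol A 'rV[G]_n [set i; j])%:R).
    rewrite ler_nat -sum_nat_const -sum1_card (partition_big (fun x : {ffun 'I_k -> 'rV[G]_n} => x i) predT) //=.
    apply: leq_sum => v _; rewrite sum1_card; apply: leq_trans (card_sol_at_le A [set i;
      j] [ffun=> v]).
    apply/subset_leq_card/fintype.subsetP => x /andP []; rewrite inE => /andP [xs /eqP xij] /eqP xi.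
    by apply/sol_atP; split => // h; rewrite !inE ffunE => /orP [] /eqP -> //; rewrite -xij.
  rewrite nsol_row card_row -expnMn card_sol_row !natrX -exprMn.
  apply: lerXn2r; rewrite ?nnegrE ?mulr_ge0 ?ler0n ?(ltW u_gt0) // natrM mulrC [X in _ <= X]mulrC.
  by have := nsol_le (J := [set i; j]); rewrite c2 expr1; apply.
apply: (@le_trans _ _ (\sum_(ij : 'I_k * 'I_k | ij.1 != ij.2)
   #|[set x in sol A 'rV[G]_n | x ij.1 == x ij.2]|%:R)).
  rewrite -natr_sum ler_nat -sum1_card.
  apply: (@leq_trans (\sum_(x in [set x in sol A 'rV[G]_n | ~~ injectiveb x])
    \sum_(ij : 'I_k * 'I_k | (ij.1 != ij.2) && (x \in [set x in sol A 'rV[G]_n | x ij.1 == x ij.2])) 1)%N).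
    apply: leq_sum => x; rewrite inE => /andP [xs /injectivePn [i [j ij xij]]].
    by rewrite (bigD1 (i, j)) //= ij inE xs xij eqxx.
  rewrite (exchange_big_dep (fun ij : 'I_k * 'I_k => ij.1 != ij.2)) /=;
    last by move=> x ij _ /andP [].
  apply: leq_sum => ij _; rewrite sum1_card; apply/subset_leq_card/fintype.subsetP => x.
  by case/and3P.
apply: (@le_trans _ _ (\sum_(ij : 'I_k * 'I_k | ij.1 != ij.2) u ^+ n * #|sol A 'rV[G]_n|%:R)).
  by apply: ler_sum => ij; apply: pair_le.
rewrite sumr_const -[X in X <= _]mulr_natl -mulrA ler_wpM2r ?mulr_ge0 ?exprn_ge0 ?(ltW u_gt0) //.
by rewrite ler_nat; apply: leq_trans (max_card _) _; rewrite card_prod card_ord.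
Qed.

Lemma codom_nth (T : Type) (x0 : T) M (t : seq T) : size t = M ->
  codom [ffun i : 'I_M => nth x0 t i] = t.
Proof.
move=> st; apply: (@eq_from_nth _ x0); first by rewrite size_codom card_ord.
rewrite size_codom card_ord => i ltM.
rewrite (nth_map (Ordinal ltM)) -?cardE ?card_ord // ffunE; congr nth.
by rewrite nth_enum_ord.
Qed.

Definition leftover (V : finType) r M (f : seq {set V} -> {set V})
    (t : {ffun 'I_r -> {ffun 'I_M -> {set V}}}) : {set V} := ~: \bigcup_c f (codom (t c)).

(* Colour a vertex by a container it lies in and the leftover by a new colour;
   few monochromatic solutions are inside containers or not injective. *)
Lemma not_rado_fingerprint (r M b K0 n : nat) (eps : R) (f : seq {set 'rV[G]_n} -> {set 'rV[G]_n})
    (S : {set 'rV[G]_n}) :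
  (0 < k)%N -> (0 < K0)%N ->
  (forall chi : 'rV[G]_n -> option 'I_r, (#|sol A 'rV[G]_n| <= K0 * #|mono_sol A chi|)%N) ->
  (forall I : {set 'rV[G]_n}, (forall x, x \in [set x in sol A 'rV[G]_n | injectiveb x] -> exists i, x i \notin I) ->
    exists t, [/\ size t = M, fingerprint I b t, I \subset f t &
      #|[set x in [set x in sol A 'rV[G]_n | injectiveb x] | [forall i, x i \in f t]]|%:R
        < eps * sol_density n * #|'rV[G]_n|%:R]) ->
  (k ^ 2)%:R * u ^+ n <= (4 * K0%:R)^-1 -> r%:R * eps <= (4 * K0%:R)^-1 ->
  ~~ rado A r S -> exists t : {ffun 'I_r -> {ffun 'I_M -> {set 'rV[G]_n}}},
    [/\ forall c i, t c i \subset S, (\sum_c \sum_i #|t c i| <= r * (M * b))%N,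
        [disjoint S & leftover f t] & (2 * K0%:R)^-1 * #|'rV[G]_n|%:R <= #|leftover f t|%:R :> R].
Proof.
move=> k_gt0 K0_gt0 many cont few_ni few_eps /forallPn [chi no_mono].
pose H := [set x in sol A 'rV[G]_n | injectiveb x].
have N_gt0 : 0 < (#|'rV[G]_n|%:R : R) by rewrite ltr0n card_row expn_gt0 ltnW.
have K0_gt0' : 0 < (K0%:R : R) by rewrite ltr0n.
pose I c := [set v in S | chi v == c].
have /fin_all_exists [t Ht] : forall c, exists t : seq {set 'rV[G]_n},
    [/\ size t = M, fingerprint (I c) b t, I c \subset f t &
      #|[set x in H | [forall i, x i \in f t]]|%:R < eps * sol_density n * #|'rV[G]_n|%:R].
  move=> c; apply: cont => x; rewrite inE => /andP [xs xinj].
  apply/existsP; apply: contraNT no_mono => /existsPn xI; apply/existsP; exists x.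
  have xI' i : (x i \in S) && (chi (x i) == c) by have := xI i; rewrite negbK inE.
  move: xs; rewrite inE => ->; rewrite xinj !andbT; apply/andP; split.
    by apply/forallP => i; have /andP [] := xI' i.
  by apply/existsP; exists c; apply/forallP => i; have /andP [] := xI' i.
pose tt : {ffun 'I_r -> {ffun 'I_M -> {set 'rV[G]_n}}} :=
  [ffun c => [ffun i : 'I_M => nth finset.set0 (t c) i]].
have ttE c : codom (tt c) = t c by rewrite ffunE codom_nth //; have [] := Ht c.
have tt_in c i : tt c i \in t c.
  by rewrite !ffunE mem_nth //; have [-> _ _ _] := Ht c.
have ttI c i : (tt c i \subset I c) && (#|tt c i| <= b)%N.
  by have [_ /allP/(_ _ (tt_in c i)) ? _ _] := Ht c.
exists tt; split.
- move=> c i; have /andP [+ _] := ttI c i => /fintype.subset_trans; apply.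
  by apply/fintype.subsetP => v; rewrite inE => /andP [].
- apply: (@leq_trans (\sum_(c < r) \sum_(i < M) b)%N); last by rewrite !sum_nat_const !card_ord.
  by apply: leq_sum => c _; apply: leq_sum => i _; have /andP [] := ttI c i.
- rewrite disjoint_subset; apply/fintype.subsetP => v vS; rewrite !inE negbK.
  apply/finset.bigcupP; exists (chi v) => //; rewrite ttE;
    have [_ _ /fintype.subsetP sI _] := Ht (chi v).
  by apply: sI; rewrite inE vS eqxx.
pose j0 := Ordinal k_gt0.
pose chi' v : option 'I_r := [pick c | v \in f (t c)].
have := many chi'; rewrite -(ler_nat R) natrM => manyR.
have cover : (#|mono_sol A chi'| <= #|[set x in sol A 'rV[G]_n | ~~ injectiveb x]|
    + \sum_c #|[set x in H | [forall i, x i \in f (t c)]]|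
    + #|[set x in sol A 'rV[G]_n | x j0 \in leftover f tt]|)%N.
  apply: leq_trans (leq_add (leq_add (leqnn _) (card_bigcup_le _)) (leqnn _)).
  apply: leq_trans (leq_add (leq_card_setU _ _) (leqnn _)).
  apply: leq_trans (leq_card_setU _ _); apply/subset_leq_card/fintype.subsetP => x.
  move=> /finset.setIdP [xs /existsP [[c|] /forallP xc]]; apply/finset.setUP.
    left; apply/finset.setUP; case: (boolP (injectiveb x)) => xinj; last by left;
      apply/finset.setIdP.
    right; apply/finset.bigcupP; exists c => //; apply/finset.setIdP; split;
      first exact/finset.setIdP.
    by apply/forallP => i; have /eqP := xc i; rewrite /chi'; case: pickP => // c' xc' [<-].
  right; apply/finset.setIdP; split => //; rewrite /leftover inE.
  apply/finset.bigcupP => -[c _]; rewrite ttE => xc'.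
  by have /eqP := xc j0; rewrite /chi'; case: pickP => // /(_ c); rewrite xc'.
have left_le := card_by_coord (leftover f tt) (@bounded_deg_sol n) (finset.in_setT j0).
have ni_le := card_sol_not_inj n.
have e_gt0 := sol_density_gt0 n.
have eN : sol_density n * #|'rV[G]_n|%:R = #|sol A 'rV[G]_n|%:R by rewrite divfK ?gt_eqF.
have s_gt0 : 0 < (#|sol A 'rV[G]_n|%:R : R) by rewrite -eN mulr_gt0.
have sum_le : \sum_c (#|[set x in H | [forall i, x i \in f (t c)]]|%:R : R) <= r%:R * eps * #|sol A 'rV[G]_n|%:R.
  apply: (@le_trans _ _ (\sum_(c < r) eps * #|sol A 'rV[G]_n|%:R)).
    by apply: ler_sum => c _; have [_ _ _ /ltW] := Ht c; rewrite -mulrA eN.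
  by rewrite sumr_const card_ord -[X in X <= _]mulr_natl mulrA.
(* Of the proportion [4 * z] of monochromatic solutions, the non-injective ones and those inside
   containers take at most [z] each. The remaining [2 * z] have entry [j0] in the leftover, which
   the degree bound forces to be large. *)
pose z : R := (4 * K0%:R)^-1.
have z2 : (2 * K0%:R)^-1 = 2 * z by rewrite /z; field; rewrite gt_eqF.
have mono_ge : 4 * z * #|sol A 'rV[G]_n|%:R <= #|mono_sol A chi'|%:R.
  rewrite -(ler_pM2l K0_gt0'); apply: le_trans manyR.
  by rewrite le_eqVlt; apply/orP; left; apply/eqP; rewrite /z; field; rewrite gt_eqF.
move: cover; rewrite -(ler_nat R) !natrD natr_sum => cover.
have ni_le' : #|[set x in sol A 'rV[G]_n | ~~ injectiveb x]|%:R <= z * #|sol A 'rV[G]_n|%:R.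
  by apply: le_trans ni_le _; rewrite ler_pM2r.
have sum_le' : r%:R * eps * #|sol A 'rV[G]_n|%:R <= z * #|sol A 'rV[G]_n|%:R by rewrite ler_pM2r.
rewrite z2 -(ler_pM2r e_gt0) -mulrA [_ * sol_density n in X in X <= _]mulrC eN.
by move: left_le; rewrite mul1r => left_le; lra.
Qed.

Lemma expR_lim0 (w : nat -> R) (c x : R) : 0 < c -> 1 < x ->
  (\forall n \near \oo, 0 <= w n <= expR (- (c * x ^+ n)))%classic ->
  (w n @[n --> \oo] --> (0 : R))%classic.
Proof.
move=> c_gt0 x_gt1 Hw; have x_gt0 : 0 < x by apply: lt_trans x_gt1.
apply: (@squeeze_cvgr _ _ _ _ (fun=> 0) (fun n => c^-1 * x^-1 ^+ n)).
- near=> n; have /andP [-> Hn] : 0 <= w n <= expR (- (c * x ^+ n)) by near: n.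
  apply: le_trans Hn _;
    rewrite expRN exprVn -invfM lef_pV2 ?posrE ?expR_gt0 ?mulr_gt0 ?exprn_gt0 //.
  by apply: le_trans (expR_ge1Dx _); rewrite lerDr.
- exact: cvg_cst.
- rewrite -[X in (_ --> X)%classic](mulr0 c^-1); apply: cvgM; first exact: cvg_cst.
  by apply: cvg_expr; rewrite ger0_norm ?invr_ge0 ?ltW // invf_lt1.
Unshelve. all: by end_near. Qed.

Hypotheses (u_lt1 : u < 1) (ug_gt1 : 1 < u * #|G|%:R).

Theorem one_statement (s r : nat) : (0 < k)%N -> (0 < r)%N -> (1 < s)%N -> (forall g : G, g *+ s = 0) ->
    s_columns_condition s A ->
  exists2 C : R, 0 < C & forall p : nat -> R, (forall n, 0 <= p n <= 1) ->
    (\forall n \near \oo, C * u ^+ n <= p n)%classic ->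
    (random_subset_prob (p n) (@rado 'rV[G]_n l k A r) @[n --> \oo] --> (1 : R))%classic.
Proof.
move=> k_gt0 r_gt0 s_gt1 Gs hcol.
have [K0 K0_gt0 many] := card_mono_sol (option 'I_r) s_gt1 Gs hcol.
have K0_gt0' : 0 < (K0%:R : R) by rewrite ltr0n.
have r_gt0' : 0 < (r%:R : R) by rewrite ltr0n.
pose eps : R := (4 * r%:R * K0%:R)^-1.
have eps_gt0 : 0 < eps by rewrite invr_gt0 !mulr_gt0.
have [M [d d_gt0 Hcont]] := @containers R k eps k_gt0 eps_gt0.
pose dl : R := (2 * K0%:R)^-1.
have dl_gt0 : 0 < dl by rewrite invr_gt0 mulr_gt0.
(* Makes the exponent from summing over all [U] equal to [dl / 4 * p n * N], a quarter of the gain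
   from avoiding the leftover. *)
pose x : R := dl / (4 * 2 ^+ (M * r)).
have x_gt0 : 0 < x by rewrite divr_gt0 ?mulr_gt0 ?exprn_gt0.
have x_le1 : x <= 1.
  rewrite ler_pdivrMr ?mulr_gt0 ?exprn_gt0 // mul1r; apply: (@le_trans _ _ 1).
    by rewrite invf_le1 ?mulr_gt0 // mulr_ege1 ?ler1n.
  by rewrite mulr_ege1 ?exprn_ege1 ?ler1n.
(* Makes the price [(r * (M * b))%:R * - ln x] of the Chernoff weight at most another quarter, given
   [b <= 2 * u ^+ n * N]; half of the gain survives. *)
pose C : R := 8 * (r * M)%:R * - ln x / dl + 1.
have lnx_ge0 : 0 <= - ln x by rewrite oppr_ge0 ln_le0.
have C_gt0 : 0 < C by rewrite ltr_wpDl // divr_ge0 ?mulr_ge0 ?(ltW dl_gt0).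
exists C => // p p01 pC.
suff lim0 : (random_subset_prob (p n) (predC (@rado 'rV[G]_n l k A r)) @[n --> \oo] --> (0 : R))%classic.
  rewrite -[X in (_ --> X)%classic](subr0 1).
  rewrite (_ : (fun n => _) = (fun n => 1 - random_subset_prob (p n) (predC (@rado 'rV[G]_n l k A r)))); last first.
    by apply/funext => n; exact: random_subset_probC.
  by apply: cvgB => //; exact: cvg_cst.
apply: (@expR_lim0 _ (dl / 2 * C) (u * #|G|%:R)) => //; first by rewrite mulr_gt0 ?divr_gt0.
have u_cvg : (u ^+ n @[n --> \oo] --> (0 : R))%classic by apply: cvg_expr; rewrite ger0_norm // ltW.
have small1 : (\forall n \near \oo, u ^+ n < d / 2)%classic.
  by apply: (cvgr_lt _ u_cvg); rewrite divr_gt0.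
have small2 : (\forall n \near \oo, u ^+ n < ((k ^ 2)%:R * (4 * K0%:R))^-1)%classic.
  by apply: (cvgr_lt _ u_cvg); rewrite invr_gt0 !mulr_gt0 // ltr0n expn_gt0 k_gt0.
near=> n.
rewrite random_subset_prob_ge0 //=.
have un1 : u ^+ n < d / 2 by near: n.
have un2 : u ^+ n < ((k ^ 2)%:R * (4 * K0%:R))^-1 by near: n.
have pn : C * u ^+ n <= p n by near: n.
have un_gt0 : 0 < u ^+ n by rewrite exprn_gt0.
pose N : R := #|'rV[G]_n|%:R.
have NE : N = #|G|%:R ^+ n by rewrite /N card_row natrX.
have N_gt0 : 0 < N by rewrite NE exprn_gt0.
have uN_ge1 : 1 <= u ^+ n * N by rewrite NE -exprMn exprn_ege1 // ltW.
pose b := (Num.truncn (u ^+ n * N)).+1.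
have b_ge : u ^+ n * N <= b%:R by apply/ltW; rewrite truncnS_gt.
have b_le : b%:R <= 2 * (u ^+ n * N).
  rewrite /b -natr1 mulr_natl mulr2n lerD // truncn_le //; exact: le_trans uN_ge1.
have b_le' : b%:R <= d * N.
  apply: le_trans b_le _; rewrite mulrA ler_pM2r // -ler_pdivlMl // mulrC; exact: ltW.
have kk_gt0 : 0 < ((k ^ 2)%:R : R) by rewrite ltr0n expn_gt0 k_gt0.
have few_ni : (k ^ 2)%:R * u ^+ n <= (4 * K0%:R)^-1.
  rewrite -ler_pdivlMl //; apply: le_trans (ltW un2) _.
  by rewrite invfM.
have few_eps : r%:R * eps <= (4 * K0%:R)^-1.
  by rewrite le_eqVlt; apply/orP; left; apply/eqP; rewrite /eps; field; rewrite !gt_eqF.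
have V_gt0 : (0 < #|'rV[G]_n|)%N by rewrite card_row expn_gt0 ltnW.
have bH : bounded_deg [set x in sol A 'rV[G]_n | injectiveb x] [set: 'I_k] 1 (u ^+ n) (sol_density n).
  apply: bounded_deg_subset (@bounded_deg_sol n).
  by apply/fintype.subsetP => y; rewrite inE => /andP [].
have [f Hf] := Hcont 'rV[G]_n (u ^+ n) (sol_density n) b [set x in sol A 'rV[G]_n | injectiveb x] un_gt0 (sol_density_gt0 n) V_gt0 b_ge b_le' bH.
have fp S := @not_rado_fingerprint r M b K0 n eps f S k_gt0 K0_gt0 (many n) Hf few_ni few_eps.
have x01 : 0 < x <= 1 by rewrite x_gt0.
have dlN : 0 <= dl * N by rewrite mulr_ge0 // ltW.
apply: le_trans (random_subset_fingerprints (p01 n) x01 dlN fp) _.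
rewrite -/N -[x in x ^- _]lnK ?posrE // -expRM_natl -expRN -!expRD ler_expR.
have pN_ge : C * (u * #|G|%:R) ^+ n <= p n * N by rewrite exprMn -NE mulrA ler_pM2r.
have x4 : x * 2 ^+ (M * r) = dl / 4 by rewrite /x; field; rewrite gt_eqF ?exprn_gt0.
have B_le : (r * (M * b))%:R * - ln x <= dl / 4 * (p n * N).
  apply: (@le_trans _ _ ((r * M)%:R * - ln x * (2 * (u ^+ n * N)))).
    by rewrite mulnA natrM mulrAC ler_wpM2l // mulr_ge0.
  have -> : (r * M)%:R * - ln x * (2 * (u ^+ n * N)) = dl / 4 * ((C - 1) * u ^+ n * N).
    by rewrite /C; field; rewrite gt_eqF.
  rewrite ler_pM2l ?divr_gt0 // ler_pM2r //; apply: le_trans pn.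
  by rewrite ler_pM2r // gerBl.
rewrite x4 -mulrN; set Y := C * _ in pN_ge; rewrite -[dl / 2 * C * _]mulrA -/Y.
have dl2 : 0 < dl / 2 by rewrite divr_gt0.
have := ler_wpM2l (ltW dl2) pN_ge.
have -> : dl / 4 * p n * N = dl / 4 * (p n * N) by rewrite mulrA.
have -> : p n * (dl * N) = 4 * (dl / 4 * (p n * N)) by field.
have -> : dl / 2 * (p n * N) = 2 * (dl / 4 * (p n * N)) by field.
by move: B_le; lra.
Unshelve. all: by end_near. Qed.

End OneStatement.

(* How the next edge attaches to the union of the previous ones: [Path] means in
   a single vertex, which lies on the last edge; [Meet j] means in [j] vertices. *)
Inductive attach := Path | Meet of nat.

Definition attach_code k := if k is Meet j then Some j else None.

Lemma attach_codeK : cancel attach_code (fun o => if o is Some j then Meet j else Path).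
Proof. by case. Qed.

HB.instance Definition _ := Equality.copy attach (can_type attach_codeK).

(** * Edge sequences and edge-critical hypergraphs *)

Section EdgeSequences.

Variable V : finType.
Implicit Types (e h g S B : {set V}) (H E : {set {set V}}) (s : seq {set V}).

Definition cov s : {set V} := \bigcup_(e <- s) e.

Definition attaches (k : attach) s e :=
  match k with
  | Path => (#|e :&: cov s| == 1%N) && (e :&: head finset.set0 s != finset.set0)
  | Meet j => #|e :&: cov s| == j
  end.

(* The head of a sequence of edges, and of its word, is the last edge. *)
Fixpoint edge_seqs E (tau : seq attach) : seq (seq {set V}) :=
  if tau is k :: tau' then
    [seq e :: s | s <- edge_seqs E tau', e <- [seq e <- enum E | attaches k s e]]
  else [seq [:: e] | e <- enum E].

Lemma cov_cons e s : cov (e :: s) = e :|: cov s.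
Proof. exact: big_cons. Qed.

Lemma cov_nil : cov [::] = finset.set0.
Proof. exact: big_nil. Qed.

Lemma cov1 e : cov [:: e] = e.
Proof. by rewrite cov_cons cov_nil finset.setU0. Qed.

Lemma edge_seqs_nil E e : ([:: e] \in edge_seqs E [::]) = (e \in E).
Proof. by rewrite mem_map ?mem_enum // => x y []. Qed.

Lemma edge_seqs_cons E k tau e s :
  (e :: s \in edge_seqs E (k :: tau)) = [&& s \in edge_seqs E tau, e \in E & attaches k s e].
Proof.
apply/allpairsPdep/and3P => [[s' [e' [ss' + [-> ->]]]]|[ss eE es]].
  by rewrite mem_filter mem_enum => /andP [].
by exists s, e; rewrite mem_filter mem_enum eE es.
Qed.

Lemma edge_seqsP E tau s : s \in edge_seqs E tau ->
  exists e s', [/\ s = e :: s', e \in E & if tau is k :: tau' then s' \in edge_seqs E tau' /\ attaches k s' e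
    else s' = [::]].
Proof.
case: tau => [/mapP [e eE ->]|k tau /allpairsPdep [s' [e [ss' + ->]]]].
  by exists e, [::]; rewrite -mem_enum.
by rewrite mem_filter mem_enum => /andP [es eE]; exists e, s'.
Qed.

Lemma edge_seqs_sub E H tau s : H \subset E -> s \in edge_seqs H tau ->
  s \in edge_seqs E tau /\ {subset s <= H}.
Proof.
move=> HE; elim: tau s => [|k tau IH] s.
  by move=> /mapP [e]; rewrite mem_enum => eH ->; rewrite edge_seqs_nil (fintype.subsetP HE) //;
    split => // x; rewrite inE => /eqP ->.
move=> /edge_seqsP [e [s' [-> eH [/IH [ss' s'H] es']]]];
  rewrite edge_seqs_cons ss' es' (fintype.subsetP HE) //.
by split => // x; rewrite inE => /orP [/eqP ->|/s'H].
Qed.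

Definition proper_colouring B H := [forall e in H, ~~ (e \subset B) && ~~ [disjoint e & B]].

Definition two_colourable H := [exists B, proper_colouring B H].

Lemma proper_colouringP B H :
  reflect (forall e, e \in H -> ~~ (e \subset B) /\ ~~ [disjoint e & B]) (proper_colouring B H).
Proof.
apply: (iffP forall_inP) => h e /h; first by move=> /andP.
by case=> *; apply/andP.
Qed.

Lemma proper_colouringC B H : proper_colouring B H -> proper_colouring (~: B) H.
Proof.
move=> /proper_colouringP h; apply/proper_colouringP => e /h [h1 h2].
by rewrite -finset.disjoints_subset [X in _ /\ ~~ X]finset.disjoints_subset finset.setCK.
Qed.

Definition critical H := ~~ two_colourable H /\ forall e, e \in H -> two_colourable (H :\ e).

Lemma exists_critical H : ~~ two_colourable H -> exists2 H' : {set {set V}}, H' \subset H & critical H'.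
Proof.
move=> nH; pose P (H' : {set {set V}}) := (H' \subset H) && ~~ two_colourable H'.
have PH : P H by rewrite /P nH subxx.
have [H' /andP [H'H nH'] H'min] := @arg_minnP _ H P (fun H => #|H|) PH.
exists H' => //; split => // e eH'; case: (boolP (two_colourable (H' :\ e))) => // ne.
have := H'min (H' :\ e); rewrite /P ne (fintype.subset_trans (finset.subsetDl _ _) H'H) => /(_ isT).
by rewrite (cardsD1 e H') eH' ltnn.
Qed.

(** A proper colouring of [H] without [e] leaves [e] monochromatic, say inside [B]. Moving [v] out
    of [B] must spoil some other edge, and that edge can only have met [B] in [v] alone. *)
Lemma critical_stable H e v : critical H -> (1 < #|e|)%N -> e \in H -> v \in e ->
  exists2 h, h \in H & h :&: e = [set v].
Proof.
move=> [nH crit] e2 eH ve.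
suff [B BH eB] : exists2 B, proper_colouring B (H :\ e) & e \subset B.
  have : ~~ proper_colouring (B :\ v) H by apply: contra nH => ?; apply/existsP; exists (B :\ v).
  move=> /forall_inPn [f fH]; rewrite negb_and !negbK => f_mono.
  have fe : f != e.
    apply: contraTneq f_mono => ->; rewrite negb_or; apply/andP; split.
      by apply/negP => /fintype.subsetP/(_ v ve); rewrite !inE eqxx.
    have [x [xe xv]] : exists x, x \in e /\ x != v.
      have /card_gt0P [x] : (0 < #|e :\ v|)%N by have := cardsD1 v e; rewrite ve; lia.
      by rewrite !inE => /andP [? ?]; exists x.
    by apply/pred0Pn; exists x; rewrite /= xe !inE xv (fintype.subsetP eB).
  have [fB1 fB2] : ~~ (f \subset B) /\ ~~ [disjoint f & B].
    by move/proper_colouringP: BH; apply; rewrite !inE fe.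
  case/orP: f_mono => [fBv|fBv].
    by move: fB1; rewrite (fintype.subset_trans fBv) // finset.subsetDl.
  have f_e x : x \in f -> x \in B -> x = v.
    by move=> xf xB; apply: contraTeq fBv => xv; apply/pred0Pn; exists x; rewrite /= xf !inE xv xB.
  have vf : v \in f by case/pred0Pn: fB2 => x /andP [xf xB]; rewrite -(f_e x xf xB).
  exists f => //; apply/setP => x; rewrite !inE; apply/andP/eqP => [[xf xe]|-> //].
  by apply: f_e => //; apply: (fintype.subsetP eB).
have /existsP [B BH] := crit e eH.
have : ~~ proper_colouring B H by apply: contra nH => ?; apply/existsP; exists B.
move=> /forall_inPn [f fH]; rewrite negb_and !negbK => f_mono.
have fe : f = e.
  apply/eqP; apply: contraTT f_mono => fe; rewrite negb_or.
  by move/proper_colouringP: BH => /(_ f); rewrite !inE fe fH => /(_ isT) [-> ->].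
case/orP: f_mono => eB; first by exists B; rewrite // -fe.
exists (~: B); first exact: proper_colouringC.
by rewrite -fe -finset.disjoints_subset.
Qed.

End EdgeSequences.

(** * Criticality forces a doubly closed sequence or a long path *)

Section CriticalHypergraph.

Variables (V : finType) (H : {set {set V}}) (w L : nat).
Hypotheses (w_ge3 : (2 < w)%N) (H_unif : forall e, e \in H -> #|e| = w) (H_crit : critical H).

Definition letters s := all (fun j => (0 < j < w)%N) s.

(* Two attachments in at least two vertices, one of them in exactly two: the
   expected number of such sequences tends to 0. *)
Definition doubly_closed (s : seq nat) := (2%N \in s) && (1 < count (leq 2) s)%N.

(** Read from the right: the starting configuration [s0], a path of [t] edges, then the closing
    letters [s1]. *)
Definition word (s1 : seq nat) (t : nat) (s0 : seq nat) :=
  map Meet s1 ++ nseq t Path ++ map Meet s0.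

Hypothesis no_bad : forall s1 s0 t, (t < L)%N -> (size s1 <= 3)%N -> (size s0 <= 3)%N ->
  letters (s1 ++ s0) -> doubly_closed (s1 ++ s0) -> edge_seqs H (word s1 t s0) = [::].
Hypothesis no_long : forall s0, (size s0 <= 3)%N -> letters s0 -> edge_seqs H (word [::] L s0) = [::].

Let bad s1 s0 t (sq : seq {set V}) : (t < L)%N -> (size s1 <= 3)%N -> (size s0 <= 3)%N ->
  letters (s1 ++ s0) -> doubly_closed (s1 ++ s0) -> sq \in edge_seqs H (word s1 t s0) -> False.
Proof. by move=> ltL z1 z0 ls ds; rewrite no_bad. Qed.

Let stable (e : {set V}) v : e \in H -> v \in e -> exists2 h, h \in H & h :&: e = [set v].
Proof. by move=> eH; apply: critical_stable; rewrite ?H_unif // ltnW. Qed.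

Lemma L_gt0 : (0 < L)%N.
Proof.
rewrite lt0n; apply/eqP => L0; have := no_long (s0 := [::]) isT isT; rewrite L0 /word /=.
have [H0|[e eH]] := set_0Vmem H.
  case: H_crit => /existsPn/(_ finset.set0)/forall_inPn [e].
  by rewrite H0 inE.
by move=> none; have := edge_seqs_nil H e; rewrite eH /= none.
Qed.

Lemma maximal_path s0 s : (size s0 <= 3)%N -> letters s0 -> s \in edge_seqs H (map Meet s0) ->
  exists t s', [/\ (t < L)%N, s' \in edge_seqs H (word [::] t s0) & edge_seqs H (word [::] t.+1 s0) = [::]].
Proof.
move=> z0 l0 ss0; apply/not_existsP => none.
suff all_t t : (t <= L)%N -> edge_seqs H (word [::] t s0) <> [::].
  by apply: (all_t L (leqnn _)); exact: no_long.
elim: t => [_ e|t IHt ltL e]; first by move: ss0; rewrite -[map _ _]/(word [::] 0 s0) e.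
case E: (edge_seqs H (word [::] t s0)) => [|s' ?]; first exact: IHt (ltnW ltL) E.
apply: (none t); exists s'; split => //.
by rewrite E mem_head.
Qed.

(** The edge [h] that criticality provides at [v] would extend the path unless it met [rest].
    Attaching [h] before [e] instead makes [e] close up in exactly two vertices: [v] and its vertex
    in [rest]. *)
Lemma close_end k tau e rest v : e :: rest \in edge_seqs H (k :: tau) -> #|e :&: cov rest| = 1%N ->
  edge_seqs H (Path :: k :: tau) = [::] -> v \in e -> v \notin cov rest ->
  exists h j, [/\ h \in H, h :&: e = [set v], #|h :&: cov rest| = j, (0 < j < w)%N &
    h :: rest \in edge_seqs H (Meet j :: tau) /\
    e :: h :: rest \in edge_seqs H [:: Meet 2, Meet j & tau]].
Proof.
move=> es e1 no_ext ve vrest; have := es; rewrite edge_seqs_cons => /and3P [rs eH _].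
have [h hH he] := stable eH ve; exists h, #|h :&: cov rest|.
have vh : v \in h by move/setP: he => /(_ v); rewrite !inE eqxx => /andP [].
have j_gt0 : (0 < #|h :&: cov rest|)%N.
  rewrite lt0n cards_eq0; apply/negP => /eqP h0.
  suff : h :: e :: rest \in edge_seqs H [:: Path, k & tau] by rewrite no_ext.
  rewrite edge_seqs_cons es hH /= cov_cons finset.setIUr h0 finset.setU0 he cards1 /=.
  by apply/set0Pn; exists v; rewrite inE.
have j_ltw : (#|h :&: cov rest| < w)%N.
  rewrite -(H_unif hH); apply: proper_card; rewrite properE finset.subsetIl /=.
  by apply/fintype.subsetPn; exists v; rewrite // inE negb_and vrest orbT.
have hs : h :: rest \in edge_seqs H (Meet #|h :&: cov rest| :: tau).
  by rewrite edge_seqs_cons rs hH /=.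
split => //; first by rewrite j_gt0.
split => //; rewrite edge_seqs_cons hs eH /= cov_cons finset.setIUr finset.setIC he.
by rewrite cardsU1 inE ve (negPf vrest) e1.
Qed.

(* A path leaving an exactly closed configuration would have to close up again. *)
Lemma closed_absorbs s0 s g : (size s0 <= 2)%N -> letters s0 -> 2%N \in s0 ->
  s \in edge_seqs H (map Meet s0) -> g \in H -> g :&: cov s != finset.set0 -> g \subset cov s.
Proof.
move=> z0 l0 in2 ss gH; rewrite -card_gt0 => j_gt0.
have cnt0 : (0 < count (leq 2) s0)%N by rewrite -has_count; apply/hasP; exists 2%N.
have [j_ltw|] := ltnP #|g :&: cov s| w; last first.
  rewrite -(H_unif gH) => le_g; have /eqP <- : g :&: cov s == g by rewrite eqEcard finset.subsetIl.
  exact: finset.subsetIr.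
have gs : g :: s \in edge_seqs H (map Meet (#|g :&: cov s| :: s0)).
  by rewrite [map _ _]/= edge_seqs_cons ss gH /=.
have [j_le1|j_gt1] := leqP #|g :&: cov s| 1; last first.
  case: (@bad [:: #|g :&: cov s|] s0 0 (g :: s)) => //; rewrite ?L_gt0 //.
  - by apply: leq_trans z0 _.
  - by rewrite /letters /= j_gt0 j_ltw.
  - by rewrite /doubly_closed inE in2 orbT /= j_gt1.
have j1 : #|g :&: cov s| = 1%N by apply/eqP; rewrite eqn_leq j_le1.
rewrite j1 in gs.
have l1 : letters (1%N :: s0) by rewrite /letters /= (ltnW w_ge3).
have [t [s' [ltL ss' no_ext]]] := maximal_path (s0 := 1%N :: s0) z0 l1 gs.
(* The last edge is either [g] itself or an edge of a path issuing from it; in both cases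
   [close_end] adds a closing in exactly two vertices to the one already in [s0]. *)
have fin t' s1 tau k e rest : (t' < L)%N -> s1 \in [:: s0; 1%N :: s0] -> tau = word [::] t' s1 ->
    e :: rest \in edge_seqs H (k :: tau) -> #|e :&: cov rest| = 1%N ->
    edge_seqs H (Path :: k :: tau) = [::] -> False.
  move=> ltt' s1E tauE es e1 no_ext'.
  have eH : e \in H by move: es; rewrite edge_seqs_cons => /and3P [].
  have [v ve vr] : exists2 v, v \in e & v \notin cov rest.
    apply/fintype.subsetPn; apply: contraTN isT => /finset.setIidPl er.
    by move: e1; rewrite er (H_unif eH) => w1; move: w_ge3; rewrite w1.
  have [h [j [hH he hj /andP [j0 jw] [_ ehs]]]] := close_end es e1 no_ext' ve vr.
  rewrite tauE in ehs; apply: (@bad [:: 2; j] s1 t' _ ltt' _ _ _ _ ehs) => //.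
  - by move: s1E; rewrite !inE => /orP [] /eqP -> //; apply: leq_trans z0 _.
  - have l_s1 : letters s1 by move: s1E; rewrite !inE => /orP [] /eqP ->.
    by rewrite /letters /= j0 jw w_ge3.
  - rewrite /doubly_closed mem_head /= ltnS addn_gt0; apply/orP; right.
    by move: s1E; rewrite !inE => /orP [] /eqP -> //=; rewrite addn_gt0 cnt0 orbT.
case: t ltL ss' no_ext => [|t] ltL ss' no_ext; have [e [rest [sE eH [rs att]]]] := edge_seqsP ss';
  rewrite sE in ss'.
- by case: (@fin 0 s0 _ _ e rest ltL _ erefl ss' (eqP att) no_ext); rewrite ?mem_head.
- case/andP: att => /eqP att _.
  by case: (@fin t (1%N :: s0) _ _ e rest (ltnW ltL) _ erefl ss' att no_ext);
    rewrite ?inE ?eqxx ?orbT.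
Qed.

(** Recolour [T] by [u] and [y] against the rest: an edge in [T] contains one of them and, having at
    least three vertices, something else. Edges missing [T] keep the proper colouring that exists
    without [e0]. *)
Lemma hitting_pair_colourable (T : {set V}) (e0 : {set V}) u y : e0 \in H -> e0 \subset T ->
  (forall g, g \in H -> g :&: T != finset.set0 -> g \subset T /\ ((u \in g) || (y \in g))) ->
  u \in T -> y \in T -> False.
Proof.
move=> e0H e0T absorb uT yT; case: H_crit => /existsPn no_col crit.
have /existsP [B0 /proper_colouringP B0_ok] := crit e0 e0H.
have /negP [] := no_col ((B0 :\: T) :|: [set u; y]); apply/proper_colouringP => g gH.
have [gT|gT] := boolP (g :&: T == finset.set0); last first.
  have [gsT uy] := absorb g gH gT; split.
    apply/negP => gB; have : (#|g| <= #|[set u; y]|)%N.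
      apply/subset_leq_card/fintype.subsetP => x xg; move: (fintype.subsetP gB x xg).
      by rewrite !inE (fintype.subsetP gsT x xg).
    by rewrite (H_unif gH) cards2; case: (u != y); case: (w) w_ge3 => [|[|[|]]].
  apply/pred0Pn; case/orP: uy => ug; [exists u | exists y]; by rewrite /= ug !inE eqxx ?orbT.
have gT' x : x \in g -> x \notin T.
  by move=> xg; apply: contraTN gT => xT; apply/set0Pn; exists x; rewrite inE xg.
have ge0 : g \in H :\ e0.
  rewrite !inE gH andbT; apply/eqP => ge.
  have /card_gt0P [x xe] : (0 < #|e0|)%N by rewrite (H_unif e0H) (ltn_trans _ w_ge3).
  by have := gT' x; rewrite ge xe (fintype.subsetP e0T) // => /(_ isT).
have inB x : x \in g -> (x \in (B0 :\: T) :|: [set u; y]) = (x \in B0).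
  move=> xg; have xT := gT' x xg; rewrite !inE xT /=; case: eqP => [xu|_];
    first by rewrite xu uT in xT.
  by case: eqP => [xy|_]; [rewrite xy yT in xT | rewrite !orbF].
have [h1 h2] := B0_ok g ge0; split.
  by apply: contra h1 => /fintype.subsetP gB; apply/fintype.subsetP => x xg; rewrite -inB // gB.
case/pred0Pn: h2 => x /andP [xg xB]; have xg' : x \in g := xg; have xB' : x \in B0 := xB.
by apply/pred0Pn; exists x; rewrite /= xg' inB.
Qed.

(** The last edge [e] of a maximal path has two free vertices, each with a closing edge. Excluding
    double closings leaves only the case that edges have three vertices and [e], [h], [h'] form a
    triangle; it absorbs every edge it meets, and [u] and [y] hit all of these. *)
Theorem critical_absurd : False.
Proof.
have [e0 e0H] : exists e, e \in H.
  have [H0|[e eH]] := set_0Vmem H; last by exists e.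
  by case: H_crit => /existsPn/(_ finset.set0)/forall_inPn [e]; rewrite H0 inE.
have [t [s [ltL ss no_ext]]] := @maximal_path [::] [:: e0] isT isT (etrans (edge_seqs_nil H e0) e0H).
case: t ltL ss no_ext => [|t] ltL ss no_ext; have [e [rest [sE eH]]] := edge_seqsP ss.
  move=> restE; rewrite sE restE in ss.
  have /card_gt0P [v ve] : (0 < #|e|)%N by rewrite (H_unif eH) (ltn_trans _ w_ge3).
  have [h hH he] := stable eH ve.
  suff : [:: h; e] \in edge_seqs H [:: Path] by rewrite -[[:: Path]]/(word [::] 1 [::]) no_ext.
  rewrite edge_seqs_cons ss hH /= cov1 he cards1 /=.
  by apply/set0Pn; exists v; rewrite inE.
move=> [rs /andP [/eqP e1 _]]; rewrite sE in ss.
have [v [v' [/finset.setDP [ve vr] /finset.setDP [ve' vr'] vv']]] :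
    exists v v', [/\ v \in e :\: cov rest, v' \in e :\: cov rest & v != v'].
  apply/card_gt1P; rewrite cardsD e1 (H_unif eH); lia.
have ltL' := ltnW ltL.
have [h [j [hH he hj /andP [j0 jw] [hs ehs]]]] := close_end ss e1 no_ext ve vr.
have [h' [j' [hH' he' hj' /andP [j0' jw'] [hs' ehs']]]] := close_end ss e1 no_ext ve' vr'.
have vh : v \in h by move/setP: he => /(_ v); rewrite !inE eqxx => /andP [].
have vh' : v' \in h' by move/setP: he' => /(_ v'); rewrite !inE eqxx => /andP [].
have v'h : v' \notin h.
  by apply/negP => v'h; move/setP: he => /(_ v'); rewrite !inE v'h ve' eq_sym (negPf vv').
have small i s1 : (i < w)%N -> (0 < i)%N -> (size s1 <= 2)%N -> letters s1 -> 2%N \in s1 ->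
    forall tt sq, (tt < L)%N -> sq \in edge_seqs H (map Meet (i :: s1) ++ nseq tt Path) -> (i <= 1)%N.
  move=> iw i0 z1 l1 in2 tt sq lttt sqs; rewrite leqNgt; apply/negP => i2.
  apply: (@bad (i :: s1) [::] tt sq) => //.
  - by rewrite cats0 /letters /= i0 iw.
  - rewrite cats0 /doubly_closed inE in2 orbT /= i2 add1n ltnS -has_count.
    by apply/hasP; exists 2%N.
  - by rewrite /word /= cats0.
have j1 : j = 1%N.
  apply/eqP; rewrite eqn_leq j0 andbT leqNgt; apply/negP => j2.
  apply: (@bad [:: 2; j] [::] t _ ltL' isT isT _ _ ehs).
    by rewrite /letters /= j0 jw w_ge3.
  by rewrite /doubly_closed /= j2.
have j1' : j' = 1%N.
  apply/eqP; rewrite eqn_leq j0' andbT leqNgt; apply/negP => j2.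
  apply: (@bad [:: 2; j'] [::] t _ ltL' isT isT _ _ ehs').
    by rewrite /letters /= j0' jw' w_ge3.
  by rewrite /doubly_closed /= j2.
have w1 : letters [:: 2; 1] by rewrite /letters /= w_ge3 (ltnW w_ge3).
(* Otherwise [h'] would be a second closing: it meets the union in [v'] and in a vertex of [rest],
   which are distinct. *)
have h'Z : h' \subset cov [:: e, h & rest].
  have [le_w|lt_w] := leqP w #|h' :&: cov [:: e, h & rest]|.
    have /eqP <- : h' :&: cov [:: e, h & rest] == h' by rewrite eqEcard finset.subsetIl (H_unif hH').
    exact: finset.subsetIr.
  have ge2 : (1 < #|h' :&: cov [:: e, h & rest]|)%N.
    have /card_gt0P [a] : (0 < #|h' :&: cov rest|)%N by rewrite hj' j1'.
    rewrite inE => /andP [ah ar]; apply/card_gt1P; exists v', a; split.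
    - by rewrite !cov_cons !inE vh' ve'.
    - by rewrite !cov_cons !inE ah ar !orbT.
    - by apply: contraTneq ar => <-.
  have := @small _ [:: 2; 1] lt_w (ltnW ge2) isT w1 isT t (h' :: e :: h :: rest) ltL'.
  have ehs2 : [:: e, h & rest] \in edge_seqs H (map Meet [:: 2; 1] ++ nseq t Path).
    by rewrite -(cats0 (nseq t Path)); move: ehs; rewrite j1.
  rewrite [_ ++ _]/= edge_seqs_cons ehs2 hH' /= eqxx => /(_ isT).
  by rewrite leqNgt ge2.
have sub_h : h' :\: (e :|: cov rest) \subset h :&: h'.
  apply/fintype.subsetP => x; rewrite !inE negb_or => /andP [/andP [xe xr] xh']; rewrite xh' andbT.
  by move: (fintype.subsetP h'Z x xh'); rewrite !cov_cons !inE (negPf xe) (negPf xr) orbF.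
have card_h'D : #|h' :\: (e :|: cov rest)| = (w - 2)%N.
  rewrite cardsD (H_unif hH') finset.setIUr he' cardsU1 hj' j1'.
  by rewrite inE vh' (negPf vr').
have hh'_ge : (w - 2 <= #|h' :&: h|)%N by rewrite -card_h'D finset.setIC subset_leq_card.
have hh'_lt : (#|h' :&: h| < w)%N.
  rewrite -(H_unif hH'); apply: proper_card; rewrite properE finset.subsetIl /=.
  by apply/fintype.subsetPn; exists v'; rewrite // inE negb_and v'h orbT.
have hh'_gt0 : (0 < #|h' :&: h|)%N by apply: leq_trans hh'_ge; rewrite subn_gt0.
have s_h : [:: h] \in edge_seqs H [::] by rewrite edge_seqs_nil.
have s_h'h : [:: h'; h] \in edge_seqs H [:: Meet #|h' :&: h|].
  by rewrite edge_seqs_cons s_h hH' /= cov1.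
have s_tri : [:: e; h'; h] \in edge_seqs H [:: Meet 2; Meet #|h' :&: h|].
  rewrite edge_seqs_cons s_h'h eH /= cov_cons cov1 finset.setIUr [e :&: h']finset.setIC he' [e :&: h]finset.setIC he.
  by rewrite cards2 [v' == v]eq_sym vv'.
(* [e] meets the union of [h] and [h'] exactly in [v] and [v'], so a larger intersection would be a
   second closing. Together with the lower bound [w - 2] this forces [w = 3]. *)
have hh'1 : #|h' :&: h| = 1%N.
  apply/eqP; rewrite eqn_leq hh'_gt0 andbT leqNgt; apply/negP => i2.
  apply: (@bad [:: 2; #|h' :&: h|] [::] 0 _ L_gt0 isT isT _ _ s_tri).
    by rewrite /letters /= hh'_gt0 hh'_lt w_ge3.
  by rewrite /doubly_closed /= i2.
have w3 : w = 3%N by apply/eqP; rewrite eqn_leq w_ge3 andbT; move: hh'_ge; rewrite hh'1 leq_subLR.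
rewrite hh'1 in s_tri.
have absorb := @closed_absorbs [:: 2; 1] _ _ isT w1 isT s_tri.
have /cards1P [y hy] : #|h' :&: h| == 1%N by rewrite hh'1.
have /cards1P [u eu] : #|e :&: cov rest| == 1%N by rewrite e1.
have [ue ur] : u \in e /\ u \in cov rest by move/setP: eu => /(_ u); rewrite !inE eqxx => /andP.
have [yh' yh] : y \in h' /\ y \in h by move/setP: hy => /(_ y); rewrite !inE eqxx => /andP.
pose T := cov [:: e; h'; h].
have TE x : (x \in T) = [|| x \in e, x \in h' | x \in h] by rewrite /T !cov_cons cov_nil !inE orbF.
have eT : e \subset T by apply/fintype.subsetP => x xe; rewrite TE xe.
apply: (@hitting_pair_colourable T e u y eH eT); rewrite ?TE ?ue ?yh ?orbT //.
move=> g gH gT; have gsT := absorb g gH gT; split => //.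
apply: contraT; rewrite negb_or => /andP [ug yg].
(* an edge avoiding [u] and [y] shares two vertices with [h] or [h'] *)
have e3 x : x \in e -> [|| x == u, x == v | x == v'].
  have : e = [set u; v; v'].
    apply/eqP; rewrite eq_sym eqEcard; apply/andP; split.
      by apply/fintype.subsetP => z; rewrite !inE -orbA => /or3P [] /eqP ->.
    have uv : u != v by apply: contraNneq vr => <-.
    have uv' : u != v' by apply: contraNneq vr' => <-.
    by rewrite (H_unif eH) w3 -finset.setUA cardsU1 cards2 !inE negb_or uv uv' vv'.
  by move=> {1}->; rewrite !inE -orbA.
(* If [g] met [f] twice, the two would be an exactly closed pair absorbing [e] through [z], although
   [u] lies in [e] and in neither of them. *)
have shared f z : f \in H -> y \in f -> u \notin f -> z \in e -> z \in f -> (#|g :&: f| <= 1)%N.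
  move=> fH yf uf ze zf; rewrite leqNgt; apply/negP => gf2.
  have gf : #|g :&: f| = 2%N.
    apply/eqP; rewrite eqn_leq gf2 andbT -ltnS -w3 -(H_unif fH); apply: proper_card.
    rewrite properE finset.subsetIr /=; apply/fintype.subsetPn; exists y => //.
    by rewrite inE (negPf yg).
  have s_gf : [:: g; f] \in edge_seqs H (map Meet [:: 2]).
    by rewrite edge_seqs_cons edge_seqs_nil fH gH /= cov1 gf.
  have l2 : letters [:: 2] by rewrite /letters /= w_ge3.
  have sub := @closed_absorbs [:: 2] _ e isT l2 isT s_gf eH; rewrite cov_cons cov1 in sub.
  have : u \in g :|: f.
    by apply: (fintype.subsetP (sub _)) => //; apply/set0Pn; exists z; rewrite !inE ze zf orbT.
  by rewrite !inE (negPf ug) (negPf uf).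
have uh : u \notin h.
  apply/negP => uh; move/setP: he => /(_ u); rewrite !inE uh ue => /esym/eqP uv.
  by move: vr; rewrite -uv ur.
have uh' : u \notin h'.
  apply/negP => uh'; move/setP: he' => /(_ u); rewrite !inE uh' ue => /esym/eqP uv.
  by move: vr'; rewrite -uv ur.
have gh := shared h v hH yh uh ve vh.
have gh' := shared h' v' hH' yh' uh' ve' vh'.
have : (#|g| <= #|g :&: h| + #|g :&: h'|)%N.
  apply: leq_trans (leq_card_setU _ _); apply/subset_leq_card/fintype.subsetP => x xg.
  have : x \in T by apply: (fintype.subsetP gsT).
  rewrite TE !inE xg /= => /or3P [/e3 /or3P [] /eqP xE|->|->]; rewrite ?orbT //.
  - by move: ug; rewrite -xE xg.
  - by rewrite xE vh.
  - by rewrite xE vh' orbT.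
by move=> le_g; have := leq_trans le_g (leq_add gh gh'); rewrite (H_unif gH) w3.
Qed.

End CriticalHypergraph.

(** * First moments of edge sequences *)

Section ExpectedSequences.

(** [Y] bounds the expected number of edges in the random set, and [x j] the expected number of
    edges completing [j] given vertices. *)
Variables (R : realType) (V : finType) (E : {set {set V}}) (w : nat) (p Y : R) (x : nat -> R).
Hypotheses (E_unif : forall e, e \in E -> #|e| = w) (p_01 : 0 <= p <= 1).
Hypothesis E_card : #|E|%:R * p ^+ w <= Y.
Hypothesis E_deg : forall J : {set V}, (0 < #|J| < w)%N ->
  #|[set e in E | J \subset e]|%:R * p ^+ (w - #|J|) <= x #|J|.
Hypothesis x_ge0 : forall j, 0 <= x j.

Let p_ge0 : 0 <= p. Proof. by case/andP: p_01. Qed.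

Definition expected (tau : seq attach) : R := \sum_(s <- edge_seqs E tau) p ^+ #|cov s|.

Lemma expected_ge0 tau : 0 <= expected tau.
Proof. by apply: sumr_ge0 => s _; rewrite exprn_ge0. Qed.

Lemma expected_nil : expected [::] <= Y.
Proof.
rewrite /expected big_map big_enum /=; apply: le_trans E_card.
rewrite mulr_natl -sumr_const; apply: ler_sum => e eE.
by rewrite cov1 E_unif.
Qed.

Lemma expected_cons k tau : expected (k :: tau) =
  \sum_(s <- edge_seqs E tau) \sum_(e in E | attaches k s e) p ^+ #|e :|: cov s|.
Proof.
rewrite /expected big_allpairs_dep; apply: eq_bigr => s _.
by rewrite big_filter big_enum_cond /=; apply: eq_bigr => e _; rewrite cov_cons.
Qed.

(** Sort the new edges by their trace on the union: each edge adds [w - j] new vertices, and [E_deg]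
    bounds every trace by [x j]. *)
Lemma attach_sum (s : seq {set V}) j (Js : {set {set V}}) (P : pred {set V}) : (0 < j < w)%N ->
  (forall J, J \in Js -> #|J| = j) ->
  (forall e, e \in E -> P e -> e :&: cov s \in Js) ->
  \sum_(e in E | P e) p ^+ #|e :|: cov s| <= #|Js|%:R * x j * p ^+ #|cov s|.
Proof.
move=> jw Jj eJ; apply: (@le_trans _ _ (\sum_(e in E | P e) p ^+ (w - j) * p ^+ #|cov s|)).
  apply: ler_sum => e /andP [eE Pe]; have := eJ e eE Pe => /Jj ej.
  by rewrite cardsU (E_unif eE) ej -exprD addnBAC // -(E_unif eE) -ej subset_leq_card // finset.subsetIl.
rewrite -mulr_suml ler_wpM2r ?exprn_ge0 // mulr_natl -sumr_const.
rewrite (partition_big (fun e => e :&: cov s) (mem Js)) /=; last by move=> e /andP [eE Pe];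
  apply: eJ.
apply: ler_sum => J JJs; have Jw : (0 < #|J| < w)%N by rewrite Jj.
apply: le_trans (_ : _ <= #|[set e in E | J \subset e]|%:R * p ^+ (w - #|J|)) _;
  last by rewrite -[j](Jj J JJs) E_deg.
rewrite (Jj J JJs) mulr_natl -sumr_const big_mkcond [X in _ <= X]big_mkcond; apply: ler_sum => e _.
case: ifP => [/andP [/andP [eE Pe] /eqP <-]|_].
  by rewrite inE eE finset.subsetIl.
by case: ifP => // _; rewrite exprn_ge0.
Qed.

(** The trace lies on the last edge, so it has at most [w] values however long the sequence is; this
    keeps the factor per path edge constant. *)
Lemma expected_Path tau : (1 < w)%N -> expected (Path :: tau) <= w%:R * x 1 * expected tau.
Proof.
move=> w_gt1; rewrite expected_cons /expected mulr_sumr big_seq [X in _ <= X]big_seq.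
apply: ler_sum => s ss; have [e0 [s' [sE e0E _]]] := edge_seqsP ss.
apply: le_trans (@attach_sum s 1 [set [set v] | v in e0] (attaches Path s) w_gt1 _ _) _.
- by move=> _ /imsetP [v _ ->]; rewrite cards1.
- move=> e eE /andP [/cards1P [v ev] /set0Pn [y]]; rewrite ev sE /= inE => /andP [ye y0].
  apply/imsetP; exists v => //; have : y \in [set v] by rewrite -ev inE ye sE cov_cons inE y0.
  by rewrite inE => /eqP <-.
rewrite ler_wpM2r ?exprn_ge0 // ler_wpM2r // ler_nat -(E_unif e0E); exact: leq_imset_card.
Qed.

Lemma card_cov tau s : s \in edge_seqs E tau -> (#|cov s| <= w * (size tau).+1)%N.
Proof.
elim: tau s => [|k tau IH] s /edge_seqsP [e [s' [-> eE]]].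
  by move=> ->; rewrite cov1 (E_unif eE) muln1.
move=> [/IH ss' _]; rewrite cov_cons mulnS /= -{1}(E_unif eE).
by apply: leq_trans (leq_card_setU _ _) _; rewrite leq_add2l.
Qed.

Lemma leq_bin_exp n j : ('C(n, j) <= n ^ j)%N.
Proof.
apply: (@leq_trans (n ^_ j)%N); first by rewrite -bin_ffact leq_pmulr // fact_gt0.
elim: j => [|j IHj]; first by rewrite ffactn0.
by rewrite ffactnSr expnSr leq_mul // leq_subr.
Qed.

Lemma expected_Meet j tau : (0 < j < w)%N ->
  expected (Meet j :: tau) <= ((w * (size tau).+1) ^ j)%:R * x j * expected tau.
Proof.
move=> jw; rewrite expected_cons /expected mulr_sumr big_seq [X in _ <= X]big_seq.
apply: ler_sum => s ss.
apply: le_trans (@attach_sum s j [set J : {set V} | J \subset cov s & #|J| == j] (attaches (Meet j) s) jw _ _) _.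
- by move=> J; rewrite inE => /andP [_ /eqP].
- by move=> e eE /= ej; rewrite inE finset.subsetIr.
rewrite ler_wpM2r ?exprn_ge0 // ler_wpM2r // ler_nat cards_draws.
apply: leq_trans (leq_bin_exp _ _) _; rewrite leq_exp2r ?card_cov //; by case/andP: jw.
Qed.

Hypothesis w_gt1 : (1 < w)%N.

Lemma expected_nseq_Path t tau : expected (nseq t Path ++ tau) <= (w%:R * x 1) ^+ t * expected tau.
Proof.
elim: t => [|t IHt]; first by rewrite mul1r.
by apply: le_trans (expected_Path _ w_gt1) _;
  rewrite exprS -[X in _ <= X]mulrA ler_wpM2l // mulr_ge0.
Qed.

Lemma expected_map_Meet (B : R) T s1 tau : letters w s1 -> (size s1 + size tau < T)%N ->
    ((w * T) ^ w)%:R <= B ->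
  expected (map Meet s1 ++ tau) <= B ^+ size s1 * (\prod_(j <- s1) x j) * expected tau.
Proof.
move=> + + leB; have B_ge0 : 0 <= B by apply: le_trans leB.
elim: s1 => [|j s1 IH] /=; first by rewrite big_nil !mul1r.
move=> /andP [jw ls1] zT; have zT' : (size s1 + size tau < T)%N by apply: ltn_trans zT;
  rewrite addSn.
apply: le_trans (expected_Meet _ jw) _; rewrite big_cons exprS.
have -> : B * B ^+ size s1 * (x j * \prod_(i <- s1) x i) * expected tau =
  B * x j * (B ^+ size s1 * (\prod_(i <- s1) x i) * expected tau) by ring.
apply: ler_pM; rewrite ?mulr_ge0 ?expected_ge0 //; last exact: IH.
rewrite ler_wpM2r //; apply: le_trans leB; rewrite ler_nat size_cat size_map.
apply: (@leq_trans ((w * T) ^ j)%N).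
  by case/andP: jw => j0 _; rewrite leq_exp2r // leq_mul2l zT' orbT.
by rewrite leq_pexp2l ?muln_gt0 ?(ltnW w_gt1) ?(leq_ltn_trans _ zT') //; case/andP: jw => _ /ltnW.
Qed.

Lemma expected_word (B : R) T s1 t s0 : letters w (s1 ++ s0) -> (size s1 + (t + size s0) < T)%N ->
    ((w * T) ^ w)%:R <= B ->
  expected (word s1 t s0) <=
    B ^+ (size s1 + size s0) * (w%:R * x 1) ^+ t * (\prod_(j <- s1 ++ s0) x j) * Y.
Proof.
rewrite /letters all_cat => /andP [l1 l0] zT leB; have B_ge0 : 0 <= B by apply: le_trans leB.
rewrite /word; apply: le_trans (@expected_map_Meet B T _ _ l1 _ leB) _.
  by rewrite size_cat size_nseq size_map.
have zT0 : (size s0 + size ([::] : seq attach) < T)%N by apply: leq_ltn_trans zT;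
  rewrite addn0 addnA leq_addl.
have h0 := @expected_map_Meet B T s0 [::] l0 zT0 leB; rewrite cats0 in h0.
rewrite big_cat /= exprD.
have -> : B ^+ size s1 * B ^+ size s0 * (w%:R * x 1) ^+ t * ((\prod_(i <- s1) x i) * (\prod_(i <- s0) x i)) * Y
  = B ^+ size s1 * (\prod_(i <- s1) x i) * ((w%:R * x 1) ^+ t * (B ^+ size s0 * (\prod_(i <- s0) x i) * Y)) by ring.
have prod_ge0 s : 0 <= \prod_(i <- s) x i by apply: prodr_ge0.
rewrite ler_wpM2l ?mulr_ge0 ?exprn_ge0 //.
apply: le_trans (expected_nseq_Path _ _) _; rewrite ler_wpM2l ?exprn_ge0 ?mulr_ge0 //.
by apply: le_trans h0 _; rewrite ler_wpM2l ?mulr_ge0 ?exprn_ge0 // expected_nil.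
Qed.

Fixpoint short_words n : seq (seq nat) :=
  if n is m.+1 then [::] :: [seq j :: s | j <- iota 1 w, s <- short_words m] else [:: [::]].

Lemma short_words_size n s : s \in short_words n -> (size s <= n)%N.
Proof.
elim: n s => [|n IHn] s /=; first by rewrite inE => /eqP ->.
by rewrite inE => /orP [/eqP -> //|/allpairsP [[j s'] /= [_ /IHn ? ->]]].
Qed.

Lemma mem_short_words n s : letters w s -> (size s <= n)%N -> s \in short_words n.
Proof.
elim: n s => [|n IHn] [|j s] //= /andP [/andP [j0 jw] ls] zs; rewrite inE; apply/orP; right.
by apply/allpairsP; exists (j, s); split => //=; [rewrite mem_iota; lia | apply: IHn].
Qed.

Definition bad_words L : seq (seq attach) :=
  [seq word q.1 t q.2 | q <- [seq q <- [seq (s1, s0) | s1 <- short_words 3, s0 <- short_words 3] |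
    letters w (q.1 ++ q.2) && doubly_closed (q.1 ++ q.2)], t <- iota 0 L].

Definition long_words L : seq (seq attach) :=
  [seq word [::] L s0 | s0 <- [seq s0 <- short_words 3 | letters w s0]].

Lemma not_two_colourable_word L (S : {set V}) : (2 < w)%N ->
  ~~ two_colourable [set e in E | e \subset S] ->
  exists tau s, [/\ tau \in bad_words L ++ long_words L, s \in edge_seqs E tau & cov s \subset S].
Proof.
move=> w_gt2 /exists_critical [H HE Hcrit]; apply: contrapT => none.
have HE' : H \subset E by apply: fintype.subset_trans HE _; apply/fintype.subsetP => e;
  rewrite inE => /andP [].
have nil_word tau : tau \in bad_words L ++ long_words L -> edge_seqs H tau = [::].
  move=> tauW; case Es : (edge_seqs H tau) => [//|s r]; case: none; exists tau, s.
  have [sE sH] : s \in edge_seqs E tau /\ {subset s <= H} by apply: edge_seqs_sub => //;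
    rewrite Es mem_head.
  split => //; rewrite /cov big_seq; apply: (big_ind (fun A : {set V} => A \subset S)).
  - exact: finset.sub0set.
  - by move=> A A' hA hA'; rewrite finset.subUset hA.
  - by move=> e /sH /(fintype.subsetP HE); rewrite inE => /andP [].
apply: (@critical_absurd V H w L w_gt2) => //.
- by move=> e /(fintype.subsetP HE') /E_unif.
- move=> s1 s0 t ltL z1 z0 ls ds; apply: nil_word; rewrite mem_cat; apply/orP; left.
  apply/allpairsPdep; exists (s1, s0), t; split => //; last by rewrite mem_iota.
  rewrite mem_filter; apply/andP; split; first by rewrite ls ds.
  apply/allpairsPdep; exists s1, s0; split => //; apply: mem_short_words => //;
    by move: ls; rewrite /letters all_cat => /andP [].
- move=> s0 z0 ls; apply: nil_word; rewrite mem_cat; apply/orP; right.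
  by apply/mapP; exists s0 => //; rewrite mem_filter ls mem_short_words.
Qed.

Lemma sum_le_size (I : eqType) (r : seq I) (F : I -> R) (M : R) :
  (forall i, i \in r -> F i <= M) -> \sum_(i <- r) F i <= (size r)%:R * M.
Proof.
elim: r => [|i r IH] h; first by rewrite big_nil mul0r.
rewrite big_cons -natr1 mulrDl mul1r addrC lerD ?h ?mem_head //.
by apply: IH => j jr; apply: h; rewrite inE jr orbT.
Qed.

(** One letter 2 yields [z2], a further letter at least 2 yields [z], and the others are at most
    1. *)
Lemma prod_doubly_closed (s : seq nat) (z2 z : R) : 0 <= z -> letters w s -> doubly_closed s ->
    (forall j, (0 < j < w)%N -> x j <= 1) -> x 2 <= z2 -> (forall j, (1 < j < w)%N -> x j <= z) ->
  \prod_(j <- s) x j <= z2 * z.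
Proof.
move=> z_ge0 ls /andP [s2 cnt] x1 x2 xz.
have prod1 r : letters w r -> \prod_(j <- r) x j <= 1.
  move=> lr; rewrite big_seq; apply: prodr_ile1 => j jr; rewrite x_ge0 x1 //.
  by move/allP: lr; apply.
have ls' : letters w (rem 2 s) by apply/allP => j /mem_rem; move/allP: ls; apply.
rewrite (big_rem _ s2) /=; apply: ler_pM => //; first by apply: prodr_ge0.
have : has (leq 2) (rem 2 s).
  by rewrite has_count count_rem s2 /= subn_gt0.
move=> /hasP [j jr j2]; rewrite (big_rem _ jr) /= -[z]mulr1.
have jw : (1 < j < w)%N by rewrite j2 /=; move/allP: ls' => /(_ _ jr)/andP [].
apply: ler_pM => //; [by apply: prodr_ge0 | exact: xz | apply: prod1].
by apply/allP => i /mem_rem; move/allP: ls'; apply.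
Qed.

(** A word has at most six [Meet] letters, hence [B ^+ 6] and the length bound [L + 7]; path factors
    are bounded by 1 in bad words and give [2^-1 ^+ L] in long ones. *)
Lemma prob_not_two_colourable L (z2 z B : R) : (2 < w)%N -> 0 <= z ->
    w%:R * x 1 <= 2^-1 -> (forall j, (0 < j < w)%N -> x j <= 1) -> x 2 <= z2 ->
    (forall j, (1 < j < w)%N -> x j <= z) -> ((w * (L + 7)) ^ w)%:R <= B -> 1 <= B ->
  random_subset_prob p [pred S : {set V} | ~~ two_colourable [set e in E | e \subset S]] <=
    (size (short_words 3) ^ 2 * L)%:R * (B ^+ 6 * (z2 * z) * Y) +
    (size (short_words 3))%:R * (B ^+ 6 * 2^-1 ^+ L * Y).
Proof.
move=> w_gt2 z_ge0 wx1 x_le1 x2 xz leB B_ge1.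
have B_ge0 : 0 <= B by apply: le_trans B_ge1.
have Y_ge0 : 0 <= Y by apply: le_trans E_card; rewrite mulr_ge0 ?exprn_ge0.
have z2_ge0 : 0 <= z2 by apply: le_trans x2.
have X_ge0 t : 0 <= (w%:R * x 1) ^+ t by rewrite exprn_ge0 ?mulr_ge0.
have prod_ge0 (s : seq nat) : 0 <= \prod_(j <- s) x j by apply: prodr_ge0.
pose r := flatten [seq edge_seqs E tau | tau <- bad_words L ++ long_words L].
apply: le_trans (@random_subset_union R V p _ _ r predT
  (fun s => [pred S : {set V} | cov s \subset S]) p_01 _) _.
  move=> S /= /(not_two_colourable_word L w_gt2) [tau [s [tauW sE covS]]].
  apply/hasP; exists s => //; apply/flattenP; exists (edge_seqs E tau) => //.
  exact: map_f.
apply: (@le_trans _ _ (\sum_(s <- r) p ^+ #|cov s|)).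
  by apply: ler_sum => s _; exact: random_subset_prob_sub.
rewrite big_flatten big_map big_cat /=; apply: lerD.
  apply: (@le_trans _ _ ((size (bad_words L))%:R * (B ^+ 6 * (z2 * z) * Y))).
    apply: sum_le_size => tau.
    move=> /allpairsPdep [[s1 s0] [t [+ tL ->]]]; rewrite mem_filter => /andP [/andP [ls ds]].
    move=> /allpairsPdep [s1' [s0' [/short_words_size z1 /short_words_size z0 [e1 e0]]]];
      subst s1' s0'.
    move: tL; rewrite mem_iota add0n => /andP [_ tL].
    apply: le_trans (@expected_word B (L + 7) s1 t s0 ls _ leB) _.
      rewrite addnCA; apply: (@leq_trans (t.+1 + (3 + 3))%N).
        by rewrite addSn ltnS leq_add2l; exact: leq_add.
      by apply: leq_trans (leq_add tL (leqnn _)) _; rewrite leq_add2l.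
    rewrite ler_wpM2r // -mulrA; apply: ler_pM; rewrite ?(mulr_ge0, X_ge0, prod_ge0, exprn_ge0) //.
      by rewrite ler_weXn2l // -[6%N]/(3 + 3)%N; exact: leq_add.
    rewrite -[X in _ <= X]mul1r; apply: ler_pM; rewrite ?(X_ge0, prod_ge0) //.
      by apply: exprn_ile1; rewrite ?mulr_ge0 //; apply: le_trans wx1 _; lra.
    exact: prod_doubly_closed.
  rewrite ler_wpM2r ?mulr_ge0 ?exprn_ge0 // ler_nat size_allpairs size_iota leq_mul2r.
  by rewrite size_filter (leq_trans (count_size _ _)) ?orbT // size_allpairs expnS expn1.
apply: (@le_trans _ _ ((size (long_words L))%:R * (B ^+ 6 * 2^-1 ^+ L * Y))).
  apply: sum_le_size => tau.
  move=> /mapP [s0 + ->]; rewrite mem_filter => /andP [ls /short_words_size z0].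
  apply: le_trans (@expected_word B (L + 7) [::] L s0 ls _ leB) _.
    by rewrite add0n ltn_add2l; exact: leq_ltn_trans z0 _.
  rewrite ler_wpM2r // -[X in _ <= X]mulr1; apply: ler_pM;
    rewrite ?(mulr_ge0, X_ge0, prod_ge0, exprn_ge0) //.
    apply: ler_pM; rewrite ?(X_ge0, exprn_ge0) //; first by rewrite ler_weXn2l // add0n;
      exact: leq_trans z0 _.
    by apply: lerXn2r; rewrite ?nnegrE ?mulr_ge0.
  rewrite big_seq; apply: prodr_ile1 => j jr; rewrite x_ge0 x_le1 //.
  by move/allP: ls; apply.
rewrite ler_wpM2r ?mulr_ge0 ?exprn_ge0 // ler_nat size_map size_filter; exact: count_size.
Qed.

End ExpectedSequences.

(** * The 0-statement: degrees of the projected solutions and the final estimate *)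

Section ZeroStatement.

Variables (R : realType) (G : finZmodType) (l k : nat) (A : 'M[int]_(l, k)) (W : {set 'I_k}).

Section Edges.

Variable n : nat.
Notation T := 'rV[G]_n.
Implicit Types (x : {ffun 'I_k -> T}) (J : {set T}).

Definition edge x : {set T} := [set x i | i in W].

Definition edges : {set {set T}} := edge @: [set x in sol A T | injectiveb x].

Lemma edges_card e : e \in edges -> #|e| = #|W|.
Proof.
move=> /imsetP [x]; rewrite inE => /andP [_ /injectiveP x_inj] ->; exact: card_imset.
Qed.

Definition restr x : {ffun 'I_k -> option T} := [ffun i => if i \in W then Some (x i) else None].

Definition restr_edge (c : {ffun 'I_k -> option T}) : {set T} :=
  [set v | [exists i in W, c i == Some v]].

Lemma restr_edgeE x : restr_edge (restr x) = edge x.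
Proof.
apply/setP => v; rewrite inE; apply/exists_inP/imsetP => [[i iW]|[i iW ->]].
  by rewrite ffunE iW => /eqP [<-]; exists i.
by exists i; rewrite // ffunE iW.
Qed.

Lemma restr_eq x y : (restr x == restr y) = [forall i in W, x i == y i].
Proof.
apply/eqP/forall_inP => [/ffunP xy i iW|xy].
  by have := xy i; rewrite !ffunE iW => -[->].
by apply/ffunP => i; rewrite !ffunE; case: ifP => // iW; rewrite (eqP (xy i iW)).
Qed.

Lemma card_restr_sol (P : pred {ffun 'I_k -> T}) :
    (forall x y : {ffun 'I_k -> T}, {in W, x =1 y} -> P x -> P y) ->
  (#|restr @: [set x in sol A T | P x]| * nsol A T W)%N = #|[set x in sol A T | P x]|.
Proof.
move=> P_W; rewrite -[RHS]sum1_card (partition_big restr (mem (restr @: [set x in sol A T | P x]))) /=; last first.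
  by move=> x xP; exact: imset_f.
rewrite -sum_nat_const; apply: eq_bigr => _ /imsetP [x + ->]; rewrite inE => /andP [xs Px].
rewrite sum1_card -(card_sol_at_sol W xs); apply: eq_card => y.
rewrite [RHS]/in_mem /= restr_eq;
  apply/sol_atP/andP => [[ys yx]|[/finset.setIdP [ys _] /forall_inP yx]].
  split; last by apply/forall_inP => i iW; rewrite yx.
  by apply/finset.setIdP; split => //; apply: P_W Px => i iW; rewrite yx.
by split => // i iW; exact/eqP/yx.
Qed.

(** Choose positions in [W] for the vertices of [J]. For a fixed choice, [nsol] of these positions
    bounds the solutions, and every restriction to [W] comes from [nsol A T W] of them. *)
Lemma card_edges_containing J (b : R) : 0 <= b -> (forall J' : {set 'I_k}, J' \subset W -> #|J'| = #|J| ->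
    (nsol A T J')%:R / (nsol A T W)%:R <= b) ->
  #|[set e in edges | J \subset e]|%:R <= (k ^ #|J|)%:R * b.
Proof.
move=> b_ge0 hb; have nW_gt0 : 0 < ((nsol A T W)%:R : R) by rewrite ltr0n nsol_gt0.
pose P (f : {ffun 'I_#|J| -> 'I_k}) x := [forall a, (f a \in W) && (x (f a) == enum_val a)].
pose X f := restr @: [set x in sol A T | P f x].
have sub : [set e in edges | J \subset e] \subset \bigcup_f restr_edge @: X f.
  apply/fintype.subsetP => e; rewrite inE => /andP [/imsetP [x + ->] /fintype.subsetP Jx].
  rewrite inE => /andP [xs _].
  have /fin_all_exists [f Hf] : forall a : 'I_#|J|, exists i : 'I_k, (i \in W) && (x i == enum_val a).
    by move=> a; have /imsetP [i iW ->] := Jx _ (enum_valP a); exists i; rewrite iW /=.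
  apply/finset.bigcupP; exists (finfun f) => //; apply/imsetP; exists (restr x);
    last by rewrite restr_edgeE.
  by apply: imset_f; rewrite inE xs; apply/forallP => a; rewrite ffunE.
apply: (@le_trans _ _ (\sum_(f : {ffun 'I_#|J| -> 'I_k}) #|X f|%:R)).
  rewrite -natr_sum ler_nat; apply: leq_trans (subset_leq_card sub) _.
  apply: leq_trans (card_bigcup_le _) _; apply: leq_sum => f _; exact: leq_imset_card.
have -> : (k ^ #|J|)%:R * b = \sum_(f : {ffun 'I_#|J| -> 'I_k}) b.
  by rewrite sumr_const card_ffun !card_ord mulr_natl.
apply: ler_sum => f _; have [->//|/card_gt0P [c /imsetP [x]]] := posnP #|X f|.
rewrite inE => /andP [xs /forallP Px] _.
pose J' := [set f a | a : 'I_#|J|].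
have J'W : J' \subset W by apply/fintype.subsetP => _ /imsetP [a _ ->]; have /andP [] := Px a.
have f_inj : injective f.
  move=> a a' faa; apply: enum_val_inj; have /andP [_ /eqP <-] := Px a;
    have /andP [_ /eqP <-] := Px a'.
  by rewrite faa.
have cJ' : #|J'| = #|J| by rewrite card_imset // card_ord.
apply: le_trans (hb J' J'W cJ'); rewrite ler_pdivlMr // -natrM ler_nat card_restr_sol; last first.
  move=> y z yz /forallP Py; apply/forallP => a; have /andP [faW /eqP <-] := Py a.
  by rewrite faW -(yz _ faW) eqxx.
apply: leq_trans (card_sol_at_le A J' x); apply/subset_leq_card/fintype.subsetP => y.
rewrite inE => /andP [ys /forallP Py]; apply/sol_atP; split => // _ /imsetP [a _ ->].
by have /andP [_ /eqP ->] := Py a; have /andP [_ /eqP ->] := Px a.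
Qed.

Lemma rado_not_two_colourable r (S : {set T}) : (1 < r)%N -> (0 < #|W|)%N -> rado A r S ->
  ~~ two_colourable [set e in edges | e \subset S].
Proof.
case: r => [|[|r]] // _ /card_gt0P [i0 i0W] radoS; apply/existsPn => B;
  apply/negP => /proper_colouringP BH.
have /existsP [x /and4P [/forallP xS /existsP [c /forallP xc] x_inj x_sol]] :=
  forallP radoS [ffun v => if v \in B then ord0 else ord_max].
have eS : edge x \in [set e in edges | e \subset S].
  rewrite inE; apply/andP; split; first by apply: imset_f; rewrite !inE x_sol.
  by apply/fintype.subsetP => _ /imsetP [i _ ->].
have [/fintype.subsetPn [_ /imsetP [i iW ->] xiB] /pred0Pn [_ /andP [/imsetP [j jW ->] xjB]]] := BH _ eS.
have := xc i; have := xc j; rewrite !ffunE (negPf xiB) (_ : x j \in B) // => /eqP <-.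
by [].
Qed.

End Edges.

Lemma poly_exp_bounded (D : nat) (a : R) : 0 < a ->
  exists2 C : R, 0 < C & forall n : nat, n.+1%:R ^+ D * expR (- (a * n%:R)) <= C.
Proof.
move=> a_gt0; elim: D a a_gt0 => [|D IHD] a a_gt0.
  by exists 1 => // n; rewrite expr0 mul1r -[leRHS]expR0 ler_expR oppr_le0 mulr_ge0 // ltW.
have a2_gt0 : 0 < a / 2 by rewrite divr_gt0.
have [C C_gt0 HC] := IHD _ a2_gt0.
exists (C * (1 + (a / 2)^-1)) => [|n]; first by rewrite mulr_gt0 // ltr_wpDr // invr_ge0 ltW.
have -> : expR (- (a * n%:R)) = expR (- (a / 2 * n%:R)) * expR (- (a / 2 * n%:R)).
  by rewrite -expRD; congr expR; field.
rewrite exprSr mulrACA; apply: ler_pM; rewrite ?mulr_ge0 ?exprn_ge0 ?expR_ge0 //.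
rewrite expRN ler_pdivrMr ?expR_gt0 //.
apply: (@le_trans _ _ ((1 + (a / 2)^-1) * (1 + a / 2 * n%:R))); last first.
  by rewrite ler_wpM2l ?expR_ge1Dx // addr_ge0 // invr_ge0 ltW.
have -> : (1 + (a / 2)^-1) * (1 + a / 2 * n%:R) = n.+1%:R + (a / 2 * n%:R + (a / 2)^-1).
  by rewrite -natr1; field; rewrite gt_eqF.
by rewrite lerDl addr_ge0 ?mulr_ge0 ?invr_ge0 // ltW.
Qed.

Lemma poly_geometric_lim0 (D : nat) (eta : R) : 0 < eta < 1 ->
  (n.+1%:R ^+ D * eta ^+ n @[n --> \oo] --> (0 : R))%classic.
Proof.
move=> /andP [eta_gt0 eta_lt1]; pose a := - ln eta / 2.
have a_gt0 : 0 < a by rewrite divr_gt0 // oppr_gt0 ln_lt0 // eta_gt0.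
have etaE n : eta ^+ n = expR (- (a * n%:R)) * expR (- a) ^+ n.
  rewrite -expRM_natl -expRD -[eta in LHS]lnK ?posrE // -expRM_natl; congr expR.
  by rewrite /a; field.
have [C C_gt0 HC] := poly_exp_bounded D a_gt0.
apply: (@squeeze_cvgr _ _ _ _ (fun=> 0) (fun n => C * expR (- a) ^+ n)).
- near=> n; rewrite mulr_ge0 ?exprn_ge0 ?(ltW eta_gt0) //= etaE mulrA.
  by rewrite ler_wpM2r ?exprn_ge0 ?expR_ge0.
- exact: cvg_cst.
- rewrite -[X in (_ --> X)%classic](mulr0 C); apply: cvgM; first exact: cvg_cst.
  by apply: cvg_expr; rewrite ger0_norm ?expR_ge0 // -expR0 ltr_expR oppr_lt0.
Unshelve. all: by end_near. Qed.

Variable u : R.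
Hypotheses (g_gt1 : (1 < #|G|)%N) (u_01 : 0 < u < 1) (ug_gt1 : 1 < u * #|G|%:R).
Hypotheses (W_gt2 : (2 < #|W|)%N)
  (nsol_le : forall J : {set 'I_k}, (0 < #|J|)%N ->
     (nsol A G J)%:R * #|G|%:R <= #|sol A G|%:R * u ^+ #|J|.-1)
  (nsol_pair : forall J : {set 'I_k}, #|J| = 2%N -> (nsol A G J * #|G| ^ 2 = #|sol A G|)%N)
  (nsol_W : (nsol A G W)%:R * #|G|%:R = #|sol A G|%:R * u ^+ #|W|.-1)
  (nsol_lt : forall J : {set 'I_k}, J \proper W -> (1 < #|J|)%N ->
     (nsol A G J)%:R * #|G|%:R < #|sol A G|%:R * u ^+ #|J|.-1).

Let u_gt0 : 0 < u. Proof. by case/andP: u_01. Qed.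
Let g_gt0 : 0 < (#|G|%:R : R). Proof. by rewrite ltr0n ltnW. Qed.
Let w := #|W|.

Lemma sol_gt0 : 0 < (#|sol A G|%:R : R).
Proof. by rewrite -nsol0 ltr0n nsol_gt0. Qed.

(* [rho J ^+ n] is the expected number of edges through [#|J|] given vertices in
   the positions [J], up to constants, at [p = u ^+ n]. *)
Definition rho (J : {set 'I_k}) : R := (nsol A G J)%:R * u ^+ (w - #|J|) / (nsol A G W)%:R.

Lemma rhoE (J : {set 'I_k}) : (0 < #|J|)%N -> J \subset W ->
  rho J = (nsol A G J)%:R * #|G|%:R / (#|sol A G|%:R * u ^+ #|J|.-1).
Proof.
move=> J0 JW; have le_Jw : (#|J| <= w)%N by exact: subset_leq_card.
have nW : (nsol A G W)%:R = #|sol A G|%:R * u ^+ #|W|.-1 / #|G|%:R :> R.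
  by rewrite -nsol_W mulfK // gt_eqF.
rewrite /rho nW; have -> : #|W|.-1 = ((w - #|J|) + #|J|.-1)%N.
  by rewrite /w -subn1 -[#|J|.-1]subn1 addnBA // subnK.
by rewrite exprD; field; rewrite !gt_eqF ?exprn_gt0 ?sol_gt0.
Qed.

Lemma rho_set0 : rho finset.set0 = u * #|G|%:R.
Proof.
have nW : (nsol A G W)%:R = #|sol A G|%:R * u ^+ #|W|.-1 / #|G|%:R :> R.
  by rewrite -nsol_W mulfK // gt_eqF.
rewrite /rho nW cards0 subn0 nsol0 /w -[in X in X / _](prednK (ltnW (ltnW W_gt2))) exprS.
by field; rewrite !gt_eqF ?exprn_gt0 ?sol_gt0.
Qed.

Lemma rho_le1 (J : {set 'I_k}) : (0 < #|J|)%N -> J \subset W -> rho J <= 1.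
Proof.
by move=> J0 JW; rewrite rhoE // ler_pdivrMr ?mulr_gt0 ?exprn_gt0 ?sol_gt0 // mul1r nsol_le.
Qed.

Lemma rho_pair (J : {set 'I_k}) : #|J| = 2%N -> J \subset W -> rho J = (u * #|G|%:R)^-1.
Proof.
move=> J2 JW; rewrite rhoE ?J2 // expr1 -(nsol_pair J2) natrM natrX.
by field; rewrite !gt_eqF // ltr0n nsol_gt0.
Qed.

(** One base below 1 for all sources of decay: overlaps in proper subsets of [W], closing in a pair,
    and long paths, for which it is at least one half. *)
Lemma exists_eta : exists eta : R, [/\ 0 < eta < 1, 2^-1 <= eta, (u * #|G|%:R)^-1 <= eta &
  forall J : {set 'I_k}, J \proper W -> (1 < #|J|)%N -> rho J <= eta].
Proof.
pose e0 : R := Num.max 2^-1 (u * #|G|%:R)^-1.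
pose eta := \big[Num.max/e0]_(J : {set 'I_k} | (J \proper W) && (1 < #|J|)%N) rho J.
have le0 : e0 <= eta by exact: bigmax_ge_id.
have e0_half : 2^-1 <= e0 by rewrite le_max lexx.
exists eta; split.
- apply/andP; split; first by apply: lt_le_trans (le_trans e0_half le0); rewrite invr_gt0.
  apply/bigmax_ltP; split; first by rewrite gt_max invf_lt1 // ltr1n invf_lt1 // mulr_gt0.
  move=> J /andP [JW J2]; rewrite rhoE ?(ltnW J2) ?proper_sub //.
  by rewrite ltr_pdivrMr ?mulr_gt0 ?exprn_gt0 ?sol_gt0 // mul1r nsol_lt.
- exact: le_trans le0.
- by apply: le_trans le0; rewrite le_max lexx orbT.
- by move=> J JW J2; apply: le_bigmax_cond; rewrite JW.
Qed.

Lemma edge_degree (n : nat) (p c b : R) (J : {set 'rV[G]_n}) :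
    0 <= p <= c * u ^+ n -> 0 <= c -> 0 <= b -> (#|J| < w)%N ->
    (forall J' : {set 'I_k}, J' \subset W -> #|J'| = #|J| -> rho J' <= b) ->
  #|[set e in edges n | J \subset e]|%:R * p ^+ (w - #|J|) <=
    (k ^ #|J|)%:R * b ^+ n * c ^+ (w - #|J|).
Proof.
move=> /andP [p0 pc] c0 b0 Jw hb; set m := (w - #|J|)%N.
have um : 0 < u ^+ m by rewrite exprn_gt0.
apply: (@le_trans _ _ ((k ^ #|J|)%:R * (b / u ^+ m) ^+ n * (c * u ^+ n) ^+ m)).
  apply: ler_pM; rewrite ?exprn_ge0 //; last by apply: lerXn2r; rewrite ?nnegrE // (le_trans p0).
  apply: card_edges_containing; first by rewrite exprn_ge0 ?divr_ge0 ?(ltW um).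
  move=> J' J'W cJ'; rewrite !nsol_row !natrX -expr_div_n.
  apply: lerXn2r; rewrite ?nnegrE ?divr_ge0 ?(ltW um) //.
  rewrite ler_pdivlMr //; apply: le_trans (hb J' J'W cJ'); rewrite /rho cJ' -/m.
  by rewrite le_eqVlt; apply/orP; left; apply/eqP; rewrite mulrAC.
rewrite le_eqVlt; apply/orP; left; apply/eqP.
rewrite expr_div_n exprMn -!exprM [(m * n)%N]mulnC.
have : u ^+ (n * m) != 0 by rewrite gt_eqF // exprn_gt0.
move: (u ^+ _) (b ^+ n) (c ^+ m) ((k ^ _)%:R : R) => a1 a2 a3 a4 a1_neq0; by field.
Qed.

Theorem zero_statement (r : nat) : (1 < r)%N ->
  exists2 c : R, 0 < c & forall p : nat -> R, (forall n, 0 <= p n <= 1) ->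
    (\forall n \near \oo, p n <= c * u ^+ n)%classic ->
    (random_subset_prob (p n) (@rado 'rV[G]_n l k A r) @[n --> \oo] --> (0 : R))%classic.
Proof.
move=> r_gt1; have [eta [eta01 eta_half eta_ug eta_rho]] := exists_eta.
have /andP [eta_gt0 eta_lt1] := eta01.
have w_gt0 : (0 < w)%N by apply: ltn_trans W_gt2.
have wk : (w <= k)%N by have := max_card (mem W); rewrite card_ord.
have k_gt0 : (0 < k)%N by apply: leq_trans wk.
have k_gt0' : 0 < (k%:R : R) by rewrite ltr0n.
(* One factor [k] pays for the position of a vertex in an edge and one for the choice of a vertex on
   the last edge; a path step then costs at most 1/2. *)
pose c : R := (2 * (k ^ 2)%:R)^-1.
have k2_ge1 : 1 <= ((k ^ 2)%:R : R) by rewrite ler1n expn_gt0 k_gt0.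
have c_gt0 : 0 < c by rewrite invr_gt0 mulr_gt0 // (lt_le_trans ltr01).
have c_le1 : c <= 1 by rewrite invf_le1 ?mulr_gt0 ?(lt_le_trans ltr01) //; lra.
have kc : k%:R * (k%:R * c) = 2^-1 by rewrite /c natrX; field; rewrite gt_eqF.
exists c => // p p01 pc.
(* Long enough for [2^-1 ^+ Lr n] to beat the number [(u * #|G|%:R) ^+ n] of starting edges. *)
pose Lr n := (2 * #|G| * n)%N.
pose sw := size (short_words w 3).
pose B n : R := ((w * (Lr n + 7)) ^ w)%:R.
pose K : R := ((w * (2 * #|G| + 7)) ^ w)%:R ^+ 6 * ((sw ^ 2 * (2 * #|G|))%:R * ((k ^ 2)%:R * (k ^ w)%:R) + sw%:R).
apply: (@squeeze_cvgr _ _ _ _ (fun=> 0) (fun n => K * (n.+1%:R ^+ (w * 6).+1 * eta ^+ n)));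
  last first.
- rewrite -[X in (_ --> X)%classic](mulr0 K); apply: cvgM; first exact: cvg_cst.
  exact: poly_geometric_lim0.
- exact: cvg_cst.
have small : (\forall n \near \oo, (k ^ w)%:R * eta ^+ n < 1)%classic.
  have lim : ((k ^ w)%:R * eta ^+ n @[n --> \oo] --> (0 : R))%classic.
    rewrite -[X in (_ --> X)%classic](mulr0 (k ^ w)%:R); apply: cvgM; first exact: cvg_cst.
    by apply: cvg_expr; rewrite ger0_norm // ltW.
  exact: (cvgr_lt _ lim).
near=> n.
rewrite random_subset_prob_ge0 //=.
have pn : 0 <= p n <= c * u ^+ n.
  by have /andP [-> _] := p01 n; near: n.
have kw1 : (k ^ w)%:R * eta ^+ n <= 1 by apply/ltW; near: n.
have ug_gt0 : 0 < u * #|G|%:R by rewrite mulr_gt0.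
pose Y : R := (u * #|G|%:R) ^+ n.
have Y_gt0 : 0 < Y by rewrite exprn_gt0.
pose z : R := (k ^ w)%:R * eta ^+ n.
pose z2 : R := (k ^ 2)%:R * Y^-1.
have z_ge0 : 0 <= z by rewrite mulr_ge0 // exprn_ge0 // ltW.
have z2_ge0 : 0 <= z2 by rewrite mulr_ge0 // invr_ge0 ltW.
have z2z : z2 <= z.
  apply: ler_pM; rewrite ?invr_ge0 ?(ltW Y_gt0) //.
    by rewrite ler_nat leq_pexp2l // ltnW.
  by rewrite /Y -exprVn; apply: lerXn2r; rewrite ?nnegrE ?invr_ge0 // ltW.
pose x j : R := if j == 1%N then k%:R * c else if j == 2%N then z2 else z.
have x_ge0 j : 0 <= x j.
  by rewrite /x; case: ifP => _; [rewrite mulr_ge0 // ltW | case: ifP].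
have E_card : #|edges n|%:R * p n ^+ w <= Y.
  have := @edge_degree n (p n) c (u * #|G|%:R) finset.set0 pn (ltW c_gt0) (ltW ug_gt0).
  rewrite cards0 subn0 expn0 mul1r => /(_ w_gt0) h.
  have -> : edges n = [set e in edges n | finset.set0 \subset e].
    by apply/setP => e; rewrite [RHS]finset.in_set finset.sub0set andbT.
  apply: le_trans (h _) _.
    by move=> J' _ /eqP; rewrite cards_eq0 => /eqP ->; rewrite rho_set0.
  by rewrite ler_piMr ?(ltW Y_gt0) // exprn_ile1 // ltW.
have E_deg (J : {set 'rV[G]_n}) : (0 < #|J| < w)%N ->
    #|[set e in edges n | J \subset e]|%:R * p n ^+ (w - #|J|) <= x #|J|.
  move=> /andP [J0 Jw]; have cw_le : c ^+ (w - #|J|) <= c.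
    by rewrite -[X in _ <= X]expr1 ler_wiXn2l ?(ltW c_gt0) // subn_gt0.
  have cw_le1 : c ^+ (w - #|J|) <= 1 by apply: le_trans c_le1.
  have cw_ge0 : 0 <= c ^+ (w - #|J|) by rewrite exprn_ge0 // ltW.
  rewrite /x; case: eqP => [J1|/eqP J1].
    apply: le_trans (@edge_degree n (p n) c 1 J pn (ltW c_gt0) ler01 Jw _) _.
      by move=> J' J'W cJ'; apply: rho_le1 => //; rewrite cJ'.
    by rewrite expr1n mulr1 J1 expn1 ler_wpM2l // -J1.
  case: eqP => [J2|/eqP J2].
    apply: le_trans (@edge_degree n (p n) c (u * #|G|%:R)^-1 J pn (ltW c_gt0) _ Jw _) _.
    - by rewrite invr_ge0 ltW.
    - by move=> J' J'W cJ'; rewrite rho_pair // cJ'.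
    by rewrite J2 exprVn -/Y -/z2 -J2 ler_piMr.
  apply: le_trans (@edge_degree n (p n) c eta J pn (ltW c_gt0) (ltW eta_gt0) Jw _) _.
    move=> J' J'W cJ'; apply: eta_rho; last by rewrite cJ' ltn_neqAle eq_sym J1.
    by rewrite properEcard J'W cJ'.
  rewrite -[X in _ <= X]mulr1; apply: ler_pM => //; first by rewrite mulr_ge0 ?exprn_ge0 // ltW.
  rewrite ler_wpM2r ?exprn_ge0 ?(ltW eta_gt0) // ler_nat leq_pexp2l // ltnW //.
have x1w : w%:R * x 1 <= 2^-1.
  by rewrite /x eqxx -kc ler_wpM2r ?ler_nat // mulr_ge0 // ltW.
have x_z j : (1 < j < w)%N -> x j <= z.
  by move=> /andP [j1 _]; rewrite /x gtn_eqF //; case: ifP.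
have x_le1 j : (0 < j < w)%N -> x j <= 1.
  move=> /andP [j0 jw]; have [j1|j1] := leqP j 1.
    have -> : j = 1%N by apply/eqP; rewrite eqn_leq j1.
    apply: le_trans (_ : _ <= k%:R * (k%:R * c)) _; last by rewrite kc invf_le1 // ler1n.
    by rewrite /x eqxx ler_peMl ?ler1n // mulr_ge0 // ltW.
  by apply: le_trans (x_z j _) kw1; rewrite j1.
have B_ge1 : 1 <= B n by rewrite ler1n expn_gt0 muln_gt0 w_gt0 addn_gt0 orbT.
have x2 : x 2 <= z2 by [].
(* Monotonicity of the probability, as a union bound with one event. *)
apply: le_trans (_ : _ <= random_subset_prob (p n)
    [pred S : {set 'rV[G]_n} | ~~ two_colourable [set e in edges n | e \subset S]]) _.
  have := @random_subset_union R _ (p n) (@rado 'rV[G]_n l k A r) unit [:: tt] predT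
    (fun=> [pred S : {set 'rV[G]_n} | ~~ two_colourable [set e in edges n | e \subset S]]) (p01 n).
  rewrite big_seq1; apply => S radoS /=; rewrite orbF.
  exact: rado_not_two_colourable radoS.
apply: le_trans (@prob_not_two_colourable R _ (edges n) w (p n) Y x (@edges_card n) (p01 n)
  E_card E_deg x_ge0 (ltnW W_gt2) (Lr n) z2 z (B n) W_gt2 z_ge0 x1w x_le1 x2 x_z (lexx _) B_ge1) _.
rewrite -/sw.
have B_le : B n <= ((w * (2 * #|G| + 7)) ^ w)%:R * n.+1%:R ^+ w.
  rewrite -natrX -natrM ler_nat -expnMn leq_exp2r // -mulnA leq_mul2l; apply/orP; right.
  by rewrite /Lr mulnDl leq_add // ?leq_mul2l ?leqnSn ?orbT // leq_pmulr.
have B6_le : B n ^+ 6 <= ((w * (2 * #|G| + 7)) ^ w)%:R ^+ 6 * n.+1%:R ^+ (w * 6).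
  by rewrite exprM -exprMn; apply: lerXn2r;
    rewrite ?nnegrE ?mulr_ge0 ?exprn_ge0 // (le_trans ler01).
have n1_ge1 : 1 <= (n.+1%:R : R) by rewrite ler1n.
have half_base : 2^-1 ^+ (2 * #|G|) * (u * #|G|%:R) <= eta.
  rewrite exprVn mulrC ler_pdivrMr ?exprn_gt0 //.
  apply: le_trans (_ : _ <= 2^-1 * 2 ^+ (2 * #|G|)) _; last by rewrite ler_pM2r ?exprn_gt0.
  apply: le_trans (_ : _ <= #|G|%:R) _; first by rewrite ler_piMl // ltW //; case/andP: u_01.
  rewrite mulrC ler_pdivlMr // -natrM -natrX ler_nat mulnC.
  exact/ltnW/ltn_expl.
have half_Y : 2^-1 ^+ Lr n * Y <= eta ^+ n.
  rewrite /Lr exprM /Y -exprMn; apply: lerXn2r; rewrite ?nnegrE ?(ltW eta_gt0) //.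
  by rewrite mulr_ge0 ?exprn_ge0 ?invr_ge0 // ltW.
(* The closing in exactly two vertices, [z2], cancels [Y]; the other closing leaves [eta ^+ n]
   against a polynomial in [n]. *)
have first_eq : (sw ^ 2 * Lr n)%:R * (B n ^+ 6 * (z2 * z) * Y) =
    (sw ^ 2 * Lr n)%:R * ((k ^ 2)%:R * (k ^ w)%:R) * (B n ^+ 6 * eta ^+ n).
  have cancel (a1 a2 a3 a4 a5 a6 : R) : a3 != 0 ->
    a6 * (a1 * (a4 * a3^-1 * (a5 * a2)) * a3) = a6 * (a4 * a5) * (a1 * a2) by move=> a3_neq0; field.
  by apply: cancel; rewrite gt_eqF.
pose b6 : R := ((w * (2 * #|G| + 7)) ^ w)%:R ^+ 6.
have eta_n : 0 <= eta ^+ n by rewrite exprn_ge0 // ltW.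
have B6_ge0 : 0 <= B n ^+ 6 by rewrite exprn_ge0 // (le_trans ler01).
pose X : R := b6 * n.+1%:R ^+ (w * 6) * eta ^+ n.
have X_ge0 : 0 <= X by apply: mulr_ge0 => //; apply: mulr_ge0; rewrite exprn_ge0.
have BX : B n ^+ 6 * eta ^+ n <= X by exact: (ler_wpM2r eta_n B6_le).
have -> : K * (n.+1%:R ^+ (w * 6).+1 * eta ^+ n) =
    (sw ^ 2 * (2 * #|G|))%:R * n.+1%:R * ((k ^ 2)%:R * (k ^ w)%:R) * X + sw%:R * (n.+1%:R * X).
  have regroup (a1 a2 a3 a4 a5 a6 a7 : R) : a1 * (a6 * (a4 * a5) + a7) * (a2 * a3 * eta ^+ n) =
    a6 * a2 * (a4 * a5) * (a1 * a3 * eta ^+ n) + a7 * (a2 * (a1 * a3 * eta ^+ n)) by ring.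
  by rewrite /X /K -/b6 exprS; exact: regroup.
rewrite first_eq; apply: lerD.
  apply: ler_pM; rewrite ?mulr_ge0 //; rewrite ler_wpM2r ?mulr_ge0 // -natrM ler_nat /Lr mulnA.
  by rewrite leq_mul2l leqnSn orbT.
rewrite ler_wpM2l // -mulrA; apply: le_trans (_ : _ <= X) _; last by rewrite ler_peMl.
by apply: le_trans BX; rewrite ler_wpM2l.
Unshelve. all: by end_near. Qed.

End ZeroStatement.

Local Open Scope classical_set_scope.
Local Open Scope ring_scope.

Theorem theorem5p3 (R : realType) (G : finZmodType) (s : nat)
    (hs : is_exponent G s) (l k : nat) (A : 'M[int]_(l, k))
    (hcol : s_columns_condition s A) (hrank : 0 < rankG R G A)
    (hab : abundant R G A) (r : nat) (hr : (2 <= r)%N) :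
  exists C c : R, [/\ 0 < C, 0 < c &
    forall p : nat -> R, (forall n : nat, 0 <= p n <= 1) ->
      ((\forall n \near \oo,
          p n <= c * (#|G|%:R : R) `^ (- (n%:R / mG R G A))) ->
       random_subset_prob (p n) (@rado 'rV[G]_n l k A r) @[n --> \oo]
         --> (0 : R)) /\
      ((\forall n \near \oo,
          C * (#|G|%:R : R) `^ (- (n%:R / mG R G A)) <= p n) ->
       random_subset_prob (p n) (@rado 'rV[G]_n l k A r) @[n --> \oo]
         --> (1 : R))].
Proof.
have [u [/andP [u_gt0 u_lt1] ug_gt1 uE nsol_le [W [W_gt2 nsol_W nsol_lt]]]] :=
  threshold_exponent hs hcol hrank hab.
have u_01 : 0 < u < 1 by rewrite u_gt0.
have [g_gt1 im_gt1] := rankG_gt0 hrank.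
have [s_gt1 Gs] := exponent_gt1 hs g_gt1.
have k_gt1 := columns_im s_gt1 Gs hcol im_gt1.
have nsol_pair J := @abundant_nsol2 R G l k A J g_gt1 hab.
have [C C_gt0 HC] := one_statement u_gt0 g_gt1 nsol_le u_lt1 ug_gt1 (ltnW k_gt1)
  (ltnW hr) s_gt1 Gs hcol.
have [c c_gt0 Hc] := zero_statement g_gt1 u_01 ug_gt1 W_gt2 nsol_le nsol_pair nsol_W nsol_lt hr.
exists C, c; split => // p p01; split => hp.
  by apply: Hc => //; apply: filterS hp => n; rewrite uE.
by apply: HC => //; apply: filterS hp => n; rewrite uE.
Qed.
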